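(* Let $Y$ be a Lévy process in $\mathbb{R}^d$. The following are equivalent: (D1) There are $T_1,c_1>0$ such that the density $p(t,x)$ of $Y_t$ exists for all $t>T_1$ and $\sup_{x}p(t,x)\le c_1[h^{-1}(1/t)]^{-d}$ for $t>T_1$. (D2) There are $T_2,c_2>0$ such that $\int_{\mathbb{R}^d}e^{-t\,\mathrm{Re}[\Psi(z)]}dz\le c_2[h^{-1}(1/t)]^{-d}$ for all $t>T_2$. (D3) There are $T_3>0$, $c_3\in(0,1]$, $\alpha_3\in(0,2]$ such that $c_3\Psi^*(|x|)\le\mathrm{Re}[\Psi(x)]$ for all $|x|<1/T_3$ and $\Psi^*(\lambda r)\le c_3^{-1}\lambda^{\alpha_3}\Psi^*(r)$ for all $\lambda\le1$, $r<1/T_3$; and $e^{-t_0\Psi}\in L^1(\mathbb{R}^d)$ for some $t_0>0$. (D4) There are $T_4>0$, $c_4\in[1,\infty)$ such that for all $|x|<1/T_4$, $\Psi^*(|x|)\le c_4\big(\langle x,Ax\rangle+\int_{|\langle x,z\rangle|<1}|\langle x,z\rangle|^2N(dz)\big)$; and $e^{-t_0\Psi}\in L^1(\mathbb{R}^d)$ for some $t_0>0$.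
   Context: $Y$ has generating triplet $(A,N,b)$ ($A$ symmetric non-negative definite matrix, $b\in\mathbb{R}^d$, $N$ Lévy measure) and characteristic exponent $\Psi$, $\mathbb{E}e^{i\langle x,Y_t\rangle}=e^{-t\Psi(x)}$. For $r>0$: $h(r)=r^{-2}\|A\|+\int(1\wedge|x|^2/r^2)N(dx)$, $\Psi^*(r)=\sup_{|z|\le r}\mathrm{Re}\,\Psi(z)$. Standing assumption $h(0^+)=\infty$; $h$ is continuous and strictly decreasing from $\infty$ to $0$ and $h^{-1}$ is its inverse. *)

(* Defs.v *)
From HB Require Import structures.
From mathcomp Require Import all_boot all_order all_algebra.
From mathcomp Require Import all_classical all_reals all_analysis.
Set Implicit Arguments.
Unset Strict Implicit.
Unset Printing Implicit Defensive.
Import Order.TTheory GRing.Theory Num.Theory numFieldNormedType.Exports.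
Local Open Scope classical_set_scope.
Local Open Scope ring_scope.

(** R^d is modelled as [d.-tuple R], which mathcomp-analysis equips with the
    product sigma-algebra generated by the coordinate projections (= Borel
    sigma-algebra of R^d). *)

(** Lebesgue integral over R^d of a function with values in \bar R,
    written as the iterated one-dimensional Lebesgue integral
    (by Tonelli this is the d-dimensional Lebesgue integral for every
    nonnegative measurable integrand, which is the only use made of it). *)
Fixpoint leb_int (R : realType) (n : nat) :
    (n.-tuple R -> \bar R) -> \bar R :=
  match n return (n.-tuple R -> \bar R) -> \bar R with
  | 0 => fun f => f [tuple]
  | m.+1 => fun f =>
      (\int[@lebesgue_measure R]_x leb_int (fun y : m.-tuple R => f [tuple of x :: y]))%E
  end.

Section levy.
Variables (R : realType) (d : nat).

Definition ip (x y : d.-tuple R) : R := \sum_(i < d) tnth x i * tnth y i.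
Definition vnorm (x : d.-tuple R) : R := Num.sqrt (ip x x).
Definition vzero : d.-tuple R := [tuple (0 : R) | i < d].

Definition quadA (A : 'M[R]_d) (x : d.-tuple R) : R :=
  \sum_(i < d) \sum_(j < d) tnth x i * A i j * tnth x j.

Definition sym_nonneg_def (A : 'M[R]_d) : Prop :=
  A^T = A /\ forall x, 0 <= quadA A x.

(** Operator norm ||A||; for symmetric non-negative definite A it equals
    sup_{|x| <= 1} <x, A x>. *)
Definition opnorm (A : 'M[R]_d) : R :=
  sup [set quadA A x | x in [set x | vnorm x <= 1]].

Definition levy_measure (N : {measure set (d.-tuple R) -> \bar R}) : Prop :=
  N [set vzero] = 0%E /\
  (\int[N]_x (Num.min 1 (vnorm x ^+ 2))%:E < +oo)%E.

(** Characteristic exponent Psi of the generating triplet (A, N, b)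
    (Sato's convention: E e^{i<z,Y_t>} = e^{-t Psi(z)},
     Psi(z) = 1/2 <z,Az> - i<b,z>
              - \int (e^{i<z,x>} - 1 - i<z,x> 1_{|x|<=1}(x)) N(dx)),
    given by its real and imaginary parts. *)
Definition RePsi (A : 'M[R]_d) (N : {measure set (d.-tuple R) -> \bar R})
  (z : d.-tuple R) : R :=
  quadA A z / 2 + fine (\int[N]_x (1 - cos (ip z x))%:E).

Definition ImPsi (N : {measure set (d.-tuple R) -> \bar R}) (b z : d.-tuple R) : R :=
  - ip b z
  - Rintegral N setT
      (fun x => sin (ip z x) - ip z x * \1_[set y | vnorm y <= 1] x).

Definition PsiStar A N (r : R) : R :=
  sup [set RePsi A N z | z in [set z | vnorm z <= r]].

Definition hfun A (N : {measure set (d.-tuple R) -> \bar R}) (r : R) : R :=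
  r ^- 2 * opnorm A +
  fine (\int[N]_x (Num.min 1 (vnorm x ^+ 2 / r ^+ 2))%:E).

(** Inverse of h: under the standing assumption h is a continuous strictly
    decreasing bijection (0,oo) -> (0,oo), and for s > 0 this is h^{-1}(s). *)
Definition hinv A N (s : R) : R := sup [set r | 0 < r /\ s <= hfun A N r].

(** The random vectors Y_t (t >= 0) have characteristic functions
    E e^{i<z,Y_t>} = e^{-t Psi(z)}
                   = e^{-t Re Psi(z)} (cos (t Im Psi(z)) - i sin (t Im Psi(z))). *)
Definition has_char_exponent (dT : measure_display) (T : measurableType dT)
  (P : probability T R) (Y : R -> {RV P >-> d.-tuple R})
  A N (b : d.-tuple R) : Prop :=
  forall t, 0 <= t -> forall z : d.-tuple R,
    (\int[P]_w (cos (ip z (Y t w)))%:E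
       = (expR (- (t * RePsi A N z)) * cos (t * ImPsi N b z))%:E)%E /\
    (\int[P]_w (sin (ip z (Y t w)))%:E
       = (- (expR (- (t * RePsi A N z)) * sin (t * ImPsi N b z)))%:E)%E.

End levy.

(* Main.v *)
Require Import Defs.
From HB Require Import structures.
From mathcomp Require Import all_boot all_order all_algebra.
From mathcomp Require Import all_classical all_reals all_analysis.
From mathcomp Require Import measurable_realfun ring lra.
Set Implicit Arguments.
Unset Strict Implicit.
Import Order.TTheory GRing.Theory Num.Theory numFieldNormedType.Exports.
Local Open Scope classical_set_scope.
Local Open Scope ring_scope.

(** Put g(r) = h(1/r) and H(x) = <x,Ax> + int min(1, <x,z>^2) N(dz), and let
    U(x) be the right-hand side of (D4) without its constant.  Bounds on 1 - cos
    and averaging u |-> Re Psi(u x) against exp(-|u|) give Re Psi(x) <= 2 g(|x|),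
    H(x) <= 66 Psi^*(|x|) and g <= C Psi^*.

    Lower bound for the integral in (D2): on disjoint translates k x0 + Q, k < K,
    of a small cube Q, subadditivity of the square root of Re Psi keeps Re Psi
    of order K^2 Re Psi(x0) + sup_Q Re Psi, so the integral is at least
    K |Q| exp(-C t (K^2 Re Psi(x0) + sup_Q Re Psi)).

    (D1) => (D2): with w_e(z) = prod_i exp(-e |z_i|), whose Fourier transform is
    a product of Poisson kernels, int w_e |E e^{i<z,Y_t>}|^2 dz is the average of
    that kernel over Y_t - Y'_t (Y' an independent copy), hence at most
    (2 pi)^d sup p.  This bounds the integral at time 2t, and the lower bound with
    K = 1 shows that h^{-1}(2/t) and h^{-1}(1/t) are comparable.

    (D2) => (D3): K = 1 gives g(k r) <= g(r) / 2 for some k < 1, and large K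
    forbids Re Psi(x0) to be small compared with g(|x0|).

    (D3) => (D4): N(|<x,z>| >= L) <= H(x/L) <= 66 Psi^*(|x|/L) is small compared
    with Psi^*(|x|) for large L by scaling, so U(x/L) dominates a multiple of
    Re Psi(x), hence of Psi^*(|x|).

    (D4) => (D2): H(2x) - H(x) >= (3/4) U(2x), so H(x) <= q H(2x) with q < 1; this
    makes Psi^* polynomially large and the integral near 0 a scaled convergent one.
    Away from 0, integrability and the lower bound keep Re Psi above a positive
    constant.

    (D2) => (D1): smoothing the law of Y_t by Poisson kernels gives the Abel means
    of the inverse Fourier integral; testing on boxes and letting e -> 0 identifies
    the density. *)

(** [leb_int] is identified with an integral against a measure only for nonnegative measurable
    integrands, and this shapes the Fourier part. Every oscillating integrand carries a summand that
    makes it nonnegative (1 + cos, 1 - cos, E + E cos); Tonelli is applied to the sum, and the known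
    contribution of the summand is subtracted at the end. Complex numbers are avoided in the same
    spirit: the characteristic function of Y_t is E exp(-i th) with E = exp(-t Re Psi) and th = t Im
    Psi, and it enters through E cos(th + <z,a>). The weight exp(-e |u|) is preferred to a Gaussian
    because all integrals it produces have elementary primitives: an exponential times a bounded
    trigonometric function, or atan. The inverse of h is handled only up to a factor 4, through h(r)
    <= l^2 h(l r). Power decay is recorded as f(l r)^m <= C l f(r)^m with m an integer, so that
    logarithms never occur and real exponents appear only at the interface with (D3). *)

(** * Lebesgue measure on tuples *)

(** Tonelli is stated for measures that carry the sigma-finite structure, whereas N and the
    pushforwards used below come as bare measures. *)
Lemma sigma_finite_pack (R : realType) (dT : measure_display)
  (T : measurableType dT) (m : {measure set T -> \bar R}) :
  sigma_finite setT m ->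
  exists m' : {sigma_finite_measure set T -> \bar R},
    forall B, m' B = m B.
Proof.
move=> sm.
pose m' : {sigma_finite_measure set T -> \bar R} := HB.pack (Measure.sort m) (Measure.class m)
  (isSFinite.Build _ _ _ _ (sfinite_measure_sigma_finite sm))
  (isSigmaFinite.Build _ _ _ _ sm).
by exists m'.
Qed.

(** By induction: the measure in dimension n + 1 is the image of the product of Lebesgue measure and
    the previous measure under [cons]. Sigma-finiteness is part of the conclusion because the next
    product needs it; exhausting rectangles are transported through the inverse of [cons]. *)
Lemma leb_measure_exists (R : realType) n :
  exists mu : {sigma_finite_measure set (n.-tuple R) -> \bar R},
    forall f : n.-tuple R -> \bar R, measurable_fun [set: n.-tuple R] f ->
    (forall x, (0 <= f x)%E) -> leb_int f = (\int[mu]_x f x)%E.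
Proof.
elim: n => [|n [mu IH]].
  exists (\d_ ([tuple] : 0.-tuple R) : {finite_measure set (0.-tuple R) -> \bar R}).
  move=> f mf f0 /=; rewrite integral_dirac//= diracT mul1e.
  by congr f; exact: val_inj.
pose cns (p : measurableTypeR R * n.-tuple R) : n.+1.-tuple R :=
  [the n.+1.-tuple R of p.1 :: p.2].
have mcns : measurable_fun setT cns by exact: measurable_cons.
pose M : {measure set (measurableTypeR R * n.-tuple R)%type -> \bar R} :=
  (@lebesgue_measure R \x mu)%E.
pose nu : {measure set (n.+1.-tuple R) -> \bar R} :=
  measure_function_pushforward__canonical__measure_function_Measure M mcns.
have snu : sigma_finite setT nu.
  have /sigma_finiteP[F [Fu Fmon mF]] := sigma_finiteT (@lebesgue_measure R).
  have /sigma_finiteP[G [Gu Gmon mG]] := sigma_finiteT mu.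
  pose uncns (x : n.+1.-tuple R) : measurableTypeR R * n.-tuple R :=
    (tnth x ord0, [tuple of behead x]).
  have muncns : measurable_fun setT uncns.
    apply: measurable_fun_pair => /=; first exact: measurable_tnth.
    exact: measurable_behead.
  have cK : forall p, uncns (cns p) = p.
    by move=> [x y]; congr pair => /=; apply: val_inj.
  exists (fun i => uncns @^-1` (F i `*` G i)).
    rewrite -preimage_bigcup; apply/seteqP; split => //= x _.
    have : [set: measurableTypeR R] (tnth x ord0) by [].
    rewrite Fu => -[i _ Fi].
    have : [set: n.-tuple R] [tuple of behead x] by [].
    rewrite Gu => -[j _ Gj].
    exists (maxn i j) => //; split => /=.
      by move/subsetPset: (Fmon _ _ (leq_maxl i j)); apply.
    by move/subsetPset: (Gmon _ _ (leq_maxr i j)); apply.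
  move=> i; have [mFi Fi] := mF i; have [mGi Gi] := mG i; split.
    by rewrite -[X in measurable X]setTI; apply: muncns => //; exact: measurableX.
  rewrite /nu /= /pushforward/= -comp_preimage.
  rewrite (_ : uncns \o cns = id); last by apply/funext => p; exact: cK.
  by rewrite preimage_id product_measure1E// lte_mul_pinfty// ge0_fin_numE.
have [nu' nu'E] := sigma_finite_pack snu.
exists nu' => f mf f0.
rewrite (eq_measure_integral nu); last by move=> B _ _; exact: nu'E.
rewrite ge0_integral_pushforward//= preimage_setT/= fubini_tonelli1//=.
- apply: eq_integral => x _; rewrite /fubini_F/= IH//.
  apply: measurableT_comp mf _.
  exact: (@measurable_cons _ _ _ _ (cst x)).
- exact: measurableT_comp.
Qed.

(** * Laplace and Cauchy integrals *)

Section one_dim.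
Variable R : realType.
Local Notation mu := (@lebesgue_measure R).

Lemma is_derive_cvg (f : R -> R) (u df : R) :
  is_derive u 1 f df -> f v @[v --> u] --> f u.
Proof.
move=> h; apply: differentiable_continuous; apply/derivable1_diffP.
exact: (@ex_derive _ _ _ _ _ _ _ h).
Qed.

Lemma is_derive_expRM (e u : R) :
  is_derive u 1 (fun v => expR (- (e * v))) (- e * expR (- (e * u))).
Proof.
have -> : (fun v => expR (- (e * v))) = expR \o (fun v => - (e * v)) by [].
apply: is_derive_eq.
by rewrite !scaler1 mulrC.
Qed.

Lemma is_derive_cos_affine (c x u : R) :
  is_derive u 1 (fun v => cos (c + v * x)) (- x * sin (c + u * x)).
Proof.
have -> : (fun v => cos (c + v * x)) = cos \o (fun v => c + v * x) by [].
apply: is_derive_eq.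
rewrite !scaler0 !add0r !scaler1.
ring.
Qed.

Lemma is_derive_sin_affine (c x u : R) :
  is_derive u 1 (fun v => sin (c + v * x)) (x * cos (c + u * x)).
Proof.
have -> : (fun v => sin (c + v * x)) = sin \o (fun v => c + v * x) by [].
apply: is_derive_eq.
rewrite !scaler0 !add0r !scaler1.
ring.
Qed.

Lemma is_derive_atan_affine (e y u : R) : e != 0 ->
  is_derive u 1 (fun v => atan ((v - y) / e)) (e / (e ^+ 2 + (u - y) ^+ 2)).
Proof.
move=> e0.
have -> : (fun v => atan ((v - y) / e)) = atan \o (fun v => (v - y) / e) by [].
apply: is_derive_eq.
rewrite !scaler0 ?addr0 ?add0r ?subr0 ?oppr0 ?addr0 !scaler1.
have h : 0 < e ^+ 2 by rewrite exprn_even_gt0//=.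
have : e ^+ 2 + (u - y) ^+ 2 != 0 by rewrite gt_eqF// ltr_wpDr// sqr_ge0.
move=> h2.
by field; rewrite h2 e0.
Qed.

Lemma ge0_integral_fold (f : R -> R) : measurable_fun setT f ->
  (forall x, 0 <= f x) ->
  (\int[mu]_x (f x)%:E = \int[mu]_(x in `[0%R, +oo[) (f x)%:E
     + \int[mu]_(x in `[0%R, +oo[) (f (- x))%:E)%E.
Proof.
move=> mf f0.
rewrite (ge0_integration_by_substitution0 (f := fun x => (f (- x))%:E)) ; last 2 first.
- apply/measurable_EFinP; apply: measurableT_comp mf _.
  exact: oppr_measurable.
- by move=> r; rewrite lee_fin.
under [X in (_ = _ + X)%E]eq_integral do rewrite opprK.
rewrite -integral_itv_bndo_bndc; last first.
  by apply/measurable_EFinP; exact: measurable_funTS.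
rewrite -(set_itvNyy R) (@itv_bndbnd_setU _ _ -oo%O (BLeft 0) +oo%O)//.
rewrite ge0_integral_setU//=.
- by rewrite addeC.
- by apply/measurable_EFinP; exact: measurable_funTS.
- by move=> x _; rewrite lee_fin.
- apply/disj_setPS => x /= []; rewrite !in_itv/= andbT => h1 h2.
  by have := lt_le_trans h1 h2; rewrite ltxx.
Qed.

Lemma cvgy_expRM (e : R) : 0 < e -> expR (- (e * u)) @[u --> +oo] --> 0.
Proof.
move=> e0.
have h : (e * u) @[u --> +oo] --> +oo by exact: gt0_cvgMry.
have h2 := @cvgr_expR R.
exact: (cvg_comp _ _ h h2).
Qed.

Lemma cvgy_expRM_bounded (e K : R) (B : R -> R) : 0 < e ->
  (forall u, `|B u| <= K) -> expR (- (e * u)) * B u @[u --> +oo] --> 0.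
Proof.
move=> e0 BK.
apply: (@squeeze_cvgr _ _ _ _ (fun u => - K * expR (- (e * u)))
  (fun u => K * expR (- (e * u)))).
- near=> u; have := BK u; rewrite ler_norml => /andP[h1 h2].
  by rewrite mulrC !ler_wpM2l ?expR_ge0// ![_ * expR _]mulrC !ler_wpM2l ?expR_ge0.
- by rewrite -[X in _ --> X](mulr0 (- K)); apply: cvgMr; exact: cvgy_expRM.
- by rewrite -[X in _ --> X](mulr0 K); apply: cvgMr; exact: cvgy_expRM.
Unshelve. all: by end_near. Qed.

(** The summand 1 makes the integrand nonnegative, so the fundamental theorem of calculus on a
    half-line applies without a separate proof of integrability. *)
Lemma integral_expRM_1Dcos (e x c : R) : 0 < e ->
  (\int[mu]_(u in `[0%R, +oo[) (expR (- (e * u)) * (1 + cos (c + u * x)))%:E =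
   (e^-1 + (e * cos c - x * sin c) / (e ^+ 2 + x ^+ 2))%:E)%E.
Proof.
move=> e0.
have d0 : 0 < e ^+ 2 + x ^+ 2 by rewrite ltr_wpDr ?sqr_ge0// exprn_gt0.
(* B is the bounded solution of B' - e B = 1 + cos(c + u x), so that exp(-e u) B(u) is a primitive
   vanishing at infinity. *)
pose B (u : R) := - e^-1 + (- e * cos (c + u * x) + x * sin (c + u * x)) / (e ^+ 2 + x ^+ 2).
pose F (u : R) := expR (- (e * u)) * B u.
have dB (u : R) : is_derive u 1 B ((e * x * sin (c + u * x) + x ^+ 2 * cos (c + u * x)) / (e ^+ 2 + x ^+ 2)).
  rewrite /B.
  have h1 := is_derive_cos_affine c x u.
  have h2 := is_derive_sin_affine c x u.
  apply: is_derive_eq.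
  by rewrite !scaler0 /GRing.scale/=; field; rewrite gt_eqF.
have dF (u : R) : is_derive u 1 F (expR (- (e * u)) * (1 + cos (c + u * x))).
  rewrite /F; have h1 := is_derive_expRM e u; have h2 := dB u.
  apply: is_derive_eq.
  by rewrite /B /GRing.scale/=; field; rewrite !gt_eqF.
rewrite (@ge0_continuous_FTC2y R _ F 0 0).
- rewrite /F /B mulr0 oppr0 expR0 mul1r mul0r addr0 -EFinB; congr EFin.
  by field; rewrite !gt_eqF.
- move=> u _; rewrite mulr_ge0 ?expR_ge0// addrC -lerBlDr sub0r; exact: cos_geN1.
- apply: continuous_subspaceT => u.
  apply: cvgM.
    exact: is_derive_cvg (is_derive_expRM e u).
  apply: cvgD; first exact: cvg_cst.
  exact: is_derive_cvg (is_derive_cos_affine c x u).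
- apply: (@cvgy_expRM_bounded e (e^-1 + (e + `|x|) / (e ^+ 2 + x ^+ 2))) => // u.
  rewrite /B (le_trans (ler_normD _ _))// normrN (ger0_norm (x := e^-1)) ?invr_ge0 ?(ltW e0)//.
  rewrite lerD2l normrM (ger0_norm (x := (_ + _)^-1)) ?invr_ge0 ?(ltW d0)//.
  rewrite ler_wpM2r ?invr_ge0 ?(ltW d0)// (le_trans (ler_normD _ _))// !normrM normrN.
  rewrite (gtr0_norm e0) lerD//.
    by rewrite ler_piMr ?(ltW e0)// cos_max.
  by rewrite ler_piMr// sin_max.
- by move=> u _; exact: (@ex_derive _ _ _ _ _ _ _ (dF u)).
- apply: cvg_at_right_filter; apply: differentiable_continuous; apply/derivable1_diffP.
  exact: (@ex_derive _ _ _ _ _ _ _ (dF 0)).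
- by move=> u _; rewrite derive1E; exact: (@derive_val _ _ _ _ _ _ _ (dF u)).
Qed.

Lemma measurable_1Dcos (e x c : R) :
  measurable_fun setT (fun u : R => expR (- (e * `|u|)) * (1 + cos (c + u * x))).
Proof.
apply: measurable_funM.
  apply: measurableT_comp => //; apply: measurableT_comp => //.
  apply: measurable_funM => //.
apply: measurable_funD => //; apply: measurableT_comp.
  by apply: continuous_measurable_fun; exact: continuous_cos.
by apply: measurable_funD => //; exact: measurable_funM.
Qed.

Lemma integral_laplace_1Dcos (e x c : R) : 0 < e ->
  (\int[mu]_u (expR (- (e * `|u|)) * (1 + cos (c + u * x)))%:E =
   (2 / e + cos c * (2 * e / (e ^+ 2 + x ^+ 2)))%:E)%E.
Proof.
move=> e0.
rewrite (@ge0_integral_fold (fun u => expR (- (e * `|u|)) * (1 + cos (c + u * x)))).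
- have -> : (\int[mu]_(u in `[0%R, +oo[) (expR (- (e * `|u|)) * (1 + cos (c + u * x)))%:E =
     \int[mu]_(u in `[0%R, +oo[) (expR (- (e * u)) * (1 + cos (c + u * x)))%:E)%E.
    by apply: eq_integral => u; rewrite inE/= in_itv/= andbT => u0; rewrite ger0_norm.
  have -> : (\int[mu]_(u in `[0%R, +oo[) (expR (- (e * `|- u|)) * (1 + cos (c + - u * x)))%:E =
     \int[mu]_(u in `[0%R, +oo[) (expR (- (e * u)) * (1 + cos (c + u * - x)))%:E)%E.
    by apply: eq_integral => u; rewrite inE/= in_itv/= andbT => u0; rewrite normrN ger0_norm// mulNr mulrN.
  rewrite !integral_expRM_1Dcos// -EFinD; congr EFin.
  have d0 : 0 < e ^+ 2 + x ^+ 2 by rewrite ltr_wpDr ?sqr_ge0// exprn_gt0.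
  by rewrite sqrrN; field; rewrite !gt_eqF.
- exact: measurable_1Dcos.
- move=> u; rewrite mulr_ge0 ?expR_ge0// addrC -lerBlDr sub0r; exact: cos_geN1.
Qed.

Lemma cauchy_den_gt0 (e z : R) : 0 < e -> 0 < e ^+ 2 + z ^+ 2.
Proof. by move=> e0; rewrite ltr_wpDr ?sqr_ge0// exprn_gt0. Qed.

Lemma continuous_cauchy (e y : R) : 0 < e ->
  continuous (fun v : R => e / (e ^+ 2 + (v - y) ^+ 2)).
Proof.
move=> e0 u; apply: cvgM; first exact: cvg_cst.
apply: cvgV; first by rewrite gt_eqF// cauchy_den_gt0.
apply: cvgD; first exact: cvg_cst.
by apply: (@cvg_comp _ _ _ (fun v => v - y) (fun v => v ^+ 2));
  [apply: cvgB; [exact: cvg_id|exact: cvg_cst]|exact: exprn_continuous].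
Qed.

Lemma integral_cauchy_itv (e y a b : R) : 0 < e -> a < b ->
  (\int[mu]_(v in `[a, b]) (e / (e ^+ 2 + (v - y) ^+ 2))%:E =
   (atan ((b - y) / e) - atan ((a - y) / e))%:E)%E.
Proof.
move=> e0 ab.
have dF (u : R) := @is_derive_atan_affine e y u (lt0r_neq0 e0).
have cF u : {for u, continuous (fun v => atan ((v - y) / e))}.
  by apply: differentiable_continuous; apply/derivable1_diffP;
    exact: (@ex_derive _ _ _ _ _ _ _ (dF u)).
rewrite (@continuous_FTC2 R _ (fun v => atan ((v - y) / e)))// ?EFinB//.
- by apply: continuous_subspaceT; exact: continuous_cauchy.
- split.
  + by move=> u _; exact: (@ex_derive _ _ _ _ _ _ _ (dF u)).
  + by apply: cvg_at_right_filter; exact: cF.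
  + by apply: cvg_at_left_filter; exact: cF.
- by move=> u _; rewrite derive1E; exact: (@derive_val _ _ _ _ _ _ _ (dF u)).
Qed.

Lemma integral_cauchy_half (e y : R) : 0 < e ->
  (\int[mu]_(v in `[0%R, +oo[) (e / (e ^+ 2 + (v - y) ^+ 2))%:E =
   (pi / 2 + atan (y / e))%:E)%E.
Proof.
move=> e0.
have dF (u : R) := @is_derive_atan_affine e y u (lt0r_neq0 e0).
rewrite (@ge0_continuous_FTC2y R _ (fun v => atan ((v - y) / e)) 0 (pi / 2)).
- by rewrite -EFinB sub0r mulNr atanN opprK.
- by move=> u _; rewrite divr_ge0// ltW// cauchy_den_gt0.
- by apply: continuous_subspaceT; exact: continuous_cauchy.
- apply: (cvg_comp _ _ _ (@cvgy_atan R)).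
  apply: gt0_cvgMly; first by rewrite invr_gt0.
  exact: cvg_addrr.
- by move=> u _; exact: (@ex_derive _ _ _ _ _ _ _ (dF u)).
- apply: cvg_at_right_filter; apply: differentiable_continuous; apply/derivable1_diffP.
  exact: (@ex_derive _ _ _ _ _ _ _ (dF 0)).
- by move=> u _; rewrite derive1E; exact: (@derive_val _ _ _ _ _ _ _ (dF u)).
Qed.

Lemma integral_cauchy (e y : R) : 0 < e ->
  (\int[mu]_v (e / (e ^+ 2 + (v - y) ^+ 2))%:E = pi%:E)%E.
Proof.
move=> e0.
rewrite (@ge0_integral_fold (fun v => e / (e ^+ 2 + (v - y) ^+ 2))).
- rewrite integral_cauchy_half//.
  have -> : (\int[mu]_(v in `[0%R, +oo[) (e / (e ^+ 2 + (- v - y) ^+ 2))%:E =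
     \int[mu]_(v in `[0%R, +oo[) (e / (e ^+ 2 + (v - (- y)) ^+ 2))%:E)%E.
    by apply: eq_integral => u _; rewrite (_ : - u - y = - (u - - y)) ?sqrrN//; ring.
  rewrite integral_cauchy_half// -EFinD mulNr atanN; congr EFin.
  by rewrite addrACA subrr addr0 -splitr.
- by apply: continuous_measurable_fun; exact: continuous_cauchy.
- by move=> u; rewrite divr_ge0 ?(ltW e0)// ltW// cauchy_den_gt0.
Qed.

End one_dim.

(** * Product integrals over R^d *)

Section products.
Variable R : realType.
Local Notation mu := (@lebesgue_measure R).

(** For b >= 0 the integrand is a combination of 1 and 1 + cos with the nonnegative coefficients a -
    b and b; a negative b is made positive by shifting the phase by pi. *)
Lemma integral_laplace_cos (e x c a b : R) : 0 < e -> `|b| <= a ->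
  (\int[mu]_u (expR (- (e * `|u|)) * (a + b * cos (c + u * x)))%:E =
   (a * (2 / e) + b * cos c * (2 * e / (e ^+ 2 + x ^+ 2)))%:E)%E.
Proof.
move=> e0; move: c; wlog b0 : b / 0 <= b => [hw|] c ba.
  have [b0|b0] := leP 0 b; first exact: hw.
  have := hw (- b) _ (c + pi); rewrite oppr_ge0 (ltW b0) normrN => /(_ isT ba).
  rewrite cosDpi mulrNN => <-.
  by apply: eq_integral => u _; rewrite [c + pi + _]addrAC cosDpi mulrNN.
rewrite ger0_norm// in ba.
(* Since cos(pi / 2) = 0, this is the bare Laplace weight, and the same formula evaluates both
   summands. *)
pose f1 (u : R) := expR (- (e * `|u|)) * (1 + cos (pi / 2 + u * 0)).
pose f2 (u : R) := expR (- (e * `|u|)) * (1 + cos (c + u * x)).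
have f2_ge0 y d u : 0 <= expR (- (e * `|u|)) * (1 + cos (d + u * y)).
  by rewrite mulr_ge0 ?expR_ge0// addrC -lerBlDr sub0r; exact: cos_geN1.
transitivity (\int[mu]_u ((a - b)%:E * (f1 u)%:E + b%:E * (f2 u)%:E))%E.
  apply: eq_integral => u _.
  by rewrite /f1 /f2 mulr0 addr0 cos_pihalf addr0 -!EFinM -EFinD; congr EFin; ring.
have mf1 : measurable_fun setT (EFin \o f1).
  by apply/measurable_EFinP; exact: measurable_1Dcos.
have mf2 : measurable_fun setT (EFin \o f2).
  by apply/measurable_EFinP; exact: measurable_1Dcos.
rewrite ge0_integralD//=.
- rewrite ge0_integralZl_EFin//; last by rewrite subr_ge0.
  rewrite ge0_integralZl_EFin//.
  have -> : (\int[mu]_u (f1 u)%:E = (2 / e)%:E)%E.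
    rewrite [LHS](integral_laplace_1Dcos 0 (pi / 2) e0) cos_pihalf.
    by congr EFin; ring.
  have -> : (\int[mu]_u (f2 u)%:E = (2 / e + cos c * (2 * e / (e ^+ 2 + x ^+ 2)))%:E)%E.
    exact: integral_laplace_1Dcos.
  by rewrite -!EFinM -EFinD; congr EFin; ring.
  + by move=> u _; exact: f2_ge0.
  + by move=> u _; exact: f2_ge0.
- by move=> u _; rewrite mule_ge0 ?lee_fin ?subr_ge0// /f1 f2_ge0.
- exact: measurable_funeM.
- by move=> u _; rewrite mule_ge0 ?lee_fin// /f2 f2_ge0.
- exact: measurable_funeM.
Qed.

Lemma measurable_laplace_cos (e x c a b : R) :
  measurable_fun setT (fun u : R => expR (- (e * `|u|)) * (a + b * cos (c + u * x))).
Proof.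
apply: measurable_funM.
  apply: measurableT_comp => //; apply: measurableT_comp => //.
  exact: measurable_funM.
apply: measurable_funD => //; apply: measurable_funM => //; apply: measurableT_comp.
  by apply: continuous_measurable_fun; exact: continuous_cos.
by apply: measurable_funD => //; exact: measurable_funM.
Qed.

Lemma tnth_cons_lift n (u : R) (z : n.-tuple R) (i : 'I_n) :
  tnth [tuple of u :: z] (lift ord0 i) = tnth z i.
Proof. by rewrite !(tnth_nth 0). Qed.

(** The free factor k absorbs the value of the first function when the remaining coordinates are
    integrated by induction. *)
Lemma leb_int_prod n (f : 'I_n -> R -> R) (c : 'I_n -> R) (k : R) :
  0 <= k ->
  (forall i, measurable_fun setT (f i)) -> (forall i u, 0 <= f i u) ->
  (forall i, (\int[mu]_u (f i u)%:E = (c i)%:E)%E) ->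
  leb_int (fun x : n.-tuple R => (k * \prod_i f i (tnth x i))%:E)
  = (k * \prod_i c i)%:E.
Proof.
elim: n f c k => [|n IH] f c k k0 mf f0 fc /=; first by rewrite !big_ord0.
transitivity (\int[mu]_u ((k * \prod_i c (lift ord0 i))%:E * (f ord0 u)%:E))%E.
  apply: eq_integral => u _.
  rewrite -EFinM [k * _ * _]mulrAC -(IH (fun i => f (lift ord0 i)) (fun i => c (lift ord0 i)) (k * f ord0 u))//.
  - congr leb_int; apply/funext => z; rewrite big_ord_recl mulrA.
    congr (_ * _ * _)%:E; apply: eq_bigr => i _; congr (f _ _).
    exact: tnth_cons_lift.
  - by rewrite mulr_ge0.
rewrite ge0_integralZl_EFin//=.
- by rewrite fc -EFinM big_ord_recl; congr EFin; ring.
- by move=> u _; rewrite lee_fin.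
- by apply/measurable_EFinP; exact: mf.
- rewrite mulr_ge0// prodr_ge0// => i _.
  by rewrite -lee_fin -fc integral_ge0// => u _; rewrite lee_fin.
Qed.

(** Integrating out n coordinates leaves a one-dimensional integrand of the same shape, with a
    multiplied by (2 / e)^n and b by a product P of Cauchy factors. As 0 <= P <= (2 / e)^n, the
    condition |b| <= a survives; hence the generality in a, b and c. *)
Lemma leb_int_laplace_cos n (x : 'I_n -> R) (e c a b : R) : 0 < e -> `|b| <= a ->
  leb_int (fun z : n.-tuple R => ((\prod_i expR (- (e * `|tnth z i|))) *
    (a + b * cos (c + \sum_i tnth z i * x i)))%:E)
  = (a * (2 / e) ^+ n + b * cos c * \prod_i (2 * e / (e ^+ 2 + x i ^+ 2)))%:E.
Proof.
move=> e0; elim: n x c a b => [|n IH] x c a b ba /=.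
  by rewrite !big_ord0 addr0 expr0 !mulr1 mul1r.
pose P := \prod_(i < n) (2 * e / (e ^+ 2 + x (lift ord0 i) ^+ 2)).
have P0 : 0 <= P.
  by apply: prodr_ge0 => i _; rewrite divr_ge0 ?mulr_ge0 ?(ltW e0)// ltW// cauchy_den_gt0.
have Ple : P <= (2 / e) ^+ n.
  rewrite -[X in _ ^+ X](card_ord n) -prodr_const; apply: ler_prod => i _.
  rewrite divr_ge0 ?mulr_ge0 ?(ltW e0)//=; last by rewrite ltW// cauchy_den_gt0.
  rewrite ler_pdivrMr ?cauchy_den_gt0// mulrAC ler_pdivlMr// -mulrA -expr2.
  by rewrite ler_pM2l// lerDl sqr_ge0.
transitivity (\int[mu]_u (expR (- (e * `|u|)) * (a * (2 / e) ^+ n + (b * P) * cos (c + u * x ord0)))%:E)%E.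
  apply: eq_integral => u _.
  transitivity (leb_int (fun z : n.-tuple R => ((\prod_i expR (- (e * `|tnth z i|))) *
    (expR (- (e * `|u|)) * a + expR (- (e * `|u|)) * b * cos ((c + u * x ord0) + \sum_i tnth z i * x (lift ord0 i))))%:E)).
    congr leb_int; apply/funext => z; rewrite !big_ord_recl addrA.
    rewrite (eq_bigr (fun i => expR (- (e * `|tnth z i|)))); last first.
      by move=> i _; congr (expR (- (e * `|_|))); exact: tnth_cons_lift.
    have -> : \sum_(i < n) tnth [tuple of u :: z] (lift ord0 i) * x (lift ord0 i) =
        \sum_(i < n) tnth z i * x (lift ord0 i).
      by apply: eq_bigr => i _; congr (_ * _); exact: tnth_cons_lift.
    by congr EFin; rewrite tnth0; ring.
  rewrite IH.
    by congr EFin; rewrite -/P; ring.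
  by rewrite normrM ger0_norm ?expR_ge0// ler_wpM2l ?expR_ge0.
rewrite integral_laplace_cos//.
  by rewrite big_ord_recl -/P [(2 / e) ^+ n.+1]exprSr; congr EFin; ring.
by rewrite normrM (ger0_norm P0) ler_pM.
Qed.

End products.

(** * Trigonometric bounds and vectors *)

Section trigo.
Variable R : realType.
Implicit Types a b s : R.

Lemma sin_ge0_le_id s : 0 <= s -> sin s <= s.
Proof.
rewrite le_eqVlt => /predU1P[<-|s0]; first by rewrite sin0.
have [|c _ h] := @MVT R (sin \- id) (fun x => cos x - 1) 0 s s0.
- by apply: continuous_subspaceT => x; apply: cvgB; [exact: continuous_sin|exact: cvg_id].
have : (sin \- id) s - (sin \- id) 0 <= 0.
  rewrite h; apply: mulr_le0_ge0; last by rewrite subr0 ltW.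
  by rewrite subr_le0 cos_le1.
by rewrite /= sin0 !subr0 subr_le0.
Qed.

Lemma normr_sin_le s : `|sin s| <= `|s|.
Proof.
have H (x : R) : 0 <= x -> `|sin x| <= x.
  move=> x0; have [x1|x1] := leP x 1.
    have x2 : 0 <= sin x.
      rewrite sin_ge0_pi// x0/= (le_trans x1)// (le_trans _ (@pi_ge2 R))//.
      by rewrite ler1n.
    by rewrite ger0_norm// sin_ge0_le_id.
  by rewrite (le_trans (sin_max _))// ltW.
have /orP[s0|s0] := le_total 0 s; first by rewrite (ger0_norm s0); exact: H.
by rewrite -normrN -sinN (ler0_norm s0); apply: H; rewrite oppr_ge0.
Qed.

Lemma oneBcosE s : 1 - cos s = 2 * sin (s / 2) ^+ 2.
Proof.
have -> : cos s = cos ((s / 2) *+ 2) by rewrite -mulr_natr divfK.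
by rewrite cos_mulr2n cos2sin2; ring.
Qed.

Lemma oneBcos_ge0 s : 0 <= 1 - cos s.
Proof. by rewrite subr_ge0 cos_le1. Qed.

Lemma oneBcos_le_min s : 1 - cos s <= 2 * Num.min 1 (s ^+ 2).
Proof.
have [_|_] := leP 1 (s ^+ 2).
  by have := cos_geN1 s; lra.
rewrite oneBcosE ler_pM2l// -[leRHS]real_normK ?num_real//.
rewrite -[leLHS]real_normK ?num_real//.
rewrite lerXn2r ?nnegrE// (le_trans (normr_sin_le _))//.
by rewrite normrM ler_piMr// ger0_norm ?invr_ge0// invf_le1// ler1n.
Qed.

Lemma sin_ge_half s : 0 <= s <= 1 -> s / 2 <= sin s.
Proof.
rewrite le_eqVlt => /andP[/predU1P[<-|s0] s1]; first by rewrite sin0 mul0r.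
have [|c cs h] := @MVT R sin cos 0 s s0.
- by apply: continuous_subspaceT; exact: continuous_sin.
move: h; rewrite sin0 !subr0 => ->.
rewrite mulrC ler_pM2r//.
have := oneBcosE c; move: cs; rewrite in_itv/= => /andP[c0 cs].
have : sin (c / 2) ^+ 2 <= (1/2) ^+ 2.
  rewrite -[leLHS]real_normK ?num_real// lerXn2r ?nnegrE//.
  rewrite (le_trans (normr_sin_le _))// ger0_norm; last by rewrite divr_ge0// ltW.
  by rewrite ler_pM2r// (le_trans (ltW cs)).
lra.
Qed.

(** The constant is 2 (1/4)^2, from 1 - cos s = 2 sin(s/2)^2 and sin v >= v / 2 on [0, 1]. *)
Lemma oneBcos_ge s : `|s| <= 1 -> s ^+ 2 / 8 <= 1 - cos s.
Proof.
move=> s1; rewrite -cos_norm -[s ^+ 2]real_normK ?num_real// oneBcosE.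
have h : `|s| / 2 / 2 <= sin (`|s| / 2).
  apply: sin_ge_half; rewrite divr_ge0//= ler_pdivrMr// mul1r.
  by rewrite (le_trans s1)// ler1n.
have : (`|s| / 2 / 2) ^+ 2 <= sin (`|s| / 2) ^+ 2.
  rewrite lerXn2r ?nnegrE// ?divr_ge0//; apply: le_trans h.
  by rewrite !divr_ge0.
have -> : (`|s| / 2 / 2) ^+ 2 = `|s| ^+ 2 / 16 by field.
lra.
Qed.

(** In half-angles this is (p + q)^2 <= 2 p^2 + 2 q^2. Integrated against N it gives the jump part
    of the quasi-subadditivity of Re Psi. *)
Lemma oneBcosD a b : 1 - cos (a + b) <= 2 * (1 - cos a) + 2 * (1 - cos b).
Proof.
rewrite (oneBcosE (a + b)) (oneBcosE a) (oneBcosE b) (_ : (a + b) / 2 = a / 2 + b / 2); last by field.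
rewrite sinD.
set x := sin (a / 2); set y := sin (b / 2).
have ca : cos (a / 2) ^+ 2 <= 1 by rewrite cos2sin2 gerBl sqr_ge0.
have cb : cos (b / 2) ^+ 2 <= 1 by rewrite cos2sin2 gerBl sqr_ge0.
have h1 : (x * cos (b / 2)) ^+ 2 <= x ^+ 2 by rewrite exprMn ler_piMr ?sqr_ge0.
have h2 : (cos (a / 2) * y) ^+ 2 <= y ^+ 2 by rewrite exprMn ler_piMl ?sqr_ge0.
have := sqr_ge0 (x * cos (b / 2) - cos (a / 2) * y).
move: h1 h2; set p := x * _; set q := _ * y => h1 h2 h3.
have : (p + q) ^+ 2 + (p - q) ^+ 2 = 2 * p ^+ 2 + 2 * q ^+ 2 by ring.
lra.
Qed.

Lemma normr_sinMn n a : `|sin (n%:R * a)| <= n%:R * `|sin a|.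
Proof.
elim: n => [|n IH]; first by rewrite !mul0r sin0 normr0.
rewrite -natr1 mulrDl mul1r sinD (le_trans (ler_normD _ _))// !normrM mulrDl mul1r.
rewrite lerD//.
  by apply: le_trans IH; rewrite ler_piMr ?cos_max.
by rewrite ler_piMl ?cos_max.
Qed.

Lemma oneBcosMn n a : 1 - cos (n%:R * a) <= n%:R ^+ 2 * (1 - cos a).
Proof.
rewrite (oneBcosE (n%:R * a)) (oneBcosE a) [leRHS]mulrCA ler_pM2l// -mulrA -exprMn.
rewrite -[leLHS]real_normK ?num_real// -[leRHS]real_normK ?num_real//.
by rewrite lerXn2r ?nnegrE// normrM normr_nat normr_sinMn.
Qed.

End trigo.

Section vectors.
Variables (R : realType) (d : nat).
Implicit Types x y z : d.-tuple R.

Definition vadd x y : d.-tuple R := [tuple tnth x i + tnth y i | i < d].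
Definition vscale (k : R) x : d.-tuple R := [tuple k * tnth x i | i < d].

Lemma ip_vaddl x y z : ip (vadd x y) z = ip x z + ip y z.
Proof. by rewrite /ip -big_split/=; apply: eq_bigr => i _; rewrite tnth_mktuple mulrDl. Qed.

Lemma ip_vscalel k x z : ip (vscale k x) z = k * ip x z.
Proof. by rewrite /ip big_distrr/=; apply: eq_bigr => i _; rewrite tnth_mktuple mulrA. Qed.

Lemma ip_sym x y : ip x y = ip y x.
Proof. by apply: eq_bigr => i _; rewrite mulrC. Qed.

Lemma ip_ge0 x : 0 <= ip x x.
Proof. by apply: sumr_ge0 => i _; rewrite -expr2 sqr_ge0. Qed.

Lemma sqr_vnorm x : vnorm x ^+ 2 = ip x x.
Proof. by rewrite sqr_sqrtr// ip_ge0. Qed.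

Lemma vnorm_ge0 x : 0 <= vnorm x.
Proof. exact: sqrtr_ge0. Qed.

Lemma vnorm_vscale k x : vnorm (vscale k x) = `|k| * vnorm x.
Proof.
rewrite /vnorm ip_vscalel ip_sym ip_vscalel mulrA -expr2 sqrtrM ?sqr_ge0//.
by rewrite sqrtr_sqr.
Qed.

Lemma cauchy_schwarz x y : ip x y ^+ 2 <= ip x x * ip y y.
Proof.
have h : forall t : R, 0 <= ip x x * t ^+ 2 + 2 * ip x y * t + ip y y.
  move=> t; have := ip_ge0 (vadd (vscale t x) y).
  rewrite ip_vaddl !ip_vscalel ![ip _ (vadd _ _)]ip_sym !ip_vaddl !ip_vscalel.
  by rewrite (ip_sym y x); congr (_ <= _); ring.
have := ip_ge0 x; rewrite le_eqVlt => /predU1P[x0|x0].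
  rewrite -x0 mul0r; have [->|xy] := eqVneq (ip x y) 0; first by rewrite expr0n.
  (* When <x,x> = 0 the quadratic in t is affine, and this t would give it the value -1. *)
  have := h (- (ip y y + 1) / (2 * ip x y)); rewrite -x0 mul0r add0r.
  have -> : 2 * ip x y * (- (ip y y + 1) / (2 * ip x y)) = - (ip y y + 1) by field.
  lra.
have := h (- ip x y / ip x x).
have -> : ip x x * (- ip x y / ip x x) ^+ 2 + 2 * ip x y * (- ip x y / ip x x) + ip y y
  = ip y y - ip x y ^+ 2 / ip x x by field; rewrite gt_eqF.
by rewrite subr_ge0 ler_pdivrMr// mulrC.
Qed.

Lemma tnth_le_vnorm x i : `|tnth x i| <= vnorm x.
Proof.
rewrite -[leLHS]sqrtr_sqr ler_wsqrtr// /ip (bigD1 i)//= -expr2 lerDl.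
by apply: sumr_ge0 => j _; rewrite -expr2 sqr_ge0.
Qed.

Lemma vnorm0 : vnorm (vzero R d) = 0.
Proof.
rewrite /vnorm /ip big1 ?sqrtr0// => i _.
by rewrite tnth_mktuple mul0r.
Qed.

Lemma vnorm_eq0 x : vnorm x = 0 -> x = vzero R d.
Proof.
move=> x0; apply: eq_from_tnth => i; rewrite tnth_mktuple.
by apply/eqP; rewrite -normr_le0 -x0 tnth_le_vnorm.
Qed.

Lemma measurable_ip2 (dT : measure_display) (T : measurableType dT)
  (f g : T -> d.-tuple R) : measurable_fun setT f -> measurable_fun setT g ->
  measurable_fun setT (fun t => ip (f t) (g t)).
Proof.
move=> /measurable_fun_tnthP mf /measurable_fun_tnthP mg.
rewrite /ip; apply: measurable_sum => i; apply: measurable_funM.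
  exact: mf.
exact: mg.
Qed.

Lemma measurable_ip z : measurable_fun setT (fun x : d.-tuple R => ip z x).
Proof. by apply: measurable_ip2 => //; exact: measurable_id. Qed.

Lemma measurable_sqr_vnorm : measurable_fun setT (fun x : d.-tuple R => vnorm x ^+ 2).
Proof.
apply: (eq_measurable_fun (fun x : d.-tuple R => ip x x)).
  by move=> x _; rewrite sqr_vnorm.
by apply: measurable_ip2; exact: measurable_id.
Qed.

Lemma measurable_quadA (A : 'M[R]_d) : measurable_fun setT (quadA A).
Proof.
apply: measurable_sum => i; apply: measurable_sum => j.
apply: measurable_funM; last exact: measurable_tnth.
by apply: measurable_funM => //; exact: measurable_tnth.
Qed.

Lemma quadA_vscale A k x : quadA A (vscale k x) = k ^+ 2 * quadA A x.
Proof.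
rewrite /quadA big_distrr/=; apply: eq_bigr => i _.
rewrite big_distrr/=; apply: eq_bigr => j _.
by rewrite !tnth_mktuple; ring.
Qed.

(** Dropping the nonnegative term at x - y yields the quasi-subadditivity of the Gaussian part. *)
Lemma quadA_parallelogram A x y :
  quadA A (vadd x y) + quadA A (vadd x (vscale (-1) y)) = 2 * quadA A x + 2 * quadA A y.
Proof.
rewrite /quadA !big_distrr/= -!big_split/=; apply: eq_bigr => i _.
rewrite !big_distrr/= -!big_split/=; apply: eq_bigr => j _.
by rewrite !tnth_mktuple; ring.
Qed.

(** A crude entrywise bound is enough: it makes the supremum that defines [opnorm] range over a
    bounded set, hence a genuine supremum. *)
Lemma quadA_le_sum A x : vnorm x <= 1 ->
  quadA A x <= \sum_(i < d) \sum_(j < d) `|A i j|.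
Proof.
move=> x1; apply: ler_sum => i _; apply: ler_sum => j _.
rewrite (le_trans (ler_norm _))// !normrM mulrAC ler_piMl//.
by rewrite mulr_ile1// (le_trans (tnth_le_vnorm _ _)).
Qed.

Lemma opnorm_has_ubound (A : 'M[R]_d) :
  has_ubound [set quadA A x | x in [set x : d.-tuple R | vnorm x <= 1]].
Proof.
by exists (\sum_(i < d) \sum_(j < d) `|A i j|) => _ [x /= x1 <-]; exact: quadA_le_sum.
Qed.

Lemma quadA_le_opnorm A x r : 0 < r -> vnorm x <= r -> quadA A x <= r ^+ 2 * opnorm A.
Proof.
move=> r0 xr.
have -> : quadA A x = r ^+ 2 * quadA A (vscale r^-1 x).
  by rewrite quadA_vscale mulrA -exprMn divff ?expr1n ?mul1r// gt_eqF.
rewrite ler_pM2l ?exprn_gt0//.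
apply: ub_le_sup; first exact: opnorm_has_ubound.
exists (vscale r^-1 x) => //=; rewrite vnorm_vscale ger0_norm ?invr_ge0 ?(ltW r0)//.
by rewrite ler_pdivrMl// mulr1.
Qed.

Lemma opnorm_le A M : (forall x, vnorm x <= 1 -> quadA A x <= M) -> opnorm A <= M.
Proof.
move=> h; apply: ge_sup.
  by exists (quadA A (vzero R d)); exists (vzero R d) => //=; rewrite vnorm0.
by move=> _ [x /= x1 <-]; exact: h.
Qed.

Lemma opnorm_ge0 (A : 'M[R]_d) : sym_nonneg_def A -> 0 <= opnorm A.
Proof.
move=> [_ A0]; have := @quadA_le_opnorm A (vzero R d) 1 ltr01.
by rewrite vnorm0 expr1n mul1r => /(_ ler01); exact: le_trans.
Qed.

End vectors.

(** * Comparison of the characteristic exponent, its supremum and h *)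

Section levy_facts.
Variables (R : realType) (d : nat) (A : 'M[R]_d).
Variable N : {measure set (d.-tuple R) -> \bar R}.
Hypothesis symA : sym_nonneg_def A.
Hypothesis levyN : levy_measure N.
Implicit Types x y z : d.-tuple R.

Let levy_weight x : R := Num.min 1 (vnorm x ^+ 2).

Lemma measurable_levy_weight : measurable_fun setT levy_weight.
Proof. by apply: measurable_minr => //; exact: measurable_sqr_vnorm. Qed.

Lemma levy_weight_ge0 x : 0 <= levy_weight x.
Proof. by rewrite /levy_weight le_min ler01 sqr_ge0. Qed.

Lemma levy_integrable (f : d.-tuple R -> R) (C : R) : measurable_fun setT f ->
  (forall x, 0 <= f x) -> (forall x, f x <= C * Num.min 1 (vnorm x ^+ 2)) ->
  N.-integrable setT (EFin \o f).
Proof.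
move=> mf f0 fC.
apply: (@le_integrable _ _ _ N setT _ _ (fun x => (C%:E * (levy_weight x)%:E)%E)) => //.
- exact/measurable_EFinP.
- move=> x _ /=; rewrite lee_fin ger0_norm// (le_trans (fC x))//.
  by rewrite ler_norm.
- apply: integrableZl => //; apply/integrableP; split.
    by apply/measurable_EFinP; exact: measurable_levy_weight.
  under eq_integral do rewrite /= ger0_norm ?levy_weight_ge0//.
  exact: levyN.2.
Qed.

Lemma min_sqr_ip_le z r x : 0 < r -> vnorm z <= r ->
  Num.min 1 (ip z x ^+ 2) <= Num.min 1 (vnorm x ^+ 2 / r^-1 ^+ 2).
Proof.
move=> r0 zr; rewrite le_min ge_min lexx/= ge_min; apply/orP; right.
apply: le_trans (cauchy_schwarz z x) _; rewrite -!sqr_vnorm exprVn invrK mulrC.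
by rewrite ler_wpM2l ?sqr_ge0// lerXn2r ?nnegrE ?vnorm_ge0// ltW.
Qed.

Lemma min_sqr_div_le r x : 0 < r ->
  Num.min 1 (vnorm x ^+ 2 / r ^+ 2) <= (1 + r ^- 2) * Num.min 1 (vnorm x ^+ 2).
Proof.
move=> r0; have r2 : 0 <= r ^- 2 by rewrite invr_ge0 sqr_ge0.
have [h|h] := leP 1 (vnorm x ^+ 2).
  by rewrite mulr1 ge_min lerDl r2.
by rewrite ge_min; apply/orP; right; rewrite mulrC ler_wpM2r ?sqr_ge0// lerDr.
Qed.

Lemma integrable_min_div r : 0 < r ->
  N.-integrable setT (EFin \o (fun x => Num.min 1 (vnorm x ^+ 2 / r ^+ 2))).
Proof.
move=> r0; apply: (@levy_integrable _ (1 + r ^- 2)) => [|x|x].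
- apply: measurable_minr => //; apply: measurable_funM => //.
  exact: measurable_sqr_vnorm.
- by rewrite le_min ler01 divr_ge0 ?sqr_ge0.
- exact: min_sqr_div_le.
Qed.

Let le_integrable_div (f : d.-tuple R -> R) (C r : R) : 0 < r -> measurable_fun setT f ->
  (forall x, 0 <= f x) ->
  (forall x, f x <= C * Num.min 1 (vnorm x ^+ 2 / r ^+ 2)) ->
  N.-integrable setT (EFin \o f).
Proof.
move=> r0 mf f0 fC.
apply: (@le_integrable _ _ _ N setT _ _ (fun x => (C%:E * (Num.min 1 (vnorm x ^+ 2 / r ^+ 2))%:E)%E)) => //.
- exact/measurable_EFinP.
- move=> x _ /=; rewrite lee_fin ger0_norm// (le_trans (fC x))//.
  by rewrite ler_norm.
- by apply: integrableZl => //; exact: integrable_min_div.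
Qed.

Lemma exists_radius z : exists2 r : R, 0 < r & vnorm z <= r.
Proof. by exists (vnorm z + 1); [rewrite ltr_wpDl ?vnorm_ge0|rewrite lerDl]. Qed.

Lemma measurable_oneBcos z : measurable_fun setT (fun x : d.-tuple R => 1 - cos (ip z x)).
Proof.
apply: measurable_funB => //.
apply: (@measurableT_comp _ _ _ _ _ _ cos); last exact: measurable_ip.
by apply: continuous_measurable_fun; exact: continuous_cos.
Qed.

Lemma integrable_oneBcos z : N.-integrable setT (EFin \o (fun x => 1 - cos (ip z x))).
Proof.
have [r r0 zr] := exists_radius z.
apply: (@le_integrable_div _ 2 r^-1); rewrite ?invr_gt0//.
- exact: measurable_oneBcos.
- move=> x; rewrite (le_trans (oneBcos_le_min _))// ler_pM2l//.
  exact: min_sqr_ip_le.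
Qed.

Lemma integrable_min_ip z : N.-integrable setT (EFin \o (fun x => Num.min 1 (ip z x ^+ 2))).
Proof.
have [r r0 zr] := exists_radius z.
apply: (@le_integrable_div _ 1 r^-1); rewrite ?invr_gt0//.
- by apply: measurable_minr => //; apply: measurable_funX; exact: measurable_ip.
- by move=> x; rewrite le_min ler01 sqr_ge0.
- by move=> x; rewrite mul1r; exact: min_sqr_ip_le.
Qed.

Lemma RePsiE z : RePsi A N z = quadA A z / 2 + \int[N]_x (1 - cos (ip z x)).
Proof. by []. Qed.

Lemma hfunE r : hfun A N r = r ^- 2 * opnorm A + \int[N]_x (Num.min 1 (vnorm x ^+ 2 / r ^+ 2)).
Proof. by []. Qed.

Lemma quadA_le_RePsi z : quadA A z <= 2 * RePsi A N z.
Proof.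
rewrite RePsiE mulrDr mulrC divfK// lerDl mulr_ge0//.
by apply: Rintegral_ge0 => x _; exact: oneBcos_ge0.
Qed.

Lemma RePsi_ge0 z : 0 <= RePsi A N z.
Proof. by have := quadA_le_RePsi z; have := symA.2 z; lra. Qed.

Lemma RePsi_vadd x y : RePsi A N (vadd x y) <= 2 * RePsi A N x + 2 * RePsi A N y.
Proof.
rewrite !RePsiE.
have h1 : quadA A (vadd x y) <= 2 * quadA A x + 2 * quadA A y.
  by rewrite -quadA_parallelogram lerDl symA.2.
have h2 : \int[N]_u (1 - cos (ip (vadd x y) u)) <=
   2 * (\int[N]_u (1 - cos (ip x u))) + 2 * (\int[N]_u (1 - cos (ip y u))).
  rewrite -!RintegralZl//; [|exact: integrable_oneBcos..].
  rewrite -RintegralD//; [|exact: (integrableZl _ _ (integrable_oneBcos _))..].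
  apply: le_Rintegral => //; first exact: integrable_oneBcos.
    by apply: (@integrableD _ _ _ _ _ _ (fun u => (2%:E * (1 - cos (ip x u))%:E)%E) (fun u => (2%:E * (1 - cos (ip y u))%:E)%E)) => //;
      exact: (integrableZl _ _ (integrable_oneBcos _)).
  by move=> u _; rewrite ip_vaddl; exact: oneBcosD.
lra.
Qed.

Lemma RePsi_vscale_nat n x : RePsi A N (vscale n%:R x) <= n%:R ^+ 2 * RePsi A N x.
Proof.
rewrite !RePsiE mulrDr quadA_vscale mulrA lerD2l.
rewrite -RintegralZl//; last exact: integrable_oneBcos.
apply: le_Rintegral => //; first exact: integrable_oneBcos.
  exact: (integrableZl _ _ (integrable_oneBcos _)).
by move=> u _; rewrite ip_vscalel; exact: oneBcosMn.
Qed.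

Lemma RePsi_le_hfun z r : 0 < r -> vnorm z <= r -> RePsi A N z <= 2 * hfun A N r^-1.
Proof.
move=> r0 zr; rewrite RePsiE hfunE mulrDr lerD//.
  rewrite exprVn invrK.
  have := quadA_le_opnorm A r0 zr; have := mulr_ge0 (sqr_ge0 r) (opnorm_ge0 symA); lra.
rewrite -RintegralZl//; last by apply: integrable_min_div; rewrite invr_gt0.
apply: le_Rintegral => //; first exact: integrable_oneBcos.
  by apply: (integrableZl _ _ (integrable_min_div _)); rewrite ?invr_gt0.
move=> u _; rewrite (le_trans (oneBcos_le_min _))// ler_pM2l//.
exact: min_sqr_ip_le.
Qed.

Lemma hfun_nincr r s : 0 < r -> r <= s -> hfun A N s <= hfun A N r.
Proof.
move=> r0 rs; have s0 := lt_le_trans r0 rs; rewrite !hfunE lerD//.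
  rewrite ler_wpM2r ?opnorm_ge0// lef_pV2 ?posrE ?exprn_gt0//.
  by rewrite lerXn2r ?nnegrE//; exact: ltW.
apply: le_Rintegral => //; [exact: integrable_min_div..|move=> x _].
rewrite le_min ge_min lexx/= ge_min; apply/orP; right.
rewrite ler_wpM2l ?sqr_ge0// lef_pV2 ?posrE ?exprn_gt0//.
by rewrite lerXn2r ?nnegrE//; exact: ltW.
Qed.

Lemma hfun_scale r l : 0 < r -> 1 <= l -> hfun A N r <= l ^+ 2 * hfun A N (l * r).
Proof.
move=> r0 l1; have l0 : 0 < l := lt_le_trans ltr01 l1.
have l2 : 1 <= l ^+ 2 by rewrite exprn_ege1.
rewrite !hfunE mulrDr lerD//.
  rewrite (_ : l ^+ 2 * ((l * r) ^- 2 * opnorm A) = r ^- 2 * opnorm A)//.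
  by field; rewrite !gt_eqF.
rewrite -RintegralZl//; last by apply: integrable_min_div; rewrite mulr_gt0.
apply: le_Rintegral => //; first exact: integrable_min_div.
  by apply: (integrableZl _ _ (integrable_min_div _)); rewrite ?mulr_gt0.
move=> x _; have [_|_] := leP 1 (vnorm x ^+ 2 / (l * r) ^+ 2).
  by rewrite mulr1 ge_min l2.
rewrite ge_min; apply/orP; right.
rewrite (_ : l ^+ 2 * (vnorm x ^+ 2 / (l * r) ^+ 2) = vnorm x ^+ 2 / r ^+ 2)//.
by field; rewrite !gt_eqF.
Qed.


(** Write |u| as n (|u| / n) with n the integer part of |u| plus one: the factor |u| / n is at most
    1, and the multiple n costs n^2 <= (1 + |u|)^2. *)
Lemma RePsi_scale (u : R) x (M : R) :
  (forall k, 0 <= k <= 1 -> RePsi A N (vscale k x) <= M) ->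
  RePsi A N (vscale `|u| x) <= (1 + `|u|) ^+ 2 * M.
Proof.
move=> h; set n := (Num.truncn `|u|).+1.
have /andP[un1 un2] : (Num.truncn `|u|)%:R <= `|u| < n%:R by exact: truncn_itv.
have n0 : 0 < n%:R :> R by rewrite ltr0n.
have -> : vscale `|u| x = vscale n%:R (vscale (`|u| / n%:R) x).
  by apply: eq_from_tnth => i; rewrite !tnth_mktuple mulrA [n%:R * _]mulrC divfK// gt_eqF.
have hk : RePsi A N (vscale (`|u| / n%:R) x) <= M.
  by apply: h; rewrite divr_ge0//= ler_pdivrMr// mul1r ltW.
apply: le_trans (RePsi_vscale_nat _ _) _.
apply: (@le_trans _ _ (n%:R ^+ 2 * M)).
  by rewrite ler_pM2l// exprn_gt0.
rewrite ler_wpM2r//.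
  by apply: le_trans hk; exact: RePsi_ge0.
rewrite lerXn2r ?nnegrE ?addr_ge0//.
by rewrite /n -natr1 addrC lerD2l.
Qed.

Lemma RePsi_vscaleN k x : RePsi A N (vscale (- k) x) = RePsi A N (vscale k x).
Proof.
rewrite !RePsiE !quadA_vscale sqrrN; congr (_ + _).
by apply: eq_Rintegral => u _; rewrite !ip_vscalel mulNr cosN.
Qed.

Lemma RePsi_scale_normr k x : RePsi A N (vscale `|k| x) = RePsi A N (vscale k x).
Proof.
have /orP[k0|k0] := le_total 0 k; first by rewrite ger0_norm.
by rewrite ler0_norm// RePsi_vscaleN.
Qed.

(** By Markov's inequality the superlevel sets of the integrable weight have finite mass. They miss
    the origin, where the weight vanishes; it is adjoined by hand and has mass zero. *)
Lemma levy_sigma_finite : sigma_finite setT N.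
Proof.
pose F k := [set x : d.-tuple R | k.+1%:R^-1 <= levy_weight x] `|` [set vzero R d].
have mF1 k : measurable [set x : d.-tuple R | k.+1%:R^-1 <= levy_weight x].
  rewrite (_ : mkset _ = levy_weight @^-1` `[k.+1%:R^-1, +oo[%classic).
    by rewrite -[X in measurable X]setTI; apply: measurable_levy_weight.
  by apply/seteqP; split => x /=; rewrite in_itv/= andbT.
have m0 : measurable [set vzero R d].
  rewrite (_ : [set vzero R d] = (fun x : d.-tuple R => vnorm x ^+ 2) @^-1` [set 0]).
    by rewrite -[X in measurable X]setTI; apply: measurable_sqr_vnorm.
  apply/seteqP; split => x /= => [->|/eqP]; first by rewrite vnorm0 expr0n.
  by rewrite expf_eq0/= => /eqP/vnorm_eq0.
exists F.
  apply/seteqP; split => x // _.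
  have [->|x0] := eqVneq x (vzero R d); first by exists 0%N => //; right.
  have w0 : 0 < levy_weight x.
    rewrite lt_min ltr01/= exprn_gt0// lt_neqAle vnorm_ge0 andbT eq_sym.
    by apply/eqP => /vnorm_eq0 /eqP; rewrite (negbTE x0).
  exists (Num.truncn (levy_weight x)^-1) => //; left => /=.
  have /andP[_ /ltW h] : (Num.truncn (levy_weight x)^-1)%:R <= (levy_weight x)^-1 < (Num.truncn (levy_weight x)^-1).+1%:R.
    by apply: truncn_itv; rewrite invr_ge0 ltW.
  by rewrite -[leRHS]invrK lef_pV2 ?posrE ?invr_gt0// ltr0n.
move=> k; split; first exact: measurableU.
apply: (@le_lt_trans _ _ (N [set x : d.-tuple R | (k.+1%:R^-1 <= levy_weight x)%R] + N [set vzero R d])%E).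
  exact: measureU2.
rewrite levyN.1 adde0.
have k0 : 0 < k.+1%:R^-1 :> R by rewrite invr_gt0.
have mw : measurable_fun setT (EFin \o levy_weight).
  by apply/measurable_EFinP; exact: measurable_levy_weight.
have := le_integral_abse N measurableT mw k0.
have -> : [set: d.-tuple R] `&` [set x | (k.+1%:R^-1%:E <= `|(EFin \o levy_weight) x|)%E]
   = [set x : d.-tuple R | (k.+1%:R^-1 <= levy_weight x)%R].
  rewrite setTI; apply/seteqP; split => x /=.
    by rewrite lee_fin ger0_norm ?levy_weight_ge0.
  by rewrite lee_fin ger0_norm ?levy_weight_ge0.
move=> h; rewrite -(@lte_pmul2l _ k.+1%:R^-1%:E) ?lte_fin//.
apply: le_lt_trans h _.
rewrite gt0_muley ?lte_fin//.
under eq_integral do rewrite /= ger0_norm ?levy_weight_ge0//.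
exact: levyN.2.
Qed.

(** The jump part is a partial integral of a nonnegative jointly measurable function, so Tonelli
    gives measurability. *)
Lemma measurable_RePsi : measurable_fun setT (RePsi A N).
Proof.
have [N' N'E] := sigma_finite_pack levy_sigma_finite.
apply: measurable_funD.
  by apply: measurable_funM => //; exact: measurable_quadA.
pose f (p : d.-tuple R * d.-tuple R) := (1 - cos (ip p.1 p.2))%:E.
have mf : measurable_fun setT f.
  apply/measurable_EFinP; apply: measurable_funB => //.
  apply: (@measurableT_comp _ _ _ _ _ _ cos).
    by apply: continuous_measurable_fun; exact: continuous_cos.
  exact: measurable_ip2.
have f0 p : (0 <= f p)%E by rewrite lee_fin oneBcos_ge0.
have := @measurable_fun_fubini_tonelli_F _ _ _ _ R N' f mf f0.
rewrite /fubini_F => h.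
apply: (eq_measurable_fun (fun z => fine (\int[N']_y f (z, y)))).
  by move=> z _; congr fine; apply: eq_measure_integral => B _ _; exact: N'E.
by apply: measurableT_comp h; exact: fine_measurable.
Qed.


Lemma RePsi_vzero : RePsi A N (vzero R d) = 0.
Proof.
have -> : vzero R d = vscale 0%:R (vzero R d).
  by apply: eq_from_tnth => i; rewrite !tnth_mktuple mul0r.
by apply/le_anti; rewrite RePsi_ge0 andbT (le_trans (RePsi_vscale_nat _ _))// expr0n mul0r.
Qed.

Lemma PsiStar_has_ubound r : has_ubound [set RePsi A N z | z in [set z | vnorm z <= r]].
Proof.
(* The maximum provides a positive radius also when r <= 0. *)
exists (2 * hfun A N (Num.max r 1)^-1) => _ [z /= zr <-].
by apply: RePsi_le_hfun; rewrite ?lt_max ?ltr01 ?orbT// le_max zr.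
Qed.

Lemma RePsi_le_PsiStar z r : vnorm z <= r -> RePsi A N z <= PsiStar A N r.
Proof. by move=> zr; apply: ub_le_sup; [exact: PsiStar_has_ubound|exists z]. Qed.

Lemma PsiStar_le r M : 0 <= r -> (forall z, vnorm z <= r -> RePsi A N z <= M) ->
  PsiStar A N r <= M.
Proof.
move=> r0 h; apply: ge_sup.
  by exists (RePsi A N (vzero R d)); exists (vzero R d) => //=; rewrite vnorm0.
by move=> _ [z /= zr <-]; exact: h.
Qed.

Lemma PsiStar_ge0 r : 0 <= r -> 0 <= PsiStar A N r.
Proof.
by move=> r0; rewrite -RePsi_vzero RePsi_le_PsiStar// vnorm0.
Qed.

Lemma le_PsiStar r s : 0 <= r -> r <= s -> PsiStar A N r <= PsiStar A N s.
Proof.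
move=> r0 rs; apply: PsiStar_le => // z zr.
by rewrite RePsi_le_PsiStar// (le_trans zr).
Qed.

Lemma PsiStar_le_hfun r : 0 < r -> PsiStar A N r <= 2 * hfun A N r^-1.
Proof. by move=> r0; apply: PsiStar_le => [|z]; [exact: ltW|exact: RePsi_le_hfun]. Qed.

Definition Hfun z : R := quadA A z + \int[N]_x Num.min 1 (ip z x ^+ 2).

(** From 1 + v <= 4 (1 + v / 4) <= 4 exp(v / 4). The quadratic growth of Re Psi along a ray is thus
    absorbed by a Laplace weight of rate 1/2, whose total mass is 4. *)
Lemma expR_half_bound (v : R) : 0 <= v -> expR (- v) * (1 + v) ^+ 2 <= 16 * expR (- (2^-1 * v)).
Proof.
move=> v0.
have h : (1 + v) ^+ 2 <= 16 * expR (2^-1 * v).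
  have -> : 2^-1 * v = v / 4 + v / 4 by field.
  rewrite expRD; have h1 := expR_ge1Dx (v / 4).
  have : (1 + v / 4) ^+ 2 <= expR (v / 4) ^+ 2.
    by rewrite lerXn2r ?nnegrE ?expR_ge0// addr_ge0// divr_ge0.
  by move: (sqr_ge0 v); nra.
have -> : 16 * expR (- (2^-1 * v)) = expR (- v) * (16 * expR (2^-1 * v)).
  by rewrite mulrCA -expRD; congr (_ * expR _); field.
by rewrite ler_wpM2l ?expR_ge0.
Qed.

(* Averaging [RePsi (u z)] over [u] with weight [exp(-|u|)] turns [1 - cos(u s)]
   into [2 s^2 / (1 + s^2)], which dominates [min 1 (s^2)]. *)
Lemma Hfun_le_PsiStar z : Hfun z <= 66 * PsiStar A N (vnorm z).
Proof.
set M := PsiStar A N (vnorm z).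
have hM k : 0 <= k <= 1 -> RePsi A N (vscale k z) <= M.
  move=> /andP[k0 k1]; apply: RePsi_le_PsiStar.
  by rewrite vnorm_vscale ger0_norm// ler_piMl ?vnorm_ge0.
have M0 : 0 <= M by rewrite PsiStar_ge0 ?vnorm_ge0.
have hA : quadA A z <= 2 * M.
  by rewrite (le_trans (quadA_le_RePsi _))// ler_pM2l// RePsi_le_PsiStar.
(* 66 = 2 + 64: the Gaussian part costs 2, and the jump part 16 times the mass 4 of the weight
   exp(-|u| / 2). *)
suff : \int[N]_x Num.min 1 (ip z x ^+ 2) <= 64 * M by rewrite /Hfun; lra.
rewrite -lee_fin /Rintegral fineK; last exact: (integrable_fin_num _ (integrable_min_ip z)).
have [N' N'E] := sigma_finite_pack levy_sigma_finite.
have NN' (f : d.-tuple R -> \bar R) : (\int[N]_x f x = \int[N']_x f x)%E.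
  by apply: eq_measure_integral => B _ _; exact/esym/N'E.
pose f (p : measurableTypeR R * d.-tuple R) :=
  (expR (- (1 * `|p.1 : R|)) * (1 + (-1) * cos (0 + (p.1 : R) * ip z p.2)))%:E.
have f0 p : (0 <= f p)%E.
  by rewrite lee_fin mulr_ge0 ?expR_ge0// add0r mulN1r oneBcos_ge0.
have mf : measurable_fun setT f.
  apply/measurable_EFinP; apply: measurable_funM.
    apply: (@measurableT_comp _ _ _ _ _ _ (fun u : R => expR (- (1 * `|u|)))) => //.
    apply: measurableT_comp => //; apply: measurableT_comp => //.
    by apply: measurable_funM => //; exact: measurableT_comp.
  apply: measurable_funD => //; apply: measurable_funM => //.
  apply: (@measurableT_comp _ _ _ _ _ _ cos).
    by apply: continuous_measurable_fun; exact: continuous_cos.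
  apply: measurable_funD => //; apply: measurable_funM => //.
  by apply: measurableT_comp => //; exact: measurable_ip.
rewrite NN'; apply: (@le_trans _ _ (\int[N']_x \int[lebesgue_measure]_u f (u, x))%E).
  apply: ge0_le_integral => //.
  - by move=> x _; rewrite lee_fin le_min ler01 sqr_ge0.
  - by have /integrableP[] := integrable_min_ip z.
  - exact: measurable_fun_fubini_tonelli_G.
  move=> x _; rewrite /f/= integral_laplace_cos//; last by rewrite normrN normr1.
  rewrite lee_fin cos0 expr1n; set s := ip z x.
  have s1 : 0 < 1 + s ^+ 2 by rewrite ltr_wpDr ?sqr_ge0.
  have -> : 1 * (2 / 1) + -1 * 1 * (2 * 1 / (1 + s ^+ 2)) = 2 * s ^+ 2 / (1 + s ^+ 2).
    by field; rewrite gt_eqF.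
  rewrite ler_pdivlMr//; have [h|h] := leP 1 (s ^+ 2); first by lra.
  by have := sqr_ge0 s; nra.
rewrite -fubini_tonelli//.
(* The majorant is written with a zero cosine coefficient so that [integral_laplace_cos] evaluates
   it. *)
apply: (@le_trans _ _ (\int[lebesgue_measure]_u ((16 * M)%:E * (expR (- (2^-1 * `|u|)) * (1 + 0 * cos (0 + u * 0)))%:E))%E).
  apply: ge0_le_integral => //.
  - by move=> u _; apply: integral_ge0 => x _; exact: f0.
  - exact: measurable_fun_fubini_tonelli_F.
  - apply/measurable_EFinP; apply: measurable_funM => //.
    exact: measurable_laplace_cos.
  move=> u _.
  have -> : (\int[N']_x f (u, x) = ((expR (- (1 * `|u|)))%:E * (\int[N]_x (1 - cos (ip (vscale u z) x)))%:E))%E.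
    rewrite /Rintegral fineK; last exact: (integrable_fin_num _ (integrable_oneBcos _)).
    rewrite NN' -ge0_integralZl_EFin ?expR_ge0//.
    + by apply: eq_integral => x _; rewrite -EFinM /f/= add0r mulN1r ip_vscalel.
    + by apply/measurable_EFinP; exact: measurable_oneBcos.
  rewrite -!EFinM lee_fin mul0r addr0 mulr1 mul1r mulrAC.
  apply: (@le_trans _ _ (expR (- `|u|) * ((1 + `|u|) ^+ 2 * M))).
    rewrite ler_wpM2l ?expR_ge0//.
    have h := RePsi_scale (u : R) hM.
    rewrite RePsi_scale_normr RePsiE in h.
    by apply: le_trans h; rewrite lerDr divr_ge0// symA.2.
  by rewrite mulrA ler_wpM2r// expR_half_bound.
rewrite ge0_integralZl_EFin//.
- rewrite integral_laplace_cos ?normr0// -EFinM lee_fin.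
  have -> : 16 * M * (1 * (2 / 2^-1) + 0 * cos 0 * (2 * 2^-1 / (2^-1 ^+ 2 + 0 ^+ 2))) = 64 * M.
    by rewrite mul0r mul0r addr0; field.
  by [].
- by apply/measurable_EFinP; exact: measurable_laplace_cos.
- by rewrite mulr_ge0.
Qed.


Lemma min1_sum_le (I : Type) (r : seq I) (a : I -> R) : (forall i, 0 <= a i) ->
  Num.min 1 (\sum_(i <- r) a i) <= \sum_(i <- r) Num.min 1 (a i).
Proof.
move=> a0; elim: r => [|i r IH]; first by rewrite !big_nil ge_min lexx orbT.
have S0 : 0 <= \sum_(j <- r) a j by apply: sumr_ge0.
rewrite !big_cons; apply: le_trans (lerD (lexx _) IH).
by have := a0 i; rewrite !minEle; case: ifPn; case: ifPn; case: ifPn => //; rewrite -?ltNge; lra.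
Qed.

Definition vunit (j : 'I_d) : d.-tuple R := [tuple (i == j)%:R | i < d].

Lemma ip_vunit j x : ip (vunit j) x = tnth x j.
Proof.
rewrite /ip (bigD1 j)//= tnth_mktuple eqxx mul1r big1 ?addr0// => i ij.
by rewrite tnth_mktuple (negbTE ij) mul0r.
Qed.

Lemma vnorm_vunit j : vnorm (vunit j) = 1.
Proof. by rewrite /vnorm ip_vunit tnth_mktuple eqxx sqrtr1. Qed.

(** Coordinate directions suffice: min(1, r^2 |x|^2) is at most the sum over j of min(1, <r e_j,
    x>^2), and each term is controlled by [Hfun_le_PsiStar]. The summand 2 accounts for the operator
    norm. *)
Lemma hfun_le_PsiStar r : 0 < r -> hfun A N r^-1 <= (2 + d%:R * 66) * PsiStar A N r.
Proof.
move=> r0; rewrite hfunE mulrDl; apply: lerD.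
  rewrite exprVn invrK mulrC -ler_pdivlMr ?exprn_gt0//; apply: opnorm_le => x x1.
  rewrite ler_pdivlMr ?exprn_gt0// mulrC -quadA_vscale.
  rewrite (le_trans (quadA_le_RePsi _))// ler_pM2l// RePsi_le_PsiStar//.
  by rewrite vnorm_vscale (gtr0_norm r0) ler_piMr// ltW.
have hj (j : 'I_d) : \int[N]_x Num.min 1 (ip (vscale r (vunit j)) x ^+ 2) <= 66 * PsiStar A N r.
  have := Hfun_le_PsiStar (vscale r (vunit j)).
  rewrite vnorm_vscale (gtr0_norm r0) vnorm_vunit mulr1; apply: le_trans.
  by rewrite /Hfun lerDr symA.2.
have hsum : \int[N]_x (\sum_(j < d) Num.min 1 (ip (vscale r (vunit j)) x ^+ 2)) =
    \sum_(j < d) \int[N]_x Num.min 1 (ip (vscale r (vunit j)) x ^+ 2).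
  apply: EFin_inj; rewrite -sumEFin [LHS]fineK; last first.
    apply: integrable_fin_num => //.
    under eq_fun do rewrite -sumEFin.
    by apply: integrable_sum => // j _; exact: integrable_min_ip.
  under eq_integral do rewrite -sumEFin.
  rewrite integral_sum//; last by move=> j; exact: integrable_min_ip.
  apply: eq_bigr => j _; rewrite fineK//.
  exact: (integrable_fin_num _ (integrable_min_ip _)).
apply: (@le_trans _ _ (\int[N]_x (\sum_(j < d) Num.min 1 (ip (vscale r (vunit j)) x ^+ 2)))).
  apply: le_Rintegral => //.
  - by apply: integrable_min_div; rewrite invr_gt0.
  - rewrite /comp; under eq_fun do rewrite -sumEFin.
    by apply: integrable_sum => // j _; exact: integrable_min_ip.
  move=> x _; apply: le_trans (min1_sum_le _ _) => [|j]; last exact: sqr_ge0.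
  rewrite le_min ge_min lexx/= ge_min; apply/orP; right.
  rewrite sqr_vnorm exprVn invrK mulrC /ip big_distrr/=.
  apply: ler_sum => j _.
  by rewrite -/(ip _ _) ip_vscalel ip_vunit exprMn -expr2.
rewrite hsum; apply: (@le_trans _ _ (\sum_(j < d) 66 * PsiStar A N r)).
  exact: ler_sum.
by rewrite sumr_const card_ord -[leLHS]mulr_natl mulrA.
Qed.

(** Dominated convergence along the integers. It bounds the superlevel sets of h, which makes the
    supremum defining [hinv] a genuine one. *)
Lemma hfun_cvg0 (e : R) : 0 < e -> exists2 r, 0 < r & hfun A N r < e.
Proof.
move=> e0.
have inv0 c : (c / n.+1%:R ^+ 2 : R) @[n --> \oo] --> 0.
  rewrite -[X in _ --> X](mulr0 c); apply: cvgMr.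
  rewrite -[X in _ --> X](mulr0 0).
  under eq_fun do rewrite expr2 invfM.
  by apply: cvgM; exact: cvg_harmonic.
have h1 : (\int[N]_x (Num.min 1 (vnorm x ^+ 2 / n.+1%:R ^+ 2))%:E @[n --> \oo] --> \int[N]_x (cst 0%E x))%E.
  apply: (@dominated_cvg _ _ _ N setT measurableT _ _ (EFin \o levy_weight)) => //.
  - move=> n; apply/measurable_EFinP; apply: measurable_minr => //.
    by apply: measurable_funM => //; exact: measurable_sqr_vnorm.
  - move=> x _; apply: cvg_EFin; first by apply: nearW.
    apply: (@squeeze_cvgr _ _ _ _ (cst 0) (fun n => vnorm x ^+ 2 / n.+1%:R ^+ 2)).
    + by apply: nearW => n; rewrite le_min ler01 divr_ge0 ?sqr_ge0//= ge_min lexx orbT.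
    + exact: cvg_cst.
    + exact: inv0.
  - apply/integrableP; split; first by apply/measurable_EFinP; exact: measurable_levy_weight.
    under eq_integral do rewrite /= ger0_norm ?levy_weight_ge0//.
    exact: levyN.2.
  - move=> n x _; rewrite /= lee_fin ger0_norm ?le_min ?ler01 ?divr_ge0 ?sqr_ge0//.
    rewrite ge_min lexx/= ge_min; apply/orP; right.
    by rewrite ler_pdivrMr// ler_peMr ?sqr_ge0// exprn_ege1// ler1n.
rewrite integral0 in h1.
have h2 : (\int[N]_x (Num.min 1 (vnorm x ^+ 2 / n.+1%:R ^+ 2)) : R) @[n --> \oo] --> 0.
  exact: fine_cvg.
have h3 : hfun A N n.+1%:R @[n --> \oo] --> 0.
  rewrite -[X in _ --> X](addr0 0); apply: cvgD h2.
  by under eq_fun do rewrite mulrC; exact: inv0.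
have [n _ /(_ n (leqnn n))/= hn] := cvgr_lt 0 h3 e e0.
by exists n.+1%:R.
Qed.

(** * The inverse of h up to constants *)

Section inverse.
Hypothesis hoo : hfun A N r @[r --> 0^'+] --> +oo.

Lemma hfun_large M : exists2 r : R, 0 < r & M <= hfun A N r.
Proof.
have h : \forall r \near 0^'+, M <= hfun A N r by move/cvgryPge: hoo; exact.
near (0 : R)^'+ => r; exists r; first by near: r; exact: nbhs_right_gt.
by near: r.
Unshelve. all: by end_near. Qed.

(** Near 0 the function h is at least 1, and h(s) <= (r / s)^2 h(r) carries positivity to larger
    radii. *)
Lemma hfun_gt0 r : 0 < r -> 0 < hfun A N r.
Proof.
move=> r0; have [s s0 hs] := hfun_large 1.
have [rs|rs] := leP r s.
  by rewrite (lt_le_trans ltr01)// (le_trans hs)// hfun_nincr.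
have l1 : 1 <= r / s by rewrite ler_pdivlMr// mul1r ltW.
have := hfun_scale s0 l1; rewrite divfK ?gt_eqF// => h.
have : 0 < (r / s) ^+ 2 * hfun A N r by rewrite (lt_le_trans ltr01)// (le_trans hs).
by rewrite pmulr_rgt0// exprn_gt0// (lt_le_trans ltr01).
Qed.

(** In dimension 0 the exponent vanishes identically, so h(1) <= C [PsiStar] would contradict the
    positivity of h. *)
Lemma dim_gt0 : (0 < d)%N.
Proof.
rewrite lt0n; apply/eqP => d0.
have := hfun_gt0 ltr01; have := hfun_le_PsiStar ltr01; rewrite invr1 => h1 h2.
have : PsiStar A N 1 <= 0.
  apply: PsiStar_le => // z _; rewrite (_ : z = vzero R d) ?RePsi_vzero//.
  by apply: eq_from_tnth => -[i id]; exfalso; rewrite d0 in id.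
have := ler0n R d; nra.
Qed.

Lemma hinv_has_ubound s : 0 < s -> has_ubound [set r | 0 < r /\ s <= hfun A N r].
Proof.
move=> s0; have [r0 r00 hr0] := hfun_cvg0 s0.
exists r0 => r [r1 sr]; rewrite leNgt; apply/negP => rr.
have := hfun_nincr r00 (ltW rr); rewrite leNgt => /negP; apply.
exact: lt_le_trans hr0 sr.
Qed.

Lemma le_hinv r s : 0 < s -> 0 < r -> s <= hfun A N r -> r <= hinv A N s.
Proof. by move=> s0 r0 sr; apply: ub_le_sup; [exact: hinv_has_ubound|]. Qed.

Lemma hinv_gt0 s : 0 < s -> 0 < hinv A N s.
Proof.
by move=> s0; have [r r0 sr] := hfun_large s; rewrite (lt_le_trans r0)// le_hinv.
Qed.

(** The radius 2 h^{-1}(s) lies beyond the supremum, so h is below s there, and halving a radius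
    multiplies h by at most 4. With the converse bound below, this stands in for h(h^{-1}(s)) =
    s. *)
Lemma hfun_hinv_le s : 0 < s -> hfun A N (hinv A N s) <= 4 * s.
Proof.
move=> s0; have r0 := hinv_gt0 s0.
have := hfun_scale r0 (ler1n _ 2); rewrite (_ : 2%:R ^+ 2 = 4); last by ring.
have : hfun A N (2 * hinv A N s) < s.
  rewrite ltNge; apply/negP => /(le_hinv s0); rewrite mulr_gt0// => /(_ isT); lra.
lra.
Qed.

(** Some radius beyond h^{-1}(s) / 2 still satisfies s <= h, and doubling the radius divides h by at
    most 4. *)
Lemma hfun_hinv_ge s : 0 < s -> s <= 4 * hfun A N (hinv A N s).
Proof.
move=> s0; have r0 := hinv_gt0 s0.
have [r [r1 sr] hr] : exists2 r, [set r | 0 < r /\ s <= hfun A N r] r & hinv A N s - hinv A N s / 2 < r.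
  apply: sup_adherent; first by rewrite divr_gt0.
  split; last exact: hinv_has_ubound.
  by have [r r1 sr] := hfun_large s; exists r.
have h2 : 0 < hinv A N s / 2 by rewrite divr_gt0.
have := hfun_scale h2 (ler1n _ 2).
rewrite (mulrC 2%:R) divfK// (_ : 2%:R ^+ 2 = 4); last by ring.
apply: le_trans; apply: le_trans sr _; apply: hfun_nincr => //; lra.
Qed.

End inverse.
End levy_facts.

(** * Lebesgue measure and lower bounds by disjoint cubes *)

Section leb_measure.
Variable R : realType.

Definition leb_measure n : {sigma_finite_measure set (n.-tuple R) -> \bar R} :=
  projT1 (cid (leb_measure_exists R n)).

Lemma leb_intE n (f : n.-tuple R -> \bar R) : measurable_fun setT f ->
  (forall x, (0 <= f x)%E) -> leb_int f = (\int[leb_measure n]_x f x)%E.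
Proof. exact: (projT2 (cid (leb_measure_exists R n))). Qed.

Lemma le_leb_int n (f g : n.-tuple R -> R) : measurable_fun setT f ->
  measurable_fun setT g -> (forall x, 0 <= f x) -> (forall x, f x <= g x) ->
  (leb_int (fun x => (f x)%:E) <= leb_int (fun x => (g x)%:E))%E.
Proof.
move=> mf mg f0 fg.
have g0 x : 0 <= g x by apply: le_trans (fg x).
rewrite !leb_intE//; try by apply/measurable_EFinP.
by apply: ge0_le_integral => //; try (by apply/measurable_EFinP); move=> x _; rewrite lee_fin.
Qed.

Lemma leb_intD n (f g : n.-tuple R -> R) : measurable_fun setT f ->
  measurable_fun setT g -> (forall x, 0 <= f x) -> (forall x, 0 <= g x) ->
  (leb_int (fun x => (f x + g x)%:E) =
   leb_int (fun x => (f x)%:E) + leb_int (fun x => (g x)%:E))%E.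
Proof.
move=> mf mg f0 g0.
rewrite !leb_intE//; try by apply/measurable_EFinP.
- under eq_integral do rewrite EFinD.
  by rewrite ge0_integralD//; try (by apply/measurable_EFinP); move=> x _; rewrite lee_fin.
- by apply/measurable_EFinP; exact: measurable_funD.
- by move=> x; rewrite lee_fin addr_ge0.
Qed.

Lemma leb_intZ n (k : R) (f : n.-tuple R -> R) : measurable_fun setT f ->
  0 <= k -> (forall x, 0 <= f x) ->
  (leb_int (fun x => (k * f x)%:E) = k%:E * leb_int (fun x => (f x)%:E))%E.
Proof.
move=> mf k0 f0.
rewrite !leb_intE//; try by apply/measurable_EFinP.
- under eq_integral do rewrite EFinM.
  by rewrite ge0_integralZl_EFin//; try (by apply/measurable_EFinP); move=> x _; rewrite lee_fin.
- by apply/measurable_EFinP; exact: measurable_funM.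
- by move=> x; rewrite lee_fin mulr_ge0.
Qed.

Lemma leb_int_sum n (I : Type) (s : seq I) (f : I -> n.-tuple R -> R) :
  (forall i, measurable_fun setT (f i)) -> (forall i x, 0 <= f i x) ->
  (leb_int (fun x => (\sum_(i <- s) f i x)%:E) =
   \sum_(i <- s) leb_int (fun x => (f i x)%:E))%E.
Proof.
move=> mf f0; elim: s => [|i s IH].
  rewrite big_nil leb_intE//.
  - by under eq_integral do rewrite big_nil; rewrite integral0.
  - by apply/measurable_EFinP; exact: measurable_sum.
  - by move=> x; rewrite big_nil.
rewrite big_cons -IH -leb_intD//.
- by congr leb_int; apply/funext => x; rewrite big_cons.
- exact: measurable_sum.
- by move=> x; exact: sumr_ge0.
Qed.

End leb_measure.

Section real_lemmas.
Variable R : realType.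

(** The n-th power of y / n <= exp(y / n); a suitable n later turns a lower bound on an exponent
    into integrable polynomial decay. *)
Lemma expRN_le_pow n (y : R) : 0 < y -> expR (- y) <= (n%:R / y) ^+ n.
Proof.
case: n => [|n] y0; first by rewrite expr0 -expR0 ler_expR oppr_le0 ltW.
have n0 : 0 < n.+1%:R :> R by rewrite ltr0n.
have h : y / n.+1%:R <= expR (y / n.+1%:R).
  by rewrite (le_trans _ (expR_ge1Dx _))// lerDr.
rewrite expRN -[leRHS]invrK lef_pV2 ?posrE ?invr_gt0 ?expR_gt0 ?exprn_gt0 ?divr_gt0//.
rewrite -exprVn invf_div.
have -> : expR y = expR (y / n.+1%:R) ^+ n.+1.
  by rewrite -expRM_natl mulrC divfK// gt_eqF.
by rewrite lerXn2r ?nnegrE ?expR_ge0// divr_ge0// ltW.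
Qed.

Lemma exists_expr_le (q e : R) : 0 <= q < 1 -> 0 < e -> exists n, q ^+ n <= e.
Proof.
move=> /andP[q0 q1] e0.
have h : q ^+ n @[n --> \oo] --> 0 by apply: cvg_expr; rewrite ger0_norm.
have [n _ /(_ n (leqnn n))/= hn] := cvgr_lt 0 h e e0.
by exists n; exact: ltW.
Qed.

(** Iterating the contraction gives f(k^n r) <= q^n f(r). Taking m with q^m <= k converts q^n into
    k^n after raising to the power m, and C = 1 / k pays for rounding l to a power of k. *)
Lemma geometric_scaling (f : R -> R) (r0 k q : R) :
  (forall r, 0 < r -> 0 <= f r) ->
  (forall r s, 0 < r -> r <= s -> f r <= f s) ->
  0 < k < 1 -> 0 <= q < 1 ->
  (forall r, 0 < r < r0 -> f (k * r) <= q * f r) ->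
  exists m, exists2 C, 0 < C & (0 < m)%N /\ forall l r, 0 < l <= 1 -> 0 < r < r0 ->
    f (l * r) ^+ m <= C * l * f r ^+ m.
Proof.
move=> f0 fmon /andP[k0 k1] q01 fk; have /andP[q0 q1] := q01.
have [m0 qm0] := exists_expr_le q01 k0.
have qm : q ^+ m0.+1 <= k by rewrite exprS (le_trans _ qm0)// ler_piMl ?exprn_ge0// ltW.
exists m0.+1, k^-1; first by rewrite invr_gt0.
split=> // l r /andP[l0 l1] /andP[r1 r2].
have ex : exists n, k ^+ n.+1 < l.
  have k01 : 0 <= k < 1 by rewrite ltW.
  have l20 : 0 < l / 2 by rewrite divr_gt0.
  have [n hn] := exists_expr_le k01 l20.
  exists n; apply: (@le_lt_trans _ _ (l / 2)); last by rewrite ltr_pdivrMr// ltr_pMr// ltr1n.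
  by rewrite exprS (le_trans _ hn)// ler_piMl ?exprn_ge0 ?ltW.
(* Minimality of n gives k^(n+1) < l <= k^n; for n = 0 the upper bound is the assumption l <= 1. *)
pose n := ex_minn ex.
have [kn ln] : k ^+ n.+1 < l /\ l <= k ^+ n.
  rewrite /n; case: ex_minnP => -[|p] hp hmin; first by rewrite expr0.
  split=> //; rewrite leNgt; apply/negP => /hmin; by rewrite ltnn.
have hfn j : f (k ^+ j * r) <= q ^+ j * f r.
  elim: j => [|j IH]; first by rewrite !expr0 !mul1r.
  rewrite !exprS -!mulrA; apply: (@le_trans _ _ (q * f (k ^+ j * r))).
    apply: fk; rewrite mulr_gt0 ?exprn_gt0//=.
    by rewrite (le_lt_trans _ r2)// ler_piMl ?(ltW r1)// exprn_ile1 ?ltW.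
  by rewrite ler_wpM2l.
have h1 : f (l * r) <= q ^+ n * f r.
  apply: le_trans (hfn n); apply: fmon; first by rewrite mulr_gt0.
  by rewrite ler_wpM2r// ltW.
have fr := f0 _ r1.
apply: (@le_trans _ _ ((q ^+ n * f r) ^+ m0.+1)).
  by rewrite lerXn2r ?nnegrE ?f0 ?mulr_gt0// mulr_ge0// exprn_ge0.
rewrite exprMn ler_wpM2r ?exprn_ge0// exprAC.
apply: (@le_trans _ _ (k ^+ n)).
  by rewrite lerXn2r ?nnegrE ?exprn_ge0// ltW.
by rewrite mulrC ler_pdivlMr// mulrC -exprS ltW.
Qed.

End real_lemmas.

Section lower_bound.
Variables (R : realType) (d : nat) (A : 'M[R]_d).
Variable N : {measure set (d.-tuple R) -> \bar R}.
Hypothesis symA : sym_nonneg_def A.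
Hypothesis levyN : levy_measure N.
Implicit Types x y z : d.-tuple R.

Lemma measurable_expRePsi t : measurable_fun setT (fun z => expR (- (t * RePsi A N z))).
Proof.
apply: measurableT_comp => //; apply: measurableT_comp => //.
by apply: measurable_funM => //; exact: measurable_RePsi.
Qed.

Lemma vnorm_le_sum x : vnorm x <= \sum_i `|tnth x i|.
Proof.
have S0 : 0 <= \sum_i `|tnth x i| by apply: sumr_ge0.
rewrite -(ler_pXn2r (n := 2)) ?nnegrE ?vnorm_ge0// sqr_vnorm expr2 mulr_suml.
apply: ler_sum => i _; rewrite -expr2 -real_normK ?num_real// expr2.
by rewrite ler_wpM2l// (bigD1 i)//= lerDl sumr_ge0.
Qed.

(* Disjoint translates [k x0 + Q], [k < K], of a small cube [Q]. *)
Lemma leb_int_expRePsi_ge (t C r : R) x0 K : 0 <= t -> 0 < r -> r <= vnorm x0 ->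
  (forall k y, (k < K)%N -> vnorm y <= r ->
     RePsi A N (vadd (vscale k%:R x0) y) <= C) ->
  ((K%:R * (r / d%:R) ^+ d * expR (- (t * C)))%:E <=
   leb_int (fun z : d.-tuple R => (expR (- (t * RePsi A N z)))%:E))%E.
Proof.
move=> t0 r0 rx0 hC.
have d0 : (0 < d)%N.
  rewrite lt0n; apply/eqP => d0; move: rx0; rewrite leNgt => /negP; apply.
  rewrite (_ : x0 = vzero R d) ?vnorm0//.
  by apply: eq_from_tnth => -[i id]; exfalso; rewrite d0 in id.
have d0R : 0 < d%:R :> R by rewrite ltr0n.
(* Half the side of the cubes: their volume is (r / d)^d, and d a = r / 2 keeps the centred cube
   inside the ball of radius r. *)
pose a := r / d%:R / 2.
have a0 : 0 < a by rewrite !divr_gt0.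
(* Otherwise |x0| <= sum_i |x0_i| < 2 a d = r. Along such a coordinate j consecutive centres are at
   least one side apart, so the open cubes are disjoint. *)
have [j xj] : exists j, 2 * a <= `|tnth x0 j|.
  apply/existsP; apply: contraT; rewrite negb_exists => /forallP h.
  have : \sum_i `|tnth x0 i| < \sum_(i < d) (2 * a).
    apply: ltr_sum => [|i _]; last by rewrite ltNge.
    by apply/hasP; exists (Ordinal d0); rewrite ?mem_index_enum.
  rewrite sumr_const card_ord -[ltRHS]mulr_natl /a => h2.
  have := le_lt_trans (vnorm_le_sum x0) h2.
  rewrite (_ : d%:R * (2 * (r / d%:R / 2)) = r); last by field; rewrite gt_eqF.
  by rewrite ltNge rx0.
pose I (k : nat) (i : 'I_d) := `](k%:R * tnth x0 i - a), (k%:R * tnth x0 i + a)[%classic.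
pose F (k : nat) z := expR (- (t * C)) * \prod_i (\1_(I k i) (tnth z i) : R).
have mI k i : measurable_fun setT (\1_(I k i) : R -> R).
  by apply: measurable_indic; exact: measurable_itv.
have mF k : measurable_fun setT (F k).
  apply: measurable_funM => //; apply: measurable_prod => i _.
  by apply: (@measurableT_comp _ _ _ _ _ _ (\1_(I k i) : R -> R)) => //; exact: measurable_tnth.
have F0 k z : 0 <= F k z.
  by rewrite mulr_ge0 ?expR_ge0//; apply: prodr_ge0 => i _.
have intF k : leb_int (fun z => (F k z)%:E) = (expR (- (t * C)) * (r / d%:R) ^+ d)%:E.
  rewrite (@leb_int_prod _ _ (fun i => \1_(I k i)) (fun=> r / d%:R)) ?expR_ge0//.
    by rewrite prodr_const card_ord.
  move=> i.
  have h := @integral_indic _ _ R (@lebesgue_measure R) setT measurableT (I k i) (measurable_itv _).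
  rewrite setIT in h; apply: etrans h _.
  apply: etrans (lebesgue_measure_itv `](k%:R * tnth x0 i - a), (k%:R * tnth x0 i + a)[) _.
  rewrite /= lte_fin.
  rewrite ltrD2l gtrN// -EFinB; congr EFin; rewrite /a; field.
  by rewrite gt_eqF.
have -> : (K%:R * (r / d%:R) ^+ d * expR (- (t * C)))%:E =
   leb_int (fun z => (\sum_(k < K) F k z)%:E).
  rewrite (@leb_int_sum _ _ _ _ (fun k : 'I_K => F k))//.
  under eq_bigr do rewrite intF.
  by rewrite sumEFin sumr_const card_ord; congr EFin; rewrite -[RHS]mulr_natl; ring.
apply: le_leb_int.
- by apply: measurable_sum => k; exact: mF.
- exact: measurable_expRePsi.
- by move=> z; apply: sumr_ge0 => k _; exact: F0.
move=> z.
have F00 (k : nat) i : tnth z i \notin I k i -> F k z = 0.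
  by move=> zi; rewrite /F (bigD1 i)//= indicE (negbTE zi) mul0r mulr0.
have [/existsP[k /forallP zk]|] := boolP [exists k : 'I_K, [forall i, tnth z i \in I k i]]; last first.
  rewrite negb_exists => /forallP h; rewrite big1 ?expR_ge0// => k _.
  by have /forallPn[i zi] := h k; exact: F00 zi.
have zkb i : k%:R * tnth x0 i - a < tnth z i < k%:R * tnth x0 i + a.
  by have := zk i; rewrite inE/= ?in_itv.
rewrite (bigD1 k)//= big1 ?addr0; last first.
  (* If z lay in the cubes of both l and k, then |l - k| |x0_j| < 2 a, which is impossible for
     distinct integers. *)
  move=> l lk; apply: (F00 _ j); apply/negP => zl0.
  have zl : l%:R * tnth x0 j - a < tnth z j < l%:R * tnth x0 j + a.
    by move: zl0; rewrite inE/= ?in_itv.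
  have : `|l%:R - k%:R| * `|tnth x0 j| < 2 * a.
    rewrite -normrM mulrBl; have := zkb j; move: zl.
    move=> /andP[? ?] /andP[? ?]; rewrite ltr_norml; apply/andP; split; lra.
  apply/negP; rewrite -leNgt (le_trans xj)// ler_peMl//.
  rewrite -val_eqE/= in lk.
  have [lk'|lk'|lk'] := ltngtP l k; last by rewrite lk' eqxx in lk.
    by rewrite distrC ger0_norm ?subr_ge0 ?ler_nat ?(ltnW lk')// -natrB ?(ltnW lk')// ler1n subn_gt0.
  by rewrite ger0_norm ?subr_ge0 ?ler_nat ?(ltnW lk')// -natrB ?(ltnW lk')// ler1n subn_gt0.
rewrite /F big1 ?mulr1; last by move=> i _; rewrite indicE zk.
rewrite ler_expR lerN2 ler_wpM2l//.
pose y : d.-tuple R := [tuple tnth z i - k%:R * tnth x0 i | i < d].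
have -> : z = vadd (vscale k%:R x0) y.
  by apply: eq_from_tnth => i; rewrite !tnth_mktuple addrC subrK.
apply: hC => //; apply: le_trans (vnorm_le_sum _) _.
apply: (@le_trans _ _ (\sum_(i < d) a)).
  apply: ler_sum => i _; rewrite tnth_mktuple ler_norml.
  by have := zkb i; move=> /andP[? ?]; apply/andP; split; lra.
rewrite sumr_const card_ord -[leLHS]mulr_natl /a.
have -> : d%:R * (r / d%:R / 2) = r / 2 by field; rewrite gt_eqF.
by rewrite ler_pdivrMr// ler_peMr ?(ltW r0)// ler1n.
Qed.

(** The case of a single cube, centred at the origin; x0 is any vector of norm r and only serves to
    apply the general bound. *)
Lemma leb_int_expRePsi_ge_ball (t r : R) : (0 < d)%N -> 0 <= t -> 0 < r ->
  (((r / d%:R) ^+ d * expR (- (t * (2 * hfun A N r^-1))))%:E <=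
   leb_int (fun z : d.-tuple R => (expR (- (t * RePsi A N z)))%:E))%E.
Proof.
move=> d0 t0 r0; pose x0 := vscale r (vunit R (Ordinal d0)).
have h := @leb_int_expRePsi_ge t (2 * hfun A N r^-1) r x0 1 t0 r0.
rewrite mul1r in h; apply: h.
  by rewrite /x0 vnorm_vscale vnorm_vunit mulr1 ler_norm.
move=> [|k]// y _ yr; rewrite (_ : vadd _ _ = y); first exact: RePsi_le_hfun.
by apply: eq_from_tnth => i; rewrite !tnth_mktuple mul0r add0r.
Qed.

Lemma leb_int_expRePsi_ge_multi (t r M : R) x0 K : 0 <= t -> 0 < r -> r <= vnorm x0 ->
  (forall y, vnorm y <= r -> RePsi A N y <= M) ->
  ((K%:R * (r / d%:R) ^+ d * expR (- (t * (2 * (K%:R ^+ 2 * RePsi A N x0) + 2 * M))))%:E <=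
   leb_int (fun z : d.-tuple R => (expR (- (t * RePsi A N z)))%:E))%E.
Proof.
move=> t0 r0 rx0 hM; apply: (leb_int_expRePsi_ge t0 r0 rx0) => k y kK yr.
apply: le_trans (RePsi_vadd symA levyN _ _) _.
rewrite lerD// ler_pM2l//; last exact: hM.
apply: le_trans (RePsi_vscale_nat A levyN _ _) _.
rewrite ler_wpM2r ?RePsi_ge0// lerXn2r ?nnegrE// ler_nat; exact: ltnW.
Qed.

End lower_bound.

(** * (D2) => (D3) => (D4) => (D2) *)

Section equivalences.
Variables (R : realType) (d : nat) (A : 'M[R]_d).
Variable N : {measure set (d.-tuple R) -> \bar R}.
Hypothesis symA : sym_nonneg_def A.
Hypothesis levyN : levy_measure N.
Hypothesis hoo : hfun A N r @[r --> 0^'+] --> +oo.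
Implicit Types x y z : d.-tuple R.

Let g (r : R) := hfun A N r^-1.

Let g_gt0 r : 0 < r -> 0 < g r.
Proof. by move=> r0; apply: hfun_gt0 => //; rewrite invr_gt0. Qed.

Let g_mono r s : 0 < r -> r <= s -> g r <= g s.
Proof.
move=> r0 rs; apply: hfun_nincr => //; first by rewrite invr_gt0 (lt_le_trans r0).
by rewrite lef_pV2 ?posrE// (lt_le_trans r0).
Qed.

Let g_small e : 0 < e -> exists2 r0, 0 < r0 & forall r, 0 < r < r0 -> g r < e.
Proof.
move=> e0; have [R0 R00 hR] := hfun_cvg0 A levyN e0.
exists R0^-1; first by rewrite invr_gt0.
move=> r /andP[r0 rR]; apply: le_lt_trans hR; apply: hfun_nincr => //.
by rewrite -[leLHS]invrK lef_pV2 ?posrE ?invr_gt0// ltW.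
Qed.

Let d0 : (0 < d)%N := dim_gt0 symA levyN hoo.
Let d0R : 0 < d%:R :> R. Proof. by rewrite ltr0n d0. Qed.

Definition PsiIntegral (t : R) : \bar R :=
  leb_int (fun z : d.-tuple R => (expR (- (t * RePsi A N z)))%:E).

Definition D2 := exists T2 c2 : R, 0 < T2 /\ 0 < c2 /\
  forall t : R, T2 < t -> (PsiIntegral t <= (c2 * (hinv A N t^-1) ^- d)%:E)%E.

(** At time 1 / g(r) the radius 1 / r belongs to the set whose supremum is h^{-1}(g(r)), so the
    bound of (D2) becomes c r^d. Since g is small near 0, small radii correspond to large times. *)
Lemma D2_small_radius : D2 -> exists r0 c, [/\ 0 < r0, 0 < c &
  forall r, 0 < r < r0 -> (PsiIntegral (g r)^-1 <= (c * r ^+ d)%:E)%E].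
Proof.
move=> [T2 [c2 [T20 [c20 h]]]].
have e0 : 0 < T2^-1 by rewrite invr_gt0.
have [r0 r00 hr0] := g_small e0.
exists r0, c2; split=> // r /andP[r1 r2].
have gr := g_gt0 r1.
apply: le_trans (h _ _) _.
  by rewrite -[ltLHS]invrK ltf_pV2 ?posrE// hr0// r1.
rewrite lee_fin ler_pM2l// invrK -[leRHS]invrK.
have rr : r^-1 <= hinv A N (g r) by apply: le_hinv => //; rewrite invr_gt0.
have ri : 0 < r^-1 by rewrite invr_gt0.
rewrite lef_pV2 ?posrE ?invr_gt0 ?exprn_gt0//; last exact: lt_le_trans rr.
by rewrite -exprVn lerXn2r ?nnegrE ?(ltW ri)// (le_trans (ltW ri)).
Qed.

(** At time 1 / g(k r) the integral is at most c (k r)^d, while the cube of size r contributes v r^d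
    exp(-2 g(r) / g(k r)). If g(k r) > g(r) / 2, that exponential exceeds exp(-4), and a small k is
    contradictory. *)
Lemma D2_scaling : D2 -> exists r0 k, [/\ 0 < r0, 0 < k < 1 &
  forall r, 0 < r < r0 -> g (k * r) <= 2^-1 * g r].
Proof.
move=> /D2_small_radius[r0 [c [r00 c0 h]]].
pose v : R := d%:R^-1 ^+ d.
have v0 : 0 < v by rewrite exprn_gt0// invr_gt0.
(* Chosen so that c k^d <= c k <= v exp(-4) / 2; the halving makes the contradiction strict. *)
pose k := Num.min 2^-1 (v * expR (- 4) / (2 * c)).
have e0 : 0 < v * expR (- 4) / (2 * c) by rewrite divr_gt0 ?mulr_gt0 ?expR_gt0.
have k0 : 0 < k by rewrite lt_min invr_gt0 ltr0n.
have k1 : k < 1 by rewrite gt_min invf_lt1 ?ltr0n// ltr1n.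
exists r0, k; split=> //; first by rewrite k0.
move=> r /andP[r1 r2].
have kr : 0 < k * r < r0.
  by rewrite mulr_gt0//= (le_lt_trans _ r2)// ler_piMl ?ltW.
have gk := g_gt0 (andP kr).1.
have := le_trans (leb_int_expRePsi_ge_ball symA levyN d0 (ltW _) r1) (h _ kr).
rewrite invr_gt0 gk => /(_ isT); rewrite lee_fin => h1.
rewrite leNgt; apply/negP => hlt.
have h2 : v * expR (- 4) < v * expR (- ((g (k * r))^-1 * (2 * hfun A N r^-1))).
  rewrite ltr_pM2l// ltr_expR ltrN2 mulrC ltr_pdivrMr//; move: hlt; rewrite /g; lra.
have h3 : v * expR (- ((g (k * r))^-1 * (2 * hfun A N r^-1))) <= c * k ^+ d.
  rewrite -(@ler_pM2r _ (r ^+ d)) ?exprn_gt0//; move: h1.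
  by rewrite /v !exprMn; congr (_ <= _); ring.
have h4 : c * k ^+ d <= v * expR (- 4) / 2.
  apply: (@le_trans _ _ (c * k)).
    rewrite ler_pM2l// -(prednK d0) exprS ler_piMr ?(ltW k0)//.
    by rewrite exprn_ile1 ?ltW.
  rewrite mulrC -ler_pdivlMr// ge_min; apply/orP; right.
    by rewrite le_eqVlt; apply/orP; left; apply/eqP; field; rewrite gt_eqF.
have h5 : 0 < v * expR (- 4) by rewrite mulr_gt0 ?expR_gt0.
lra.
Qed.

(** At time 1 / g(r), r = |x|, if K^2 Re Psi(x) <= g(r) then each of the K cubes contributes at
    least v r^d exp(-6), with 6 = 2 + 4 from the quasi-subadditivity of Re Psi. A K with K v exp(-6)
    > c contradicts the upper bound c r^d. *)
Lemma D2_lower : D2 -> exists r0 c, [/\ 0 < r0, 0 < c &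
  forall x, 0 < vnorm x < r0 -> c * g (vnorm x) <= RePsi A N x].
Proof.
move=> /D2_small_radius[r0 [c [r00 c0 h]]].
pose v : R := d%:R^-1 ^+ d.
have v0 : 0 < v by rewrite exprn_gt0// invr_gt0.
have e0 : 0 < v * expR (- 6) by rewrite mulr_gt0 ?expR_gt0.
pose K := (Num.truncn (c / (v * expR (- 6)))).+1.
have /andP[_ hK] : (Num.truncn (c / (v * expR (- 6))))%:R <= c / (v * expR (- 6)) < K%:R.
  by apply: truncn_itv; rewrite divr_ge0// ltW.
rewrite ltr_pdivrMr// in hK.
have K0 : 0 < K%:R :> R by rewrite ltr0n.
exists r0, (K%:R ^- 2); split=> //; first by rewrite invr_gt0 exprn_gt0.
move=> x /andP[r1 r2]; set r := vnorm x in r1 r2 *.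
have gr := g_gt0 r1.
rewrite leNgt; apply/negP => hlt.
have hM y : vnorm y <= r -> RePsi A N y <= 2 * g r by exact: RePsi_le_hfun.
have ti : 0 <= (g r)^-1 by rewrite invr_ge0 ltW.
have := le_trans (leb_int_expRePsi_ge_multi symA levyN K ti r1 (lexx _) hM) (h r _).
rewrite r1 r2 => /(_ isT); rewrite lee_fin => h1.
have h2 : K%:R * v * expR (- ((g r)^-1 * (2 * (K%:R ^+ 2 * RePsi A N x) + 2 * (2 * g r)))) <= c.
  rewrite -(@ler_pM2r _ (r ^+ d)) ?exprn_gt0//; move: h1.
  rewrite /v exprMn; congr (_ <= _); ring.
have h3 : expR (- 6) <= expR (- ((g r)^-1 * (2 * (K%:R ^+ 2 * RePsi A N x) + 2 * (2 * g r)))).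
  rewrite ler_expR lerN2 mulrC ler_pdivrMr//.
  have : K%:R ^+ 2 * RePsi A N x <= g r.
    by rewrite mulrC -ler_pdivlMr ?exprn_gt0// mulrC ltW.
  lra.
have h4 : K%:R * v * expR (- 6) <= c.
  by apply: le_trans h2; rewrite ler_wpM2l// mulr_ge0// ltW.
by move: hK; rewrite mulrA ltNge h4.
Qed.

(** Extracting the m-th root produces the real exponent 1 / m of (D3). The root of C is replaced by
    max(1, C), which is at least as large. *)
Lemma root_bound (m : nat) (C l a b : R) : (0 < m)%N -> 0 < C -> 0 < l -> 0 <= a -> 0 <= b ->
  a ^+ m <= C * l * b ^+ m -> a <= Num.max 1 C * l `^ m%:R^-1 * b.
Proof.
move=> m0 C0 l0 a0 b0 h.
have C1 : 1 <= Num.max 1 C by rewrite le_max lexx.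
have Cm : C <= Num.max 1 C ^+ m.
  apply: (@le_trans _ _ (Num.max 1 C)); first by rewrite le_max lexx orbT.
  by rewrite -(prednK m0) exprS ler_peMr ?exprn_ege1// (le_trans ler01).
have lm : (l `^ m%:R^-1) ^+ m = l.
  rewrite -powR_mulrn ?powR_ge0// -powRrM mulVf ?powRr1 ?ltW//.
  by rewrite pnatr_eq0 -lt0n.
rewrite -(@ler_pXn2r _ m)//; last first.
- by rewrite nnegrE !mulr_ge0 ?powR_ge0// (le_trans ler01).
apply: le_trans h _; rewrite !exprMn lm.
by rewrite !ler_wpM2r ?exprn_ge0// ltW.
Qed.

Let CP : R := 2 + d%:R * 66.
Let CP1 : 1 <= CP. Proof. by rewrite /CP; have := d0R; lra. Qed.
Let gP r : 0 < r -> g r <= CP * PsiStar A N r.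
Proof. exact: hfun_le_PsiStar. Qed.
Let Pg r : 0 < r -> PsiStar A N r <= 2 * g r.
Proof. exact: PsiStar_le_hfun. Qed.

Definition D3_local := exists T3 c3 alpha3 : R, [/\ 0 < T3, 0 < c3 <= 1, 0 < alpha3 <= 2,
      (forall x : d.-tuple R, vnorm x < T3^-1 ->
         c3 * PsiStar A N (vnorm x) <= RePsi A N x) &
      (forall lambda r : R, 0 < lambda <= 1 -> 0 < r < T3^-1 ->
         PsiStar A N (lambda * r) <= c3^-1 * lambda `^ alpha3 * PsiStar A N r)].

Definition Psi_L1 := exists t0 : R, 0 < t0 /\ (PsiIntegral t0 < +oo)%E.

Lemma PsiStar0 : PsiStar A N 0 = 0.
Proof.
apply/le_anti; rewrite PsiStar_ge0// andbT; apply: PsiStar_le => // z.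
by rewrite le_eqVlt ltNge vnorm_ge0 orbF => /eqP/vnorm_eq0 ->; rewrite RePsi_vzero.
Qed.

Lemma D2_D3 : D2 -> D3_local /\ Psi_L1.
Proof.
move=> h2; split; last first.
  have [T2 [c2 [T20 [c20 h]]]] := h2.
  exists (T2 + 1); split; first by rewrite addr_gt0.
  by apply: le_lt_trans (h _ _) (ltry _); rewrite ltrDl.
have [r1 [k [r10 k01 hk]]] := D2_scaling h2.
have [r2 [c [r20 c0 hc]]] := D2_lower h2.
have g0 r : 0 < r -> 0 <= g r by move=> r0; exact/ltW/g_gt0.
have q01 : 0 <= (2^-1 : R) < 1 by rewrite invr_ge0 ler0n invf_lt1// ltr1n.
have [m [C C0 [m0 hm]]] := geometric_scaling g0 g_mono k01 q01 hk.
pose r0 := Num.min r1 r2.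
pose B := 2 * Num.max 1 C * CP.
have B0 : 0 < B by rewrite !mulr_gt0 ?lt_max ?ltr01// (lt_le_trans ltr01).
(* c / 2 pays for [PsiStar] <= 2 g in the lower bound, and 1 / B for passing from [PsiStar] to g and
   back in the scaling. *)
exists r0^-1, (Num.min 1 (Num.min (c / 2) B^-1)), m%:R^-1.
have r00 : 0 < r0 by rewrite lt_min r10.
have cm : 0 < Num.min 1 (Num.min (c / 2) B^-1).
  by rewrite !lt_min ltr01 divr_gt0//= invr_gt0.
have mR : 1 <= m%:R :> R by rewrite ler1n.
split.
- by rewrite invr_gt0.
- by rewrite cm ge_min lexx.
- by rewrite invr_gt0 (lt_le_trans ltr01)//= (@le_trans _ _ 1) ?ler1n// invf_le1// (lt_le_trans ltr01).
- move=> x; rewrite invrK => xr.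
  (* [D2_lower] concerns nonzero vectors; at the origin both sides vanish. *)
  have := vnorm_ge0 x; rewrite le_eqVlt => /predU1P[<-|x0].
    by rewrite PsiStar0 mulr0 RePsi_ge0.
  apply: (@le_trans _ _ (c * g (vnorm x))); last first.
    by apply: hc; rewrite x0 (lt_le_trans xr)// ge_min lexx orbT.
  apply: (@le_trans _ _ (c / 2 * PsiStar A N (vnorm x))).
    by rewrite ler_wpM2r ?PsiStar_ge0 ?vnorm_ge0// !ge_min lexx !orbT.
  by rewrite -mulrA ler_pM2l// mulrC ler_pdivrMr// mulrC Pg.
- move=> l r /andP[l0 l1]; rewrite invrK => /andP[rr0 rr1].
  have hr : 0 < r < r1 by rewrite rr0 (lt_le_trans rr1)// ge_min lexx.
  have lr : 0 < l * r by rewrite mulr_gt0.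
  have hl : 0 < l <= 1 by rewrite l0.
  have := root_bound m0 C0 l0 (ltW (g_gt0 lr)) (ltW (g_gt0 rr0)) (hm _ _ hl hr).
  move=> h; apply: le_trans (Pg lr) _.
  apply: (@le_trans _ _ (B * l `^ m%:R^-1 * PsiStar A N r)).
    apply: (@le_trans _ _ (2 * (Num.max 1 C * l `^ m%:R^-1 * (CP * PsiStar A N r)))).
      rewrite ler_pM2l// (le_trans h)// ler_wpM2l ?gP// mulr_ge0 ?powR_ge0//.
      by rewrite le_max ler01.
    by rewrite le_eqVlt; apply/orP; left; apply/eqP; rewrite /B; ring.
  rewrite ler_wpM2r ?PsiStar_ge0 ?(ltW rr0)// ler_wpM2r ?powR_ge0//.
  rewrite -[leLHS]invrK lef_pV2 ?posrE ?invr_gt0//.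
  by rewrite !ge_min lexx !orbT.
Qed.


(** * From scaling to the truncated second moment *)

(** The truncation is a factor of the integrand instead of a domain of integration, so that the
    integrands of U, H and Re Psi can be compared pointwise on the whole space. *)
Definition sqr_trunc (s : R) : R := (`|s| < 1)%R%:R * s ^+ 2.

Lemma sqr_trunc_ge0 s : 0 <= sqr_trunc s.
Proof. by rewrite mulr_ge0 ?sqr_ge0. Qed.

Lemma sqr_trunc_le_min s : sqr_trunc s <= Num.min 1 (s ^+ 2).
Proof.
rewrite /sqr_trunc; case: ltP => s1; last by rewrite mul0r le_min ler01 sqr_ge0.
by rewrite mul1r le_min lexx andbT -real_normK ?num_real// exprn_ile1// ltW.
Qed.

Lemma sqr_trunc_le_oneBcos s : sqr_trunc s <= 8 * (1 - cos s).
Proof.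
rewrite /sqr_trunc; case: ltP => s1; last by rewrite mul0r mulr_ge0 ?oneBcos_ge0.
by rewrite mul1r mulrC -ler_pdivrMr//; apply: oneBcos_ge; exact: ltW.
Qed.

(** Where |s| < 1 this is the identity 1/4 = 1 - 3/4; elsewhere the truncated square vanishes.
    Integrated, it bounds the drop of H under halving by U. *)
Lemma min_sqr_half s : Num.min 1 ((2^-1 * s) ^+ 2) <= Num.min 1 (s ^+ 2) - 3 / 4 * sqr_trunc s.
Proof.
have h : (2^-1 * s) ^+ 2 <= s ^+ 2.
  by rewrite exprMn ler_piMl ?sqr_ge0// exprn_ile1 ?invr_ge0// invf_le1// ler1n.
rewrite /sqr_trunc; case: ltP => s1; last first.
  rewrite mul0r mulr0 subr0 le_min ge_min lexx/= ge_min; apply/orP; right.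
  exact: h.
have s2 : s ^+ 2 <= 1 by rewrite -real_normK ?num_real// exprn_ile1// ltW.
rewrite mul1r (min_idPr s2) ge_min; apply/orP; right.
rewrite exprMn (_ : 2^-1 ^+ 2 = 4^-1); last by field.
by rewrite le_eqVlt; apply/orP; left; apply/eqP; field.
Qed.

(** The cutoff is at |l s| = 1: below it use 1 - cos s <= 2 s^2, above it 1 - cos s <= 2, where the
    minimum equals 1. The parameter l remains free so that the second term can be made small by
    scaling. *)
Lemma oneBcos_le_trunc l s : 0 < l ->
  1 - cos s <= 2 * l ^- 2 * sqr_trunc (l * s) + 2 * Num.min 1 ((l * s) ^+ 2).
Proof.
move=> l0; have h := oneBcos_le_min s.
rewrite /sqr_trunc; case: ltP => s1.
  apply: (@le_trans _ _ (2 * s ^+ 2)).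
    by rewrite (le_trans h)// ler_pM2l// ge_min lexx orbT.
  rewrite mul1r exprMn (_ : 2 * l ^- 2 * (l ^+ 2 * s ^+ 2) = 2 * s ^+ 2); last first.
    by field; rewrite gt_eqF.
  by rewrite lerDl mulr_ge0// le_min ler01 mulr_ge0 ?sqr_ge0.
rewrite mul0r mulr0 add0r (min_idPl _); last by rewrite -real_normK ?num_real// exprn_ege1.
by rewrite (le_trans h)// ler_pM2l// ge_min lexx.
Qed.

Lemma integrable_sqr_trunc x : N.-integrable setT (EFin \o (fun z => sqr_trunc (ip x z))).
Proof.
apply: (le_integrable _ _ _ (integrable_min_ip levyN x)) => //.
- apply/measurable_EFinP; apply: measurable_funM; last by apply: measurable_funX; exact: measurable_ip.
  apply: (@measurableT_comp _ _ _ _ _ _ (fun b : bool => b%:R : R)) => //.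
  apply: measurable_fun_ltr => //; apply: measurableT_comp => //; exact: measurable_ip.
- move=> z _ /=; rewrite lee_fin !ger0_norm ?sqr_trunc_ge0 ?sqr_trunc_le_min//.
  by rewrite le_min ler01 sqr_ge0.
Qed.

Definition Ufun x : R := quadA A x + \int[N]_z sqr_trunc (ip x z).

Lemma UfunE x : ((quadA A x)%:E +
  \int[N]_(z in [set z | (`|ip x z| < 1)%R]) ((ip x z) ^+ 2)%:E)%E = (Ufun x)%:E.
Proof.
rewrite EFinD; congr (_ + _)%E; rewrite /Rintegral fineK; last first.
  exact: (integrable_fin_num _ (integrable_sqr_trunc x)).
rewrite [LHS]integral_mkcond; apply: eq_integral => z _.
rewrite patchE /sqr_trunc; case: ifPn => [|]; rewrite ?in_setE/=.
  by move=> ->; rewrite mul1r.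
by move=> /negP; rewrite in_setE/= => /negP/negbTE ->; rewrite mul0r.
Qed.

Lemma Rintegral_le_lin (f u v : d.-tuple R -> R) (a b : R) :
  N.-integrable setT (EFin \o f) -> N.-integrable setT (EFin \o u) ->
  N.-integrable setT (EFin \o v) -> (forall z, f z <= a * u z + b * v z) ->
  \int[N]_z f z <= a * (\int[N]_z u z) + b * (\int[N]_z v z).
Proof.
move=> jf ju jv h.
have jau : N.-integrable setT (EFin \o (fun z => a * u z)) by exact: (integrableZl _ _ ju).
have jbv : N.-integrable setT (EFin \o (fun z => b * v z)) by exact: (integrableZl _ _ jv).
rewrite -!RintegralZl// -RintegralD//; apply: le_Rintegral => //.
exact: (integrableD _ jau jbv).
Qed.

Lemma Ufun_ge0 x : 0 <= Ufun x.
Proof.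
by rewrite addr_ge0 ?symA.2//; apply: Rintegral_ge0 => z _; exact: sqr_trunc_ge0.
Qed.

Lemma Ufun_le_Hfun x : Ufun x <= Hfun A N x.
Proof.
rewrite lerD2l; apply: le_Rintegral => //; [exact: integrable_sqr_trunc|exact: integrable_min_ip|].
by move=> z _; exact: sqr_trunc_le_min.
Qed.

Lemma Ufun_le_RePsi x : Ufun x <= 8 * RePsi A N x.
Proof.
have := @Rintegral_le_lin _ _ _ 8 0 (integrable_sqr_trunc x) (integrable_oneBcos levyN x) (integrable_oneBcos levyN x).
rewrite mul0r addr0 => h; rewrite RePsiE /Ufun mulrDr lerD//.
  by have := symA.2 x; lra.
by apply: h => z; rewrite mul0r addr0; exact: sqr_trunc_le_oneBcos.
Qed.

Lemma Hfun_half x : Hfun A N (vscale 2^-1 x) <= Hfun A N x - 3 / 4 * Ufun x.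
Proof.
have := @Rintegral_le_lin _ _ _ 1 (- (3 / 4)) (integrable_min_ip levyN (vscale 2^-1 x))
  (integrable_min_ip levyN x) (integrable_sqr_trunc x).
rewrite /Hfun /Ufun quadA_vscale => h.
have : \int[N]_z Num.min 1 (ip (vscale 2^-1 x) z ^+ 2) <=
   1 * (\int[N]_x0 Num.min 1 (ip x x0 ^+ 2)) + - (3 / 4) * (\int[N]_x0 sqr_trunc (ip x x0)).
  by apply: h => z; rewrite ip_vscalel mul1r mulNr; exact: min_sqr_half.
rewrite (_ : 2^-1 ^+ 2 = 4^-1); last by field.
lra.
Qed.

Lemma RePsi_le_trunc l x : 0 < l ->
  RePsi A N x <= 2 * l ^- 2 * Ufun (vscale l x) + 2 * Hfun A N (vscale l x).
Proof.
move=> l0.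
have := @Rintegral_le_lin _ _ _ (2 * l ^- 2) 2 (integrable_oneBcos levyN x)
  (integrable_sqr_trunc (vscale l x)) (integrable_min_ip levyN (vscale l x)).
rewrite RePsiE /Ufun /Hfun quadA_vscale => h.
have := h _; rewrite {h} => h.
have {}h : \int[N]_z (1 - cos (ip x z)) <=
  2 * l ^- 2 * (\int[N]_z sqr_trunc (ip (vscale l x) z)) +
  2 * (\int[N]_z Num.min 1 (ip (vscale l x) z ^+ 2)).
  by apply: h => z; rewrite ip_vscalel; exact: oneBcos_le_trunc.
have hA : quadA A x / 2 <= 2 * l ^- 2 * (l ^+ 2 * quadA A x) + 2 * (l ^+ 2 * quadA A x).
  rewrite (_ : 2 * l ^- 2 * (l ^+ 2 * quadA A x) = 2 * quadA A x); last first.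
    by field; rewrite gt_eqF.
  have q0 := symA.2 x; have : 0 <= l ^+ 2 * quadA A x by rewrite mulr_ge0 ?sqr_ge0.
  lra.
lra.
Qed.

Definition D4_local := exists T4 c4 : R, [/\ 0 < T4, 1 <= c4 &
  forall x : d.-tuple R, vnorm x < T4^-1 -> PsiStar A N (vnorm x) <= c4 * Ufun x].

Lemma D3_D4 : D3_local -> D4_local.
Proof.
move=> [T3 [c [al [T30 /andP[c0 c1] /andP[al0 _] h1 h2]]]].
have ic0 : 0 < c^-1 by rewrite invr_gt0.
(* 264 = 4 * 66, so that 2 H(y) <= 2 * 66 (mu / c) [PsiStar](|x|) is at most half of the lower bound
   c [PsiStar](|x|) of (D3); l below solves l^al = mu. *)
pose mu := Num.min 1 (c ^+ 2 / 264).
have mu0 : 0 < mu by rewrite lt_min ltr01 divr_gt0// exprn_gt0.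
pose l := mu `^ al^-1.
have l0 : 0 < l by rewrite powR_gt0.
have l1 : l <= 1.
  have <- : 1 `^ al^-1 = 1 :> R by rewrite powR1.
  rewrite /l ge0_ler_powR ?nnegrE ?invr_ge0 ?(ltW al0) ?(ltW mu0)//.
  by rewrite ge_min lexx.
have lal : l `^ al = mu by rewrite /l -powRrM mulVf ?gt_eqF// powRr1// ltW.
have l2 : 0 < l ^- 2 by rewrite invr_gt0 exprn_gt0.
pose c4 := Num.max 1 (4 * l ^- 2 / c).
exists (T3 / l), c4; split.
- by rewrite divr_gt0.
- by rewrite le_max lexx.
move=> y; rewrite invf_div => yT.
(* (D4) is proved at y, while (D3) is used at the longer vector x = y / l: the cutoff at 1 / l for x
   is the cutoff at 1 for y, and the range |x| < 1 / T3 becomes |y| < l / T3. *)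
pose x := vscale l^-1 y.
have yx : y = vscale l x.
  by apply: eq_from_tnth => i; rewrite !tnth_mktuple mulrA divff ?mul1r// gt_eqF.
have xy : vnorm y = l * vnorm x by rewrite yx vnorm_vscale gtr0_norm.
have xT : vnorm x < T3^-1.
  by rewrite -(@ltr_pM2l _ l)// -xy.
have P0 := PsiStar_ge0 symA levyN (vnorm_ge0 x).
have Pl : PsiStar A N (l * vnorm x) <= c^-1 * mu * PsiStar A N (vnorm x).
  have := vnorm_ge0 x; rewrite le_eqVlt => /predU1P[<-|x0].
    by rewrite mulr0 PsiStar0 mulr0.
  by rewrite -lal; apply: h2; rewrite ?l0 ?x0.
have hH : 2 * Hfun A N y <= c / 2 * PsiStar A N (vnorm x).
  have := Hfun_le_PsiStar symA levyN y; rewrite xy => hy.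
  have : c^-1 * mu <= c / 264.
    rewrite mulrC ler_pdivrMr// mulrAC -expr2 ge_min; apply/orP; right.
    exact: lexx.
  move=> hc; have : c^-1 * mu * PsiStar A N (vnorm x) <= c / 264 * PsiStar A N (vnorm x).
    by rewrite ler_wpM2r.
  lra.
have := RePsi_le_trunc x l0; rewrite -yx => hR.
have := h1 _ xT => hx.
have h3 : c * PsiStar A N (vnorm x) <= 4 * l ^- 2 * Ufun y by lra.
apply: (@le_trans _ _ (PsiStar A N (vnorm x))).
  by apply: le_PsiStar; rewrite ?vnorm_ge0// xy ler_piMl ?vnorm_ge0.
apply: (@le_trans _ _ (4 * l ^- 2 / c * Ufun y)).
  by rewrite mulrAC ler_pdivlMr// mulrC.
by rewrite ler_wpM2r ?Ufun_ge0// le_max lexx orbT.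
Qed.


(** * From the truncated second moment to the integral bound *)

(** The cubes have a fixed size r whatever the length of x. If K^2 Re Psi(x) < 1, each of the K
    translates contributes at least v, and K v exceeds the finite integral I. Hence the bound 1 /
    K^2, uniform in x. *)
Lemma RePsi_bounded_below : Psi_L1 -> forall r, 0 < r ->
  exists2 m, 0 < m & forall x, r <= vnorm x -> m <= RePsi A N x.
Proof.
move=> [t [t0 hI]] r r0.
have Ifin : PsiIntegral t = (fine (PsiIntegral t))%:E.
  rewrite fineK// ge0_fin_numE// /PsiIntegral leb_intE.
  - by apply: integral_ge0 => z _; rewrite lee_fin expR_ge0.
  - by apply/measurable_EFinP; exact: measurable_expRePsi.
  - by move=> z; rewrite lee_fin expR_ge0.
set I := fine (PsiIntegral t) in Ifin.
pose v := (r / d%:R) ^+ d * expR (- (t * (2 + 2 * (2 * g r)))).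
have v0 : 0 < v by rewrite mulr_gt0 ?expR_gt0// exprn_gt0// divr_gt0.
pose K := (Num.truncn `|I / v|).+1.
have /andP[_ hK] : (Num.truncn `|I / v|)%:R <= `|I / v| < K%:R by exact: truncn_itv.
have {}hK : I < K%:R * v by rewrite -ltr_pdivrMr// (le_lt_trans (ler_norm _)).
have K0 : 0 < K%:R :> R by rewrite ltr0n.
exists (K%:R ^- 2) => [|x rx]; first by rewrite invr_gt0 exprn_gt0.
rewrite leNgt; apply/negP => hlt.
have hM y : vnorm y <= r -> RePsi A N y <= 2 * g r by exact: RePsi_le_hfun.
have := leb_int_expRePsi_ge_multi symA levyN K (ltW t0) r0 rx hM.
rewrite -/(PsiIntegral t) Ifin lee_fin => h1.
have h3 : v <= (r / d%:R) ^+ d * expR (- (t * (2 * (K%:R ^+ 2 * RePsi A N x) + 2 * (2 * g r)))).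
  rewrite ler_wpM2l ?exprn_ge0 ?divr_ge0 ?(ltW r0)// ler_expR lerN2 ler_pM2l// lerD2r.
  rewrite -[leRHS]mulr1 ler_pM2l// mulrC -ler_pdivlMr ?exprn_gt0// mul1r; exact: ltW.
have : K%:R * v <= I.
  by apply: le_trans h1; rewrite -mulrA ler_pM2l.
by rewrite leNgt hK.
Qed.

Lemma D4_lower T4 c4 : 1 <= c4 ->
  (forall x, vnorm x < T4^-1 -> PsiStar A N (vnorm x) <= c4 * Ufun x) ->
  forall x, vnorm x < T4^-1 -> PsiStar A N (vnorm x) <= 8 * c4 * RePsi A N x.
Proof.
move=> c41 h x xT; apply: le_trans (h _ xT) _.
rewrite mulrAC mulrC ler_wpM2r ?(le_trans ler01)//; exact: Ufun_le_RePsi.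
Qed.

(** The contraction under halving is available for H along a ray, not directly for [PsiStar]. After
    enough halvings it outweighs the loss in [PsiStar] <= c4 U <= c4 H and H <= 66 [PsiStar], and
    [geometric_scaling] applies. *)
Lemma D4_scaling T4 c4 : 0 < T4 -> 1 <= c4 ->
  (forall x, vnorm x < T4^-1 -> PsiStar A N (vnorm x) <= c4 * Ufun x) ->
  exists m, exists2 C, 0 < C & (0 < m)%N /\ forall l r, 0 < l <= 1 -> 0 < r < T4^-1 ->
    PsiStar A N (l * r) ^+ m <= C * l * PsiStar A N r ^+ m.
Proof.
move=> T40 c41 h; have c40 : 0 < c4 := lt_le_trans ltr01 c41.
(* H <= 66 c4 U turns the drop (3/4) U into H / (88 c4). *)
pose q := 1 - (88 * c4)^-1.
have hq : 0 < (88 * c4)^-1 by rewrite invr_gt0 mulr_gt0.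
have hq1 : (88 * c4)^-1 <= 1 by rewrite invf_le1 ?mulr_gt0//; lra.
have q01 : 0 <= q < 1 by rewrite /q subr_ge0 hq1 gtrBl hq.
have /andP[q0 q1] := q01.
have Hq y : vnorm y < T4^-1 -> Hfun A N (vscale 2^-1 y) <= q * Hfun A N y.
  move=> yT; have h1 := Hfun_half y; have h2 := h _ yT.
  have h3 := Hfun_le_PsiStar symA levyN y.
  have : (88 * c4)^-1 * Hfun A N y <= 3 / 4 * Ufun y.
    by rewrite mulrC ler_pdivrMr ?mulr_gt0//; nra.
  rewrite /q; lra.
have Hqn j y : vnorm y < T4^-1 -> Hfun A N (vscale (2^-1 ^+ j) y) <= q ^+ j * Hfun A N y.
  move=> yT; elim: j => [|j IH].
    rewrite expr0 mul1r (_ : vscale 1 y = y)//.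
    by apply: eq_from_tnth => i; rewrite tnth_mktuple mul1r.
  have -> : vscale (2^-1 ^+ j.+1) y = vscale 2^-1 (vscale (2^-1 ^+ j) y).
    by apply: eq_from_tnth => i; rewrite !tnth_mktuple exprS mulrA.
  apply: le_trans (Hq _ _) _; last by rewrite exprS -mulrA ler_wpM2l.
  rewrite vnorm_vscale ger0_norm ?exprn_ge0 ?invr_ge0// (le_lt_trans _ yT)//.
  by rewrite ler_piMl ?vnorm_ge0// exprn_ile1 ?invr_ge0// invf_le1// ler1n.
(* The number of halvings is fixed by 66 c4 q^(n+1) <= 1/2. *)
have e0 : 0 < (2 * (66 * c4))^-1 by rewrite invr_gt0 !mulr_gt0.
have [n hn] := exists_expr_le q01 e0.
have hn1 : 66 * c4 * q ^+ n.+1 <= 2^-1.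
  rewrite mulrC -ler_pdivlMr ?mulr_gt0// -invfM exprS (le_trans _ hn)//.
  by rewrite ler_piMl ?exprn_ge0// ltW.
pose k : R := 2^-1 ^+ n.+1.
have k0 : 0 < k by rewrite exprn_gt0// invr_gt0.
have k1 : k < 1 by rewrite exprn_ilt1 ?invr_ge0// invf_lt1// ltr1n.
apply: (@geometric_scaling R (PsiStar A N) T4^-1 k 2^-1).
- by move=> r r0; rewrite PsiStar_ge0// ltW.
- by move=> r s r0; apply: le_PsiStar => //; exact: ltW.
- by rewrite k0.
- by rewrite invr_ge0 ler0n invf_lt1// ltr1n.
move=> r /andP[r0 rT].
(* [PsiStar] depends on the radius alone, so the contraction along a single coordinate ray is
   sufficient. *)
pose y := vscale r (vunit R (Ordinal d0)).
have yr : vnorm y = r by rewrite vnorm_vscale vnorm_vunit mulr1 gtr0_norm.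
have yT : vnorm y < T4^-1 by rewrite yr.
have kyr : vnorm (vscale k y) = k * r by rewrite vnorm_vscale yr gtr0_norm.
have := h (vscale k y); rewrite kyr => /(_ _)h1.
apply: le_trans (h1 _) _.
  by rewrite (le_lt_trans _ rT)// ler_piMl ?(ltW r0)// ltW.
have h2 : Ufun (vscale k y) <= q ^+ n.+1 * (66 * PsiStar A N r).
  apply: le_trans (Ufun_le_Hfun _) _; apply: le_trans (Hqn _ _ yT) _.
  rewrite ler_wpM2l ?exprn_ge0// -yr; exact: Hfun_le_PsiStar.
apply: (@le_trans _ _ (c4 * (q ^+ n.+1 * (66 * PsiStar A N r)))).
  by rewrite ler_pM2l.
have -> : c4 * (q ^+ n.+1 * (66 * PsiStar A N r)) = 66 * c4 * q ^+ n.+1 * PsiStar A N r by ring.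
by rewrite ler_wpM2r// PsiStar_ge0// ltW.
Qed.

(** Each factor 2 r^2 / (r^2 + z_i^2) is at least r^2 / b^2. A product of Cauchy densities thus
    serves as the integrable majorant of (r / |z|)^(2d), with an explicit integral and without polar
    coordinates. *)
Lemma cauchy_prod_ge (r b : R) z : 0 < r -> r <= b -> vnorm z <= b ->
  (r / b) ^+ (2 * d) <= 2 ^+ d * (r ^+ d * \prod_i (r / (r ^+ 2 + (tnth z i - 0) ^+ 2))).
Proof.
move=> r0 rb zb; have b0 : 0 < b := lt_le_trans r0 rb.
rewrite exprM.
have -> : 2 ^+ d * (r ^+ d * \prod_i (r / (r ^+ 2 + (tnth z i - 0) ^+ 2)))
  = \prod_(i < d) (2 * r * (r / (r ^+ 2 + (tnth z i - 0) ^+ 2))).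
  by rewrite [RHS]big_split/= prodr_const card_ord exprMn mulrA.
rewrite -[X in _ ^+ X](card_ord d) -prodr_const; apply: ler_prod => i _.
rewrite sqr_ge0/= subr0 exprMn exprVn.
have zi : tnth z i ^+ 2 <= b ^+ 2.
  rewrite -real_normK ?num_real// lerXn2r ?nnegrE ?(ltW b0)//.
  by rewrite (le_trans (tnth_le_vnorm _ _)).
have rb2 : r ^+ 2 <= b ^+ 2 by rewrite lerXn2r ?nnegrE ?(ltW b0) ?(ltW r0).
have p0 : 0 < r ^+ 2 + tnth z i ^+ 2 by exact: cauchy_den_gt0.
rewrite (_ : 2 * r * (r / (r ^+ 2 + tnth z i ^+ 2)) = r ^+ 2 * (2 / (r ^+ 2 + tnth z i ^+ 2))); last first.
  by field; rewrite gt_eqF.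
rewrite ler_wpM2l ?sqr_ge0// -[leLHS]mul1r ler_pdivrMr ?exprn_gt0// mulrAC ler_pdivlMr// mul1r.
lra.
Qed.

Lemma D4_D2 : D4_local -> Psi_L1 -> D2.
Proof.
move=> [T4 [c4 [T40 c41 h]]] hL1.
have c40 : 0 < c4 := lt_le_trans ltr01 c41.
have hlow := D4_lower c41 h.
have [m [C C0 [m0 hsc]]] := D4_scaling T40 c41 h.
have iT0 : 0 < T4^-1 by rewrite invr_gt0.
have [mu mu0 hmu] := RePsi_bounded_below hL1 iT0.
have [t0 [t00 hI]] := hL1.
set r1 := T4^-1 in h hlow hsc iT0 hmu *.
have Ifin : PsiIntegral t0 = (fine (PsiIntegral t0))%:E.
  rewrite fineK// ge0_fin_numE// /PsiIntegral leb_intE.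
  - by apply: integral_ge0 => z _; rewrite lee_fin expR_ge0.
  - by apply/measurable_EFinP; exact: measurable_expRePsi.
  - by move=> z; rewrite lee_fin expR_ge0.
set I := fine (PsiIntegral t0) in Ifin.
have I0 : 0 <= I.
  rewrite fine_ge0// /PsiIntegral leb_intE.
  - by apply: integral_ge0 => z _; rewrite lee_fin expR_ge0.
  - by apply/measurable_EFinP; exact: measurable_expRePsi.
  - by move=> z; rewrite lee_fin expR_ge0.
pose r2 := r1 / 2.
have r20 : 0 < r2 by rewrite divr_gt0.
have r21 : r2 < r1 by rewrite ltr_pdivrMr// ltr_pMr// ltr1n.
have CP0 : 0 < CP := lt_le_trans ltr01 CP1.
(* Lower bound for (t Re Psi(z))^m (r / |z|): the factor 4 CP comes from 1 / t <= 4 CP [PsiStar](r),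
   the factor 8 c4 from [D4_lower], and C from the scaling. *)
pose a := (32 * c4 * CP)^-1 ^+ m / C.
have a0 : 0 < a by rewrite divr_gt0// exprn_gt0// invr_gt0 !mulr_gt0.
(* With this power, exp(-y) <= (n1 / y)^n1 produces exactly the decay (r / |z|)^(2d) of the Cauchy
   majorant. *)
pose n1 := (m * (2 * d))%N.
pose C1 := 2 ^+ d * (1 + n1%:R ^+ n1 / a ^+ (2 * d)).
have C10 : 0 <= C1 by rewrite mulr_ge0 ?exprn_ge0// addr_ge0// divr_ge0 ?exprn_ge0// ltW.
(* Scaling gives t^(-m) <= b r, so the power m d of 1 / t yields the required factor r^d. *)
pose n2 := (m * d)%N.
pose b := C / r2 * PsiStar A N r2 ^+ m * (4 * CP) ^+ m.
pose C3 := expR (t0 * mu) * I * ((n2%:R / mu) ^+ n2 * b ^+ d).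
have b0 : 0 <= b.
  rewrite mulr_ge0 ?exprn_ge0 ?mulr_ge0 ?(ltW CP0)// ?divr_ge0 ?invr_ge0 ?(ltW C0) ?(ltW r20)//.
  by rewrite exprn_ge0// PsiStar_ge0// ltW.
have C30 : 0 <= C3.
  by rewrite !mulr_ge0 ?expR_ge0// exprn_ge0// divr_ge0// ltW.
(* t > t0 lets the part of the exponent beyond t0 decay, and t > 1 / g(r2) forces r <= r2 < 1 / T4,
   inside the range of the scaling. The final 1 makes the constant positive. *)
exists (t0 + (g r2)^-1), (C1 * pi ^+ d + C3 + 1).
have gr2 := g_gt0 r20.
split; first by rewrite addr_gt0 ?invr_gt0.
split; first by rewrite ltr_wpDl// addr_ge0// mulr_ge0// exprn_ge0// pi_ge0.
move=> t tT.
have tt0 : t0 < t by rewrite (lt_trans _ tT)// ltrDl invr_gt0.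
have tg : (g r2)^-1 < t by rewrite (lt_trans _ tT)// ltrDr.
have t_gt0 : 0 < t := lt_trans t00 tt0.
have ti0 : 0 < t^-1 by rewrite invr_gt0.
set rho := hinv A N t^-1.
have rho0 : 0 < rho by exact: hinv_gt0.
pose r := rho^-1.
have r_gt0 : 0 < r by rewrite invr_gt0.
have rr2 : r <= r2.
  rewrite -[leRHS]invrK lef_pV2 ?posrE ?invr_gt0//.
  apply: le_hinv => //; first by rewrite invr_gt0.
  by rewrite -[leRHS]invrK lef_pV2 ?posrE ?invr_gt0// ltW.
have Pt : t^-1 <= 4 * CP * PsiStar A N r.
  have := hfun_hinv_ge symA levyN hoo ti0; rewrite -/rho => h1.
  have := gP r_gt0; rewrite /g /r invrK => h2; lra.
have Pr : (4 * CP)^-1 <= t * PsiStar A N r.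
  have h4 : 1 <= t * (4 * CP * PsiStar A N r) by rewrite mulrC -ler_pdivrMr// div1r.
  by rewrite -div1r ler_pdivrMr ?mulr_gt0//; lra.
have P0 : 0 <= PsiStar A N r by rewrite PsiStar_ge0// ltW.
have prod_ge0 (z : d.-tuple R) : 0 <= \prod_i (r / (r ^+ 2 + (tnth z i - 0) ^+ 2)).
  by apply: prodr_ge0 => i _; rewrite divr_ge0 ?(ltW r_gt0)// ltW// cauchy_den_gt0.
have C1r : 0 <= C1 * r ^+ d by rewrite mulr_ge0 ?exprn_ge0// ltW.
have point z : expR (- (t * RePsi A N z)) <=
   C1 * r ^+ d * \prod_i (r / (r ^+ 2 + (tnth z i - 0) ^+ 2))
   + expR (- ((t - t0) * mu)) * expR (- (t0 * RePsi A N z)).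
  have prod0 : 0 <= C1 * r ^+ d * \prod_i (r / (r ^+ 2 + (tnth z i - 0) ^+ 2)).
    exact: mulr_ge0.
  (* Three zones: beyond r1 the lower bound mu acts on the time t - t0; in the ball of radius r the
     trivial bound 1 is dominated by the Cauchy product; in between the decay comes from the
     scaling. *)
  have [zr1|zr1] := leP r1 (vnorm z).
    apply: (@le_trans _ _ (expR (- ((t - t0) * mu)) * expR (- (t0 * RePsi A N z)))); last by rewrite lerDr.
    rewrite -expRD ler_expR -opprD lerN2 mulrBl.
    have : (t - t0) * mu <= (t - t0) * RePsi A N z by rewrite ler_pM2l ?subr_gt0// hmu.
    by lra.
  apply: (@le_trans _ _ (C1 * r ^+ d * \prod_i (r / (r ^+ 2 + (tnth z i - 0) ^+ 2)))); last first.
    by rewrite lerDl mulr_ge0 ?expR_ge0.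
  have [zr|zr] := leP (vnorm z) r.
    apply: (@le_trans _ _ 1); first by rewrite -expR0 ler_expR oppr_le0 mulr_ge0 ?RePsi_ge0// ltW.
    have := cauchy_prod_ge r_gt0 (lexx _) zr; rewrite divff ?gt_eqF// expr1n => /le_trans; apply.
    rewrite mulrA ler_wpM2r//.
    rewrite ler_wpM2r ?exprn_ge0 ?(ltW r_gt0)// /C1 ler_peMr ?exprn_ge0// lerDl.
    by rewrite divr_ge0 ?exprn_ge0// ltW.
  have z0 : 0 < vnorm z := lt_trans r_gt0 zr.
  have hl : 0 < r / vnorm z <= 1 by rewrite divr_gt0//= ler_pdivrMr// mul1r ltW.
  have hz : 0 < vnorm z < r1 by rewrite z0.
  have := hsc _ _ hl hz; rewrite divfK ?gt_eqF// => h1.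
  have Pz : 0 <= PsiStar A N (vnorm z) by rewrite PsiStar_ge0// ltW.
  have w0 : 0 < r / vnorm z by rewrite divr_gt0.
  have key : a <= (t * RePsi A N z) ^+ m * (r / vnorm z).
    have h2 : (t * PsiStar A N (vnorm z)) ^+ m <= (8 * c4) ^+ m * (t * RePsi A N z) ^+ m.
      rewrite -exprMn lerXn2r ?nnegrE ?mulr_ge0 ?RePsi_ge0 ?(ltW t_gt0) ?(ltW c40)//.
      by rewrite mulrCA ler_pM2l// hlow.
    have h3 : (4 * CP)^-1 ^+ m <= (t * PsiStar A N r) ^+ m.
      by rewrite lerXn2r ?nnegrE ?mulr_ge0 ?invr_ge0 ?mulr_ge0 ?(ltW CP0) ?(ltW t_gt0).
    have h4 : (t * PsiStar A N r) ^+ m <= C * (r / vnorm z) * (t * PsiStar A N (vnorm z)) ^+ m.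
      by rewrite !exprMn mulrCA ler_pM2l ?exprn_gt0.
    have h5 : (4 * CP)^-1 ^+ m <= C * (r / vnorm z) * ((8 * c4) ^+ m * (t * RePsi A N z) ^+ m).
      apply: le_trans h3 _; apply: le_trans h4 _.
      by rewrite ler_wpM2l// mulr_ge0 ?ltW.
    rewrite /a ler_pdivrMr// (_ : 32 * c4 * CP = (8 * c4) * (4 * CP)); last by ring.
    rewrite invfM exprMn exprVn mulrC ler_pdivrMr ?exprn_gt0 ?mulr_gt0//.
    by apply: le_trans h5 _; rewrite le_eqVlt; apply/orP; left; apply/eqP; ring.
  have y0 : 0 < t * RePsi A N z.
    rewrite lt_neqAle mulr_ge0 ?RePsi_ge0 ?(ltW t_gt0)// andbT eq_sym; apply/eqP => y0.
    by move: key; rewrite y0 expr0n (gtn_eqF m0) mul0r leNgt a0.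
  apply: le_trans (expRN_le_pow n1 y0) _.
  have hy : a ^+ (2 * d) <= (t * RePsi A N z) ^+ n1 * (r / vnorm z) ^+ (2 * d).
    rewrite /n1 [_ ^+ (m * _)]exprM -exprMn lerXn2r ?nnegrE ?(ltW a0)//.
    by rewrite mulr_ge0 ?exprn_ge0 ?(ltW y0)// ltW.
  apply: (@le_trans _ _ (n1%:R ^+ n1 / a ^+ (2 * d) * (r / vnorm z) ^+ (2 * d))).
    rewrite exprMn exprVn -mulrA ler_wpM2l ?exprn_ge0//.
    rewrite [leRHS]mulrC ler_pdivlMr ?exprn_gt0// [leLHS]mulrC ler_pdivrMr ?exprn_gt0//.
    by rewrite mulrC.
  have := cauchy_prod_ge r_gt0 (ltW zr) (lexx (vnorm z)) => h6.
  have c0' : 0 <= n1%:R ^+ n1 / a ^+ (2 * d) by rewrite divr_ge0 ?exprn_ge0// ltW.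
  apply: (@le_trans _ _ ((1 + n1%:R ^+ n1 / a ^+ (2 * d)) * (r / vnorm z) ^+ (2 * d))).
    by rewrite ler_wpM2r ?exprn_ge0 ?(ltW w0)// lerDr.
  apply: (@le_trans _ _ ((1 + n1%:R ^+ n1 / a ^+ (2 * d)) * (2 ^+ d * (r ^+ d * \prod_i (r / (r ^+ 2 + (tnth z i - 0) ^+ 2)))))).
    by rewrite ler_wpM2l// addr_ge0.
  by rewrite le_eqVlt; apply/orP; left; apply/eqP; rewrite /C1; ring.
have mprod : measurable_fun setT (fun z : d.-tuple R => \prod_i (r / (r ^+ 2 + (tnth z i - 0) ^+ 2))).
  apply: measurable_prod => i _.
  apply: (@measurableT_comp _ _ _ _ _ _ (fun v : R => r / (r ^+ 2 + (v - 0) ^+ 2))).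
    by apply: continuous_measurable_fun; exact: continuous_cauchy.
  exact: measurable_tnth.
apply: (@le_trans _ _ (leb_int (fun z : d.-tuple R => (C1 * r ^+ d * \prod_i (r / (r ^+ 2 + (tnth z i - 0) ^+ 2))
   + expR (- ((t - t0) * mu)) * expR (- (t0 * RePsi A N z)))%:E))).
  apply: le_leb_int => //; first exact: measurable_expRePsi.
  by apply: measurable_funD; apply: measurable_funM => //; exact: measurable_expRePsi.
rewrite leb_intD; last 4 first.
- exact: measurable_funM.
- by apply: measurable_funM => //; exact: measurable_expRePsi.
- by move=> z; rewrite mulr_ge0.
- by move=> z; rewrite mulr_ge0 ?expR_ge0.
rewrite (@leb_int_prod _ _ (fun=> fun v => r / (r ^+ 2 + (v - 0) ^+ 2)) (fun=> pi))//; last 3 first.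
- by move=> i; apply: continuous_measurable_fun; exact: continuous_cauchy.
- by move=> i u; rewrite divr_ge0 ?(ltW r_gt0)// ltW// cauchy_den_gt0.
- by move=> i; exact: integral_cauchy.
rewrite leb_intZ ?expR_ge0//; last exact: measurable_expRePsi.
rewrite -/(PsiIntegral t0) Ifin -EFinM -EFinD lee_fin prodr_const card_ord.
rewrite -exprVn -/r.
have tail : expR (- ((t - t0) * mu)) * I <= C3 * r ^+ d.
  have h1 : (t^-1) ^+ m <= b * r.
    have hl : 0 < r / r2 <= 1 by rewrite divr_gt0//= ler_pdivrMr// mul1r.
    have hr2 : 0 < r2 < r1 by rewrite r20.
    have := hsc _ _ hl hr2; rewrite divfK ?gt_eqF// => h2.
    apply: (@le_trans _ _ ((4 * CP * PsiStar A N r) ^+ m)).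
      by rewrite lerXn2r ?nnegrE ?mulr_ge0 ?(ltW ti0) ?(ltW CP0).
    rewrite exprMn; apply: (@le_trans _ _ ((4 * CP) ^+ m * (C * (r / r2) * PsiStar A N r2 ^+ m))).
      by rewrite ler_wpM2l// exprn_ge0// mulr_ge0// ltW.
    by rewrite le_eqVlt; apply/orP; left; apply/eqP; rewrite /b; ring.
  rewrite mulrBl opprB expRD /C3.
  have h4 : expR (- (t * mu)) <= (n2%:R / mu) ^+ n2 * b ^+ d * r ^+ d.
    apply: le_trans (expRN_le_pow n2 (mulr_gt0 t_gt0 mu0)) _.
    rewrite (_ : n2%:R / (t * mu) = n2%:R / mu * t^-1); last by field; rewrite !gt_eqF.
    rewrite exprMn -mulrA ler_wpM2l ?exprn_ge0 ?divr_ge0 ?(ltW mu0)//.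
    rewrite -exprMn /n2 exprM lerXn2r ?nnegrE ?exprn_ge0 ?(ltW ti0)//.
    by rewrite mulr_ge0 // ltW.
  apply: (@le_trans _ _ (expR (t0 * mu) * ((n2%:R / mu) ^+ n2 * b ^+ d * r ^+ d) * I)).
    by rewrite ler_wpM2r// ler_wpM2l ?expR_ge0.
  by rewrite le_eqVlt; apply/orP; left; apply/eqP; ring.
have rd : 0 <= r ^+ d by rewrite exprn_ge0// ltW.
apply: le_trans (lerD (lexx _) tail) _.
rewrite (_ : C1 * r ^+ d * pi ^+ d + C3 * r ^+ d = (C1 * pi ^+ d + C3) * r ^+ d); last by ring.
by rewrite ler_wpM2r// lerDl.
Qed.

End equivalences.

(** * Fourier inversion through Poisson kernels *)

Section kernels.
Variables (R : realType) (d : nat).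
Implicit Types x y z a : d.-tuple R.

Definition abel_weight (e : R) z : R := \prod_i expR (- (e * `|tnth z i|)).

Lemma abel_weightE e z : abel_weight e z = expR (- (e * \sum_i `|tnth z i|)).
Proof. by rewrite mulr_sumr -sumrN expR_sum. Qed.

Lemma abel_weight_ge0 e z : 0 <= abel_weight e z.
Proof. by rewrite abel_weightE expR_ge0. Qed.

Lemma measurable_abel_weight e : measurable_fun setT (abel_weight e).
Proof.
apply: measurable_prod => i _.
apply: (@measurableT_comp _ _ _ _ _ _ (fun v : R => expR (- (e * `|v|)))); last exact: measurable_tnth.
by apply: measurableT_comp => //; apply: measurableT_comp => //; exact: measurable_funM.
Qed.

Lemma leb_int_abel_weight e : 0 < e ->
  leb_int (fun z => (abel_weight e z)%:E) = ((2 / e) ^+ d)%:E.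
Proof.
move=> e0; have := @leb_int_laplace_cos R d (fun=> 0) e 0 1 0 e0.
rewrite normr0 ler01 => /(_ isT); rewrite mul1r !mul0r addr0 => <-.
by congr leb_int; apply/funext => z; rewrite mul0r addr0 mulr1.
Qed.

(** The Fourier transform of [abel_weight], recentred at a and left unnormalised: its total mass is
    (2 pi)^d. *)
Definition poisson_kernel (e : R) a y : R :=
  \prod_i (2 * e / (e ^+ 2 + (tnth y i - tnth a i) ^+ 2)).

Lemma poisson_kernel_ge0 e a y : 0 < e -> 0 <= poisson_kernel e a y.
Proof.
move=> e0; apply: prodr_ge0 => i _.
by rewrite divr_ge0 ?mulr_ge0 ?(ltW e0)// ltW// cauchy_den_gt0.
Qed.

Lemma measurable_poisson_kernel2 e (dT : measure_display) (T : measurableType dT)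
  (f g : T -> d.-tuple R) : 0 < e -> measurable_fun setT f -> measurable_fun setT g ->
  measurable_fun setT (fun t => poisson_kernel e (f t) (g t)).
Proof.
move=> e0 /measurable_fun_tnthP mf /measurable_fun_tnthP mg.
apply: measurable_prod => i _.
apply: (@measurableT_comp _ _ _ _ _ _ (fun v : R => 2 * e / (e ^+ 2 + v ^+ 2))).
  apply: continuous_measurable_fun => u.
  have := @continuous_cauchy R e 0 e0 u; rewrite /continuous_at subr0 => h.
  have -> : (fun v : R => 2 * e / (e ^+ 2 + v ^+ 2)) = (fun v => 2 * (e / (e ^+ 2 + (v - 0) ^+ 2))).
    by apply/funext => v; rewrite subr0 mulrA.
  by rewrite -[2 * e / (e ^+ 2 + u ^+ 2)]mulrA; apply: cvgMr.
by apply: measurable_funB; [exact: mg|exact: mf].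
Qed.

Lemma leb_int_abel_cos e a y : 0 < e ->
  leb_int (fun z => (abel_weight e z * (1 + cos (ip z y - ip z a)))%:E)
  = ((2 / e) ^+ d + poisson_kernel e a y)%:E.
Proof.
move=> e0; have := @leb_int_laplace_cos R d (fun i => tnth y i - tnth a i) e 0 1 1 e0.
rewrite normr1 lexx => /(_ isT); rewrite cos0 !mul1r => <-.
congr leb_int; apply/funext => z; rewrite add0r mul1r; congr (_ * (1 + cos _))%:E.
by rewrite /ip -sumrB; apply: eq_bigr => i _; rewrite mulrBr.
Qed.

Lemma leb_int_poisson_kernel e a : 0 < e ->
  leb_int (fun y => (poisson_kernel e a y)%:E) = ((2 * pi) ^+ d)%:E.
Proof.
move=> e0.
have := @leb_int_prod R d (fun i v => 2 * (e / (e ^+ 2 + (v - tnth a i) ^+ 2))) (fun=> 2 * pi) 1 ler01.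
rewrite prodr_const card_ord mul1r => <-.
- by congr leb_int; apply/funext => y; rewrite mul1r; congr EFin; apply: eq_bigr => i _; rewrite mulrA.
- move=> i; apply: measurable_funM => //.
  by apply: continuous_measurable_fun; exact: continuous_cauchy.
- by move=> i u; rewrite mulr_ge0// divr_ge0 ?(ltW e0)// ltW// cauchy_den_gt0.
- move=> i; under eq_integral do rewrite EFinM.
  rewrite ge0_integralZl_EFin//=.
  + by rewrite [X in (_ * X)%E](integral_cauchy (tnth a i) e0).
  + by move=> u _; rewrite lee_fin divr_ge0 ?(ltW e0)// ltW// cauchy_den_gt0.
  + by apply/measurable_EFinP; apply: continuous_measurable_fun; exact: continuous_cauchy.
Qed.

(** Monotone convergence, so that the limit is allowed to be infinite: in the Plancherel step
    finiteness of the limit is the conclusion. *)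
Lemma abel_weight_cvg (f : d.-tuple R -> R) : measurable_fun setT f ->
  (forall z, 0 <= f z) ->
  (leb_int (fun z => (abel_weight (n.+1%:R ^- 2) z * f z)%:E) @[n --> \oo] -->
   leb_int (fun z => (f z)%:E))%E.
Proof.
move=> mf f0.
have wf0 n z : 0 <= abel_weight (n.+1%:R ^- 2) z * f z.
  by rewrite mulr_ge0// abel_weight_ge0.
have mwf n : measurable_fun setT (fun z => (abel_weight (n.+1%:R ^- 2) z * f z)%:E).
  apply/measurable_EFinP; apply: measurable_funM => //; exact: measurable_abel_weight.
have -> : (fun n => leb_int (fun z => (abel_weight (n.+1%:R ^- 2) z * f z)%:E)) =
    (fun n => \int[leb_measure R d]_z (abel_weight (n.+1%:R ^- 2) z * f z)%:E)%E.
  by apply/funext => n; rewrite leb_intE// => z; rewrite lee_fin.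
rewrite leb_intE//; last by apply/measurable_EFinP.
have -> : (\int[leb_measure R d]_z (f z)%:E =
  \int[leb_measure R d]_z (limn (fun n => (abel_weight (n.+1%:R ^- 2) z * f z)%:E)))%E.
  apply: eq_integral => z _; apply/esym/cvg_lim => //.
  apply: cvg_EFin; first exact: nearW.
  rewrite /comp/= -[X in _ --> X](mul1r (f z)); apply: cvgMl.
  under eq_fun do rewrite abel_weightE.
  have h : - (n.+1%:R ^- 2 * \sum_i `|tnth z i|) @[n --> \oo] --> (0 : R).
    rewrite -[X in _ --> X]oppr0; apply: cvgN; rewrite -[X in _ --> X](mul0r (\sum_i `|tnth z i|)).
    apply: cvgMl; rewrite -[X in _ --> X](mulr0 0).
    under eq_fun do rewrite expr2 invfM.
    by apply: cvgM; exact: cvg_harmonic.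
  have h2 : expR (- (n.+1%:R ^- 2 * \sum_i `|tnth z i|)) @[n --> \oo] --> (1 : R).
    rewrite -[X in _ --> X]expR0.
    exact: (@continuous_cvg _ _ _ _ _ _ (@expR R) 0 (@continuous_expR R 0) h).
  exact: h2.
apply: cvg_monotone_convergence => //.
  by move=> n z _; rewrite lee_fin.
move=> z _ n m nm; rewrite lee_fin ler_wpM2r// !abel_weightE ler_expR lerN2.
rewrite ler_wpM2r ?sumr_ge0// lef_pV2 ?posrE ?exprn_gt0//.
by rewrite lerXn2r ?nnegrE// ler_nat ltnS.
Qed.

End kernels.

Lemma fin_eq_sub (R : realDomainType) (c : R) (x y z : \bar R) :
  x \is a fin_num -> y \is a fin_num -> z \is a fin_num ->
  (c%:E + x + z = c%:E + y -> x = y - z)%E.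
Proof.
case: x => // x; case: y => // y; case: z => // z _ _ _.
by rewrite -!EFinD => -[h]; congr EFin; lra.
Qed.

(** * Characteristic functions with modulus [E] and phase [th] *)

Section charfun.
Variables (R : realType) (d : nat).
Variables (dT : measure_display) (T : measurableType dT) (P : probability T R).
Variables (X : T -> d.-tuple R) (mX : measurable_fun setT X).
Variables (E th : d.-tuple R -> R).
Hypothesis E0 : forall z, 0 <= E z.
Hypothesis mE : measurable_fun setT E.
Hypothesis hc : forall z, (\int[P]_w (cos (ip z (X w)))%:E = (E z * cos (th z))%:E)%E.
Hypothesis hs : forall z, (\int[P]_w (sin (ip z (X w)))%:E = (- (E z * sin (th z)))%:E)%E.
Implicit Types a z : d.-tuple R.

Let mcos : measurable_fun setT (@cos R).
Proof. by apply: continuous_measurable_fun; exact: continuous_cos. Qed.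
Let msin : measurable_fun setT (@sin R).
Proof. by apply: continuous_measurable_fun; exact: continuous_sin. Qed.

Lemma integrable_bounded1 (f : T -> R) : measurable_fun setT f ->
  (forall w, `|f w| <= 1) -> P.-integrable setT (EFin \o f).
Proof.
move=> mf f1; apply: (@le_integrable _ _ _ P setT _ _ (EFin \o cst 1)) => //.
- exact/measurable_EFinP.
- by move=> w _ /=; rewrite lee_fin normr1.
- exact: finite_measure_integrable_cst.
Qed.

Lemma prob_integral_cst (c : R) : (\int[P]_w (cst c%:E w) = c%:E)%E.
Proof.
rewrite integral_cst//; transitivity (c%:E * 1)%E; last by rewrite mule1.
by congr (_ * _)%E; exact: probability_setT.
Qed.

Lemma measurable_ipX z : measurable_fun setT (fun w => ip z (X w)).
Proof. by apply: (@measurableT_comp _ _ _ _ _ _ (ip z)) => //; exact: measurable_ip. Qed.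

Lemma integral_cos_affine z (al be de : R) :
  (\int[P]_w (al + be * cos (ip z (X w) + de))%:E = (al + be * (E z * cos (th z - de)))%:E)%E.
Proof.
have ic : P.-integrable setT (EFin \o (fun w => cos (ip z (X w)))).
  by apply: integrable_bounded1 => [|w]; [exact: measurableT_comp (measurable_ipX z)|exact: cos_max].
have is_ : P.-integrable setT (EFin \o (fun w => sin (ip z (X w)))).
  by apply: integrable_bounded1 => [|w]; [exact: measurableT_comp (measurable_ipX z)|exact: sin_max].
have i1 : P.-integrable setT (EFin \o (fun w => be * cos de * cos (ip z (X w)))).
  exact: (integrableZl _ _ ic).
have i2 : P.-integrable setT (EFin \o (fun w => - (be * sin de) * sin (ip z (X w)))).
  exact: (integrableZl _ _ is_).
have i0 : P.-integrable setT (EFin \o cst al) by exact: finite_measure_integrable_cst.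
have i01 : P.-integrable setT (EFin \o (fun w => al + be * cos de * cos (ip z (X w)))).
  exact: (integrableD _ i0 i1).
transitivity (\int[P]_w (al + be * cos de * cos (ip z (X w)) + - (be * sin de) * sin (ip z (X w)))%:E)%E.
  by apply: eq_integral => w _; rewrite cosD; congr EFin; ring.
have i012 : P.-integrable setT (EFin \o (fun w => al + be * cos de * cos (ip z (X w)) +
    - (be * sin de) * sin (ip z (X w)))).
  exact: (integrableD _ i01 i2).
rewrite -[LHS]fineK; last exact: integrable_fin_num.
congr EFin; rewrite -/(Rintegral P setT _) RintegralD// RintegralD// !RintegralZl// Rintegral_cst//.
have -> : al * fine (P setT) = al by rewrite [P _](@probability_setT _ _ _ P) mulr1.
have -> : \int[P]_w cos (ip z (X w)) = E z * cos (th z) by rewrite /Rintegral hc.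
have -> : \int[P]_w sin (ip z (X w)) = - (E z * sin (th z)) by rewrite /Rintegral hs.
by rewrite cosB; ring.
Qed.

(** The phase th is an arbitrary function here. Adding 1 gives the P-average of 1 + cos(<z,X> -
    <z,a>), so joint measurability is supplied by Tonelli. *)
Lemma measurable_char2 :
  measurable_fun setT (fun p : d.-tuple R * d.-tuple R => E p.1 * cos (th p.1 + ip p.1 p.2)).
Proof.
pose f (q : (d.-tuple R * d.-tuple R) * T) := (1 + cos (ip q.1.1 (X q.2) + - ip q.1.1 q.1.2))%:E.
have f0 q : (0 <= f q)%E by rewrite lee_fin -lerBlDl sub0r cos_geN1.
have mf : measurable_fun setT f.
  apply/measurable_EFinP; apply: measurable_funD => //.
  apply: (measurableT_comp mcos); apply: measurable_funD.
    by apply: measurable_ip2; apply: measurableT_comp => //; exact: measurableT_comp.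
  apply: (@measurableT_comp _ _ _ _ _ _ (@GRing.opp R)) => //.
  by apply: measurable_ip2; apply: measurableT_comp => //; exact: measurableT_comp.
have h := @measurable_fun_fubini_tonelli_F _ _ _ _ R P f mf f0.
have {}h : measurable_fun setT (fun p : d.-tuple R * d.-tuple R => 1 + E p.1 * cos (th p.1 + ip p.1 p.2)).
  apply/measurable_EFinP; apply: eq_measurable_fun h => p _.
  rewrite /fubini_F /f/=.
  have := @integral_cos_affine p.1 1 1 (- ip p.1 p.2).
  by rewrite opprK mul1r => <-; apply: eq_integral => w _; rewrite mul1r.
have -> : (fun p : d.-tuple R * d.-tuple R => E p.1 * cos (th p.1 + ip p.1 p.2)) =
  (fun p => (1 + E p.1 * cos (th p.1 + ip p.1 p.2)) - 1) by apply/funext => p; rewrite addrAC subrr add0r.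
exact: measurable_funB.
Qed.

Lemma measurable_char a : measurable_fun setT (fun z => E z * cos (th z + ip z a)).
Proof.
apply: (@measurableT_comp _ _ _ _ _ _
  (fun p : d.-tuple R * d.-tuple R => E p.1 * cos (th p.1 + ip p.1 p.2)) _ (fun z => (z, a))).
  exact: measurable_char2.
exact: pair2_measurable.
Qed.

(** Average 1 - cos(<z,X> + th(z)) >= 0: the shift by th(z) cancels the phase and leaves 1 -
    E(z). *)
Lemma E_le1 z : E z <= 1.
Proof.
have h : (\int[P]_w (1 + (-1) * cos (ip z (X w) + th z))%:E = (1 + (-1) * (E z * cos (th z - th z)))%:E)%E.
  exact: integral_cos_affine.
have : (0%:E <= \int[P]_w (1 + (-1) * cos (ip z (X w) + th z))%:E)%E.
  by apply: integral_ge0 => w _; rewrite lee_fin mulN1r subr_ge0 cos_le1.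
by rewrite h lee_fin subrr cos0 mulr1 mulN1r subr_ge0.
Qed.

Lemma onePEcos_ge0 z u : 0 <= 1 + E z * cos u.
Proof.
rewrite -lerBlDl sub0r lerNl -mulrN; apply: (@le_trans _ _ (E z * 1)).
  by rewrite ler_wpM2l// lerNl cos_geN1.
by rewrite mulr1 E_le1.
Qed.

(** Both sides are the double integral of w_e(z) (1 + cos <z, X - a>), taken in the two orders; (2 /
    e)^d is the contribution of the summand 1. *)
Lemma poisson_smoothing e a : 0 < e ->
  (((2 / e) ^+ d)%:E + \int[P]_w (poisson_kernel e a (X w))%:E =
   leb_int (fun z => (abel_weight e z * (1 + E z * cos (th z + ip z a)))%:E))%E.
Proof.
move=> e0.
pose f (p : d.-tuple R * T) := (abel_weight e p.1 * (1 + cos (ip p.1 (X p.2) - ip p.1 a)))%:E.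
have f0 p : (0 <= f p)%E.
  by rewrite lee_fin mulr_ge0 ?abel_weight_ge0// -lerBlDl sub0r cos_geN1.
have mf : measurable_fun setT f.
  apply/measurable_EFinP; apply: measurable_funM.
    by apply: measurableT_comp => //; exact: measurable_abel_weight.
  apply: measurable_funD => //; apply: (measurableT_comp mcos); apply: measurable_funB.
    by apply: measurable_ip2 => //; exact: measurableT_comp.
  by apply: measurable_ip2.
have mk : measurable_fun setT (fun w => (poisson_kernel e a (X w))%:E).
  by apply/measurable_EFinP; apply: measurable_poisson_kernel2.
transitivity (\int[P]_w ((2 / e) ^+ d + poisson_kernel e a (X w))%:E)%E.
  under [RHS]eq_integral do rewrite EFinD.
  rewrite ge0_integralD//.
  - by rewrite [X in (_ = X + _)%E](@prob_integral_cst ((2 / e) ^+ d)).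
  - by move=> w _; rewrite lee_fin exprn_ge0// divr_ge0// ltW.
  - by move=> w _; rewrite lee_fin poisson_kernel_ge0.
transitivity (\int[P]_w \int[leb_measure R d]_z f (z, w))%E.
  apply: eq_integral => w _; rewrite -leb_int_abel_cos// leb_intE//.
    apply/measurable_EFinP; apply: measurable_funM; first exact: measurable_abel_weight.
    apply: measurable_funD => //; apply: (measurableT_comp mcos); apply: measurable_funB.
      by apply: measurable_ip2 => //; exact: measurable_id.
    by apply: measurable_ip2 => //; exact: measurable_id.
  by move=> z; exact: (f0 (z, w)).
rewrite -fubini_tonelli// leb_intE.
- apply: eq_integral => z _; rewrite /f/=.
  rewrite mulrDr mulr1 -[th z + _]opprK opprD -{1}[ip z a]opprK.
  have := @integral_cos_affine z (abel_weight e z) (abel_weight e z) (- ip z a).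
  rewrite !opprK opprD !opprK => <-; apply: eq_integral => w _.
  by rewrite mulrDr mulr1.
- apply/measurable_EFinP; apply: measurable_funM; first exact: measurable_abel_weight.
  by apply: measurable_funD => //; exact: measurable_char.
- by move=> z; rewrite lee_fin mulr_ge0 ?abel_weight_ge0 ?onePEcos_ge0.
Qed.

(** * A Plancherel bound from a bounded density *)

Section plancherel.
Variable M : R.
Hypothesis M0 : 0 <= M.
Hypothesis dom : forall B, measurable B -> (P (X @^-1` B) <= M%:E * leb_measure R d B)%E.

Lemma integral_le_dom (f : d.-tuple R -> \bar R) : measurable_fun setT f ->
  (forall x, (0 <= f x)%E) ->
  (\int[P]_w f (X w) <= M%:E * \int[leb_measure R d]_x f x)%E.
Proof.
move=> mf f0.
pose nu : {measure set (d.-tuple R) -> \bar R} :=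
  measure_function_pushforward__canonical__measure_function_Measure P mX.
have -> : (\int[P]_w f (X w) = \int[nu]_x f x)%E.
  by rewrite ge0_integral_pushforward//= preimage_setT.
pose M' : {nonneg R} := NngNum M0.
rewrite -[M%:E](_ : M'%:num%:E = _)// -ge0_integral_mscale//.
by apply: ge0_le_measure_integral => // B mB; rewrite /mscale/=; exact: dom.
Qed.

(** Averaging E cos(th + <z,X>) over the law of X gives E^2. In the other order, fixing X(w) and
    integrating in z gives the Poisson smoothing centred at X(w), itself an average over a second
    variable v: this variable is the independent copy. *)
Lemma leb_int_abel_sqr e : 0 < e ->
  (leb_int (fun z => (abel_weight e z * E z ^+ 2)%:E) <= (M * (2 * pi) ^+ d)%:E)%E.
Proof.
move=> e0.
have c0 : 0 <= (2 / e) ^+ d :> R by rewrite exprn_ge0// divr_ge0// ltW.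
pose f (p : d.-tuple R * T) := (abel_weight e p.1 * (1 + E p.1 * cos (th p.1 + ip p.1 (X p.2))))%:E.
have f0 p : (0 <= f p)%E by rewrite lee_fin mulr_ge0 ?abel_weight_ge0 ?onePEcos_ge0.
have mf : measurable_fun setT f.
  apply/measurable_EFinP; apply: measurable_funM.
    by apply: measurableT_comp => //; exact: measurable_abel_weight.
  apply: measurable_funD => //.
  apply: (@measurableT_comp _ _ _ _ _ _
    (fun p : d.-tuple R * d.-tuple R => E p.1 * cos (th p.1 + ip p.1 p.2)) _ (fun p : d.-tuple R * T => (p.1, X p.2))).
    exact: measurable_char2.
  by apply: measurable_fun_pair => //; exact: measurableT_comp.
have mw : measurable_fun setT (abel_weight e : d.-tuple R -> R) by exact: measurable_abel_weight.
have mE2 : measurable_fun setT (fun z => abel_weight e z * E z ^+ 2).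
  by apply: measurable_funM => //; exact: measurable_funX.
have h1 : (leb_int (fun z => (abel_weight e z + abel_weight e z * E z ^+ 2)%:E) =
    \int[P]_w \int[leb_measure R d]_z f (z, w))%E.
  rewrite -fubini_tonelli// leb_intE.
  - apply: eq_integral => z _; rewrite /f/=.
    have := @integral_cos_affine z (abel_weight e z) (abel_weight e z * E z) (th z).
    rewrite subrr cos0 mulr1 -mulrA -expr2 => <-; apply: eq_integral => w _.
    by rewrite addrC [th z + _]addrC; congr EFin; ring.
  - by apply/measurable_EFinP; exact: measurable_funD.
  - by move=> z; rewrite lee_fin addr_ge0 ?mulr_ge0 ?abel_weight_ge0 ?sqr_ge0.
have h2 : (\int[P]_w \int[leb_measure R d]_z f (z, w) <= ((2 / e) ^+ d + M * (2 * pi) ^+ d)%:E)%E.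
  apply: (@le_trans _ _ (\int[P]_w (cst ((2 / e) ^+ d + M * (2 * pi) ^+ d)%:E w))%E).
    apply: ge0_le_integral => //.
    - by move=> w _; apply: integral_ge0 => z _; exact: f0.
    - exact: measurable_fun_fubini_tonelli_G.
    move=> w _.
    have -> : (\int[leb_measure R d]_z f (z, w) =
      ((2 / e) ^+ d)%:E + \int[P]_v (poisson_kernel e (X w) (X v))%:E)%E.
      rewrite poisson_smoothing// leb_intE//; last by move=> z; exact: (f0 (z, w)).
      apply/measurable_EFinP; apply: measurable_funM => //.
      by apply: measurable_funD => //; exact: measurable_char.
    rewrite EFinD leeD2l//.
    have mk : measurable_fun setT (fun y => (poisson_kernel e (X w) y)%:E).
      by apply/measurable_EFinP; apply: measurable_poisson_kernel2 => //; exact: measurable_id.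
    have k0 y : (0 <= (poisson_kernel e (X w) y)%:E)%E by rewrite lee_fin poisson_kernel_ge0.
    apply: le_trans (integral_le_dom mk k0) _.
    by rewrite -leb_intE// leb_int_poisson_kernel.
  by rewrite prob_integral_cst.
move: h2; rewrite -h1 leb_intD//.
- by rewrite leb_int_abel_weight// EFinD leeD2lE.
- by move=> z; exact: abel_weight_ge0.
- by move=> z; rewrite mulr_ge0 ?abel_weight_ge0 ?sqr_ge0.
Qed.

Lemma leb_int_sqr_char_le :
  (leb_int (fun z => (E z ^+ 2)%:E) <= (M * (2 * pi) ^+ d)%:E)%E.
Proof.
have mE2 : measurable_fun setT (fun z => E z ^+ 2) by exact: measurable_funX.
have h := abel_weight_cvg mE2 (fun z => sqr_ge0 (E z)).
rewrite -(cvg_lim _ h)//; apply: lime_le; first by apply/cvg_ex; eexists; exact: h.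
by apply: nearW => n; apply: leb_int_abel_sqr; rewrite invr_gt0 exprn_gt0.
Qed.

End plancherel.

(** * Inversion for an integrable modulus *)

Section inversion.
Hypothesis IE : (leb_int (fun z => (E z)%:E) < +oo)%E.

Let I := fine (leb_int (fun z => (E z)%:E)).
Let en (n : nat) : R := n.+1%:R ^- 2.
Let en0 n : 0 < en n. Proof. by rewrite invr_gt0 exprn_gt0. Qed.

Lemma leb_int_charE : leb_int (fun z => (E z)%:E) = I%:E.
Proof.
rewrite fineK// ge0_fin_numE// leb_intE//.
- by apply: integral_ge0 => z _; rewrite lee_fin.
- by apply/measurable_EFinP.
Qed.

Let E1cos z u := E z + E z * cos (th z + u).

Let E1cos_ge0 z u : 0 <= E1cos z u.
Proof.
by rewrite /E1cos -[X in X + _]mulr1 -mulrDr mulr_ge0// -lerBlDl sub0r cos_geN1.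
Qed.

Let E1cos_le z u : E1cos z u <= 2 * E z.
Proof.
have : E z * cos (th z + u) <= E z * 1 by rewrite ler_wpM2l// cos_le1.
rewrite /E1cos; lra.
Qed.

Let mE1cos a : measurable_fun setT (fun z => E1cos z (ip z a)).
Proof. by apply: measurable_funD => //; exact: measurable_char. Qed.

(** This is the integral of E cos(th + <z,a>), that is (2 pi)^d times the future density, encoded as
    a difference of two integrals of nonnegative functions. *)
Definition char_inv a : R := fine (leb_int (fun z => (E1cos z (ip z a))%:E)) - I.

Lemma leb_int_E1cos a :
  leb_int (fun z => (E1cos z (ip z a))%:E) = (char_inv a + I)%:E.
Proof.
rewrite /char_inv subrK fineK//.
have h : (leb_int (fun z => (E1cos z (ip z a))%:E) <= (2 * I)%:E)%E.
  rewrite EFinM -leb_int_charE -leb_intZ//; apply: le_leb_int => //.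
  exact: measurable_funM.
rewrite ge0_fin_numE ?(le_lt_trans h) ?ltry// leb_intE//.
- by apply: integral_ge0 => z _; rewrite lee_fin.
- by apply/measurable_EFinP.
- by move=> z; rewrite lee_fin.
Qed.

Lemma char_inv_le a : char_inv a <= I.
Proof.
have : (leb_int (fun z => (E1cos z (ip z a))%:E) <= (2 * I)%:E)%E.
  rewrite EFinM -leb_int_charE -leb_intZ//; apply: le_leb_int => //.
  exact: measurable_funM.
rewrite leb_int_E1cos lee_fin; lra.
Qed.

Lemma measurable_char_inv : measurable_fun setT char_inv.
Proof.
apply: measurable_funB => //.
pose f (p : d.-tuple R * d.-tuple R) := (E1cos p.1 (ip p.1 p.2))%:E.
have f0 p : (0 <= f p)%E by rewrite lee_fin.
have mf : measurable_fun setT f.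
  apply/measurable_EFinP; apply: measurable_funD; last exact: measurable_char2.
  exact: measurableT_comp.
have h := @measurable_fun_fubini_tonelli_G _ _ _ _ R (leb_measure R d) f mf f0.
apply: (eq_measurable_fun (fun a => fine (\int[leb_measure R d]_z f (z, a)))).
  move=> a _; rewrite leb_intE//; first by apply/measurable_EFinP.
  by move=> z; rewrite lee_fin.
by apply: measurableT_comp h; exact: fine_measurable.
Qed.

(** Up to the factor (2 pi)^d, the density at a of the law of X convolved with a Poisson kernel. *)
Definition smoothed n a : \bar R := (\int[P]_w (poisson_kernel (en n) a (X w))%:E)%E.

Let mker n a : measurable_fun setT (fun w => (poisson_kernel (en n) a (X w))%:E).
Proof. by apply/measurable_EFinP; apply: measurable_poisson_kernel2. Qed.

Lemma smoothed_ge0 n a : (0 <= smoothed n a)%E.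
Proof. by apply: integral_ge0 => w _; rewrite lee_fin poisson_kernel_ge0. Qed.

Let w1 n z : abel_weight (en n) z <= 1.
Proof.
rewrite abel_weightE -expR0 ler_expR oppr_le0 mulr_ge0 ?(ltW (en0 n))//.
exact: sumr_ge0.
Qed.

(** The bound is uniform in n and a, and provides both finiteness and the domination needed to pass
    to the limit on boxes. *)
Lemma smoothed_le n a : (smoothed n a <= I%:E)%E.
Proof.
have := poisson_smoothing a (en0 n); rewrite -/(smoothed n a) => h.
have : (leb_int (fun z => (abel_weight (en n) z * (1 + E z * cos (th z + ip z a)))%:E)
   <= leb_int (fun z => (abel_weight (en n) z + E z)%:E))%E.
  apply: le_leb_int.
  - apply: measurable_funM; first exact: measurable_abel_weight.
    by apply: measurable_funD => //; exact: measurable_char.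
  - by apply: measurable_funD => //; exact: measurable_abel_weight.
  - by move=> z; rewrite mulr_ge0 ?abel_weight_ge0 ?onePEcos_ge0.
  move=> z; rewrite mulrDr mulr1 lerD2l; apply: (@le_trans _ _ (abel_weight (en n) z * E z)).
    by rewrite ler_wpM2l ?abel_weight_ge0// ler_piMr// cos_le1.
  by rewrite ler_piMl.
rewrite -h leb_intD//.
- by rewrite leb_int_abel_weight// leb_int_charE leeD2lE.
- exact: measurable_abel_weight.
- by move=> z; exact: abel_weight_ge0.
Qed.

(* [smoothed n a] is the difference of the Abel means of [E1cos] and of [E], both nonnegative. *)
Lemma smoothed_cvg a : smoothed n a @[n --> \oo] --> (char_inv a)%:E.
Proof.
have mw n : measurable_fun setT (abel_weight (en n) : d.-tuple R -> R).
  exact: measurable_abel_weight.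
have c1 := abel_weight_cvg mE E0.
have c2 := abel_weight_cvg (mE1cos a) (fun z => E1cos_ge0 z (ip z a)).
rewrite leb_int_charE in c1; rewrite leb_int_E1cos in c2.
have wE0 n z : 0 <= abel_weight (en n) z * E z by rewrite mulr_ge0// abel_weight_ge0.
have mwE n : measurable_fun setT (fun z => abel_weight (en n) z * E z).
  exact: measurable_funM.
have fin1 n : leb_int (fun z => (abel_weight (en n) z * E z)%:E) \is a fin_num.
  have h : (leb_int (fun z => (abel_weight (en n) z * E z)%:E) <= I%:E)%E.
    by rewrite -leb_int_charE; apply: le_leb_int => // z; rewrite ler_piMl.
  rewrite ge0_fin_numE ?(le_lt_trans h) ?ltry// leb_intE//.
  - by apply: integral_ge0 => z _; rewrite lee_fin.
  - by apply/measurable_EFinP.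
  - by move=> z; rewrite lee_fin.
have fin2 n : leb_int (fun z => (abel_weight (en n) z * E1cos z (ip z a))%:E) \is a fin_num.
  have h : (leb_int (fun z => (abel_weight (en n) z * E1cos z (ip z a))%:E) <= (char_inv a + I)%:E)%E.
    rewrite -leb_int_E1cos; apply: le_leb_int => //.
    - exact: measurable_funM.
    - by move=> z; rewrite mulr_ge0// abel_weight_ge0.
    - by move=> z; rewrite ler_piMl.
  rewrite ge0_fin_numE ?(le_lt_trans h) ?ltry// leb_intE//.
  - by apply: integral_ge0 => z _; rewrite lee_fin mulr_ge0// abel_weight_ge0.
  - by apply/measurable_EFinP; exact: measurable_funM.
  - by move=> z; rewrite lee_fin mulr_ge0// abel_weight_ge0.
have key n : (smoothed n a = leb_int (fun z => (abel_weight (en n) z * E1cos z (ip z a))%:E)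
    - leb_int (fun z => (abel_weight (en n) z * E z)%:E))%E.
  have fS : smoothed n a \is a fin_num.
    by rewrite ge0_fin_numE ?smoothed_ge0// (le_lt_trans (smoothed_le n a)) ?ltry.
  apply: (@fin_eq_sub R ((2 / en n) ^+ d) _ _ _ fS (fin2 n) (fin1 n)).
  have h := poisson_smoothing a (en0 n); rewrite -/(smoothed n a) in h.
  rewrite h -leb_int_abel_weight// -!leb_intD//.
  - by congr leb_int; apply/funext => z; congr EFin; rewrite /E1cos; ring.
  - apply: measurable_funM => //; apply: measurable_funD => //; exact: measurable_char.
  - by move=> z; exact: abel_weight_ge0.
  - by move=> z; rewrite mulr_ge0 ?abel_weight_ge0.
  - by apply: measurable_funM => //; apply: measurable_funD => //; exact: measurable_char.
  - by move=> z; rewrite mulr_ge0 ?abel_weight_ge0 ?onePEcos_ge0.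
rewrite (_ : (fun n => smoothed n a) = (fun n => leb_int (fun z => (abel_weight (en n) z * E1cos z (ip z a))%:E)
    - leb_int (fun z => (abel_weight (en n) z * E z)%:E))%E); last by apply/funext => n; exact: key.
rewrite (_ : (char_inv a)%:E = ((char_inv a + I)%:E - I%:E)%E); last by rewrite -EFinB addrK.
by apply: cvgeB.
Qed.

Lemma char_inv_ge0 a : 0 <= char_inv a.
Proof.
have h := @smoothed_cvg a.
rewrite -lee_fin -(cvg_lim _ h)//; apply: lime_ge; first by apply/cvg_ex; eexists; exact: h.
by apply: nearW => n; exact: smoothed_ge0.
Qed.

Definition box (al be : 'I_d -> R) : set (d.-tuple R) :=
  [set x | forall i, al i < tnth x i < be i].

Lemma measurable_box al be : measurable (box al be).
Proof.
have -> : box al be = \bigcap_(i in [set: 'I_d]) ((fun x => tnth x i) @^-1` `]al i, be i[%classic).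
  by apply/seteqP; split => x /= h i; [move=> _|]; have := h i; rewrite /= in_itv//=; apply.
apply: fin_bigcap_measurable => // i _.
by rewrite -[X in measurable X]setTI; apply: measurable_tnth.
Qed.

Lemma indic_box al be x : \1_(box al be) x = \prod_i (\1_(`]al i, be i[%classic) (tnth x i) : R).
Proof.
rewrite indicE; have [xB|xB] := boolP (x \in box al be).
  by rewrite big1// => i _; rewrite indicE mem_set//= in_itv/=; move/set_mem: xB; apply.
have [i hi] : exists i, ~~ (al i < tnth x i < be i).
  apply/existsP; rewrite -negb_forall; apply: contra xB => /forallP h.
  by apply/mem_set => i; exact: h.
by rewrite (bigD1 i)//= indicE memNset ?mul0r//= in_itv/=; exact/negP.
Qed.

Section one_box.
Variables al be : 'I_d -> R.
Hypothesis ab : forall i, al i < be i.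

(* The margin [dl / (n + 1)] is much larger than [en n = (n + 1)^-2], so the Poisson smoothing of the
   indicator of [[an n, bn n]] converges at every point, endpoints included. *)
Let dl i := (be i - al i) / 4.
Let dl0 i : 0 < dl i. Proof. by rewrite divr_gt0// subr_gt0. Qed.
Let an n i := al i + dl i / n.+1%:R.
Let bn n i := be i - dl i / n.+1%:R.

Let dln n i : dl i / n.+1%:R <= dl i.
Proof. by rewrite ler_pdivrMr// ler_peMr ?(ltW (dl0 i))// ler1n. Qed.

Let abn n i : an n i < bn n i.
Proof.
have h1 := dln n i; have h2 := dl0 i; rewrite /an /bn.
have h3 : be i - al i = 4 * dl i by rewrite /dl; field.
move: h1 h2 h3; move: (dl i / n.+1%:R) => u; move: (dl i) => v h1 h2 h3; lra.
Qed.

(** The mass that the one-dimensional factor of the kernel centred at y gives to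
    [an n i, bn n i]. *)
Let Ln n (y : R) i := 2 * (atan ((bn n i - y) / en n) - atan ((an n i - y) / en n)).

(** The arguments of atan in [Ln] are quadratic polynomials in n + 1 whose leading coefficient
    vanishes exactly when y is an endpoint; the linear term, created by the margin, then decides. *)
Let cvg_quad (c s : R) : 0 < c \/ (c = 0 /\ 0 < s) ->
  (c * n.+1%:R ^+ 2 + s * n.+1%:R) @[n --> \oo] --> +oo.
Proof.
move=> h; apply/cvgryPge => A.
have [K [K0 hK]] : exists K : R, 0 < K /\ exists m, forall n, (m <= n)%N -> K <= c * n.+1%:R + s.
  case: h => [c0|[-> s0]]; last by exists s; split => //; exists 0%N => n _; rewrite mul0r add0r.
  exists 1; split => //; exists (Num.truncn `|(1 - s) / c|) => n mn.
  have h : `|(1 - s) / c| < (Num.truncn `|(1 - s) / c|).+1%:R by exact: truncnS_gt.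
  have : (1 - s) / c <= n.+1%:R.
    apply: le_trans (ler_norm _) _; apply: le_trans (ltW h) _.
    by rewrite ler_nat ltnS.
  by rewrite ler_pdivrMr// mulrC; lra.
case: hK => m hm.
have h2 : `|A / K| < (Num.truncn `|A / K|).+1%:R by exact: truncnS_gt.
exists (maxn m (Num.truncn `|A / K|)) => // n /= mn.
have h1 := hm n (leq_trans (leq_maxl _ _) mn).
have h3 : A / K <= n.+1%:R.
  apply: le_trans (ler_norm _) _; apply: le_trans (ltW h2) _.
  by rewrite ler_nat ltnS (leq_trans (leq_maxr _ _) mn).
rewrite ler_pdivrMr// in h3; apply: le_trans h3 _.
have -> : c * n.+1%:R ^+ 2 + s * n.+1%:R = n.+1%:R * (c * n.+1%:R + s) by ring.
by rewrite ler_pM2l.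
Qed.

Let bnE n i y : (bn n i - y) / en n = (be i - y) * n.+1%:R ^+ 2 + (- dl i) * n.+1%:R.
Proof.
have n0 : n.+1%:R != 0 :> R by rewrite pnatr_eq0.
by rewrite /bn /en; move: n.+1%:R n0 => m m0; field.
Qed.

Let anE n i y : (an n i - y) / en n = (al i - y) * n.+1%:R ^+ 2 + dl i * n.+1%:R.
Proof.
have n0 : n.+1%:R != 0 :> R by rewrite pnatr_eq0.
by rewrite /an /en; move: n.+1%:R n0 => m m0; field.
Qed.

Let cvg_atan_y (u : nat -> R) : u n @[n --> \oo] --> +oo -> atan (u n) @[n --> \oo] --> pi / 2.
Proof. by move=> h; apply: (cvg_comp _ _ h); exact: cvgy_atan. Qed.

Let cvg_atan_Ny (u : nat -> R) : (- u n) @[n --> \oo] --> +oo -> atan (u n) @[n --> \oo] --> - (pi / 2).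
Proof.
move=> /cvg_atan_y h; have -> : (fun n => atan (u n)) = (fun n => - atan (- u n)).
  by apply/funext => n; rewrite atanN opprK.
exact: cvgN.
Qed.

Let Ln_cvg i y : Ln n y i @[n --> \oo] --> 2 * pi * (\1_(`]al i, be i[%classic) y : R).
Proof.
rewrite -mulrA; apply: cvgMr.
have := ab i; have := dl0 i => dli abi.
rewrite indicE; have [ya|ya] := leP y (al i).
  rewrite memNset/=; last by rewrite in_itv/= ltNge ya.
  rewrite mulr0 -(subrr (pi / 2)); apply: cvgB; apply: cvg_atan_y.
    under eq_fun do rewrite bnE; apply: cvg_quad; left; lra.
  under eq_fun do rewrite anE; apply: cvg_quad.
  (* At y = al i only the linear term dl i (n + 1) remains, and it still sends both atan terms to pi
     / 2. *)
  by move: ya; rewrite le_eqVlt => /predU1P[->|ya]; [right; split => //; rewrite subrr|left; lra].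
have [yb|yb] := leP (be i) y.
  rewrite memNset/=; last by rewrite in_itv/= [_ < be i]ltNge yb andbF.
  rewrite mulr0 -(subrr (- (pi / 2))); apply: cvgB; apply: cvg_atan_Ny.
    under eq_fun do rewrite bnE opprD -!mulNr opprK; apply: cvg_quad.
    move: yb; rewrite le_eqVlt => /predU1P[e|{}yb]; [right|left; lra].
    by split; [rewrite e subrr oppr0|exact: dli].
  under eq_fun do rewrite anE opprD -!mulNr; apply: cvg_quad; left; lra.
rewrite mem_set/=; last by rewrite in_itv/= ya yb.
rewrite mulr1 [X in _ --> X]splitr -[X in _ --> _ + X]opprK; apply: cvgB.
  apply: cvg_atan_y; under eq_fun do rewrite bnE; apply: cvg_quad; left; lra.
apply: cvg_atan_Ny; under eq_fun do rewrite anE opprD -!mulNr; apply: cvg_quad; left; lra.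
Qed.

Let chi n (x : d.-tuple R) : R := \prod_i \1_(`[an n i, bn n i]%classic) (tnth x i).

Let mitv n i : measurable_fun setT (\1_(`[an n i, bn n i]%classic) : R -> R).
Proof. by apply: measurable_indic; exact: measurable_itv. Qed.

Let mchi n : measurable_fun setT (chi n).
Proof.
apply: measurable_prod => i _.
by apply: (@measurableT_comp _ _ _ _ _ _ (\1_(`[an n i, bn n i]%classic) : R -> R)) => //; exact: measurable_tnth.
Qed.

Let chi0 n x : 0 <= chi n x.
Proof. by apply: prodr_ge0 => i _; rewrite indicE. Qed.

Let chi_le n x : chi n x <= \1_(box al be) x.
Proof.
rewrite indic_box; apply: ler_prod => i _; rewrite !indicE ler0n/= ler_nat.
case: (boolP (tnth x i \in `[an n i, bn n i]%classic)) => //; rewrite inE/= in_itv/= => /andP[h1 h2].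
rewrite mem_set//= in_itv/= (lt_le_trans _ h1) ?(le_lt_trans h2)//.
  by rewrite /bn gtrBl divr_gt0.
by rewrite /an ltrDl divr_gt0.
Qed.

Let chi_cvg x : chi n x @[n --> \oo] --> (\1_(box al be) x : R).
Proof.
have inv0 (c : R) : (c / n.+1%:R : R) @[n --> \oo] --> 0.
  by rewrite -[X in _ --> X](mulr0 c); apply: cvgMr; exact: cvg_harmonic.
have [xB|xB] := pselect (box al be x); last first.
  have -> : (fun n => chi n x) = (fun=> 0).
    apply/funext => n; apply/le_anti; rewrite chi0 andbT (le_trans (chi_le n x))//.
    by rewrite indicE memNset.
  by rewrite indicE memNset//; exact: cvg_cst.
rewrite indicE mem_set//.
have : \forall n \near \oo, forall i : 'I_d, an n i <= tnth x i <= bn n i.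
  apply: filter_forall => i; have /andP[x1 x2] := xB i.
  have h1 : 0 < tnth x i - al i by rewrite subr_gt0.
  have h2 : 0 < be i - tnth x i by rewrite subr_gt0.
  near=> n; apply/andP; split.
    have : dl i / n.+1%:R < tnth x i - al i by near: n; exact: (cvgr_lt _ (inv0 _)).
    by rewrite /an -lerBrDl; exact: ltW.
  have : dl i / n.+1%:R < be i - tnth x i by near: n; exact: (cvgr_lt _ (inv0 _)).
  by rewrite /bn lerBrDr -lerBrDl; exact: ltW.
move=> hn; apply: cvg_near_cst; apply: filterS hn => n hn; apply/eqP; rewrite /chi big1// => i _.
by rewrite indicE mem_set//= in_itv/=; exact: hn.
Unshelve. all: by end_near. Qed.

Let Ln_abs n y i : `|Ln n y i| <= 2 * pi.
Proof.
rewrite /Ln normrM ger0_norm// ler_pM2l// ler_norml.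
have h1 := atan_gtNpi2 ((bn n i - y) / en n); have h2 := atan_ltpi2 ((bn n i - y) / en n).
have h3 := atan_gtNpi2 ((an n i - y) / en n); have h4 := atan_ltpi2 ((an n i - y) / en n).
apply/andP; split; lra.
Qed.

Let leb_int_chi_ker n y :
  leb_int (fun a => (chi n a * poisson_kernel (en n) a y)%:E) = (\prod_i Ln n (tnth y i) i)%:E.
Proof.
have := @leb_int_prod R d (fun i v => \1_(`[an n i, bn n i]%classic) v *
  (2 * (en n / (en n ^+ 2 + (v - tnth y i) ^+ 2)))) (fun i => Ln n (tnth y i) i) 1 ler01.
rewrite mul1r => <-.
- congr leb_int; apply/funext => a; rewrite mul1r /chi -big_split/=; congr EFin.
  apply: eq_bigr => i _; congr (_ * _); rewrite mulrA; congr (_ / (_ + _)).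
  by rewrite -sqrrN opprB.
- move=> i; apply: measurable_funM => //; apply: measurable_funM => //.
  by apply: continuous_measurable_fun; exact: continuous_cauchy.
- move=> i u; rewrite mulr_ge0 ?indicE// mulr_ge0// divr_ge0 ?(ltW (en0 n))//.
  by rewrite ltW// cauchy_den_gt0.
move=> i.
have mC : measurable_fun setT (fun v : R => (en n / (en n ^+ 2 + (v - tnth y i) ^+ 2))%:E).
  by apply/measurable_EFinP; apply: continuous_measurable_fun; exact: continuous_cauchy.
transitivity ((2 : R)%:E * \int[lebesgue_measure]_(v in `[an n i, bn n i])
  (en n / (en n ^+ 2 + (v - tnth y i) ^+ 2))%:E)%E; last first.
  by rewrite (integral_cauchy_itv _ (en0 n) (abn n i)) -EFinM.
rewrite -ge0_integralZl_EFin//=.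
- rewrite [RHS]integral_mkcond; apply: eq_integral => v _; rewrite patchE indicE; case: ifPn => _.
    by rewrite mul1r EFinM.
  by rewrite mul0r.
- move=> v _; rewrite lee_fin divr_ge0 ?(ltW (en0 n))//.
  by rewrite ltW// cauchy_den_gt0.
- exact: measurable_funTS.
Qed.

(** The double integral of chi_n(a) times the kernel between a and X is computed in both orders.
    Integrating in a first gives products of [Ln], which tend to (2 pi)^d times the indicator of the
    box; integrating over the sample space first gives chi_n times [smoothed], which tends to the
    right-hand integrand. Both limits are dominated. *)
Lemma box_prob : (((2 * pi) ^+ d)%:E * P (X @^-1` box al be) =
  leb_int (fun a => (\1_(box al be) a * char_inv a)%:E))%E.
Proof.
have mB := measurable_box al be.
have mXB : measurable (X @^-1` box al be) by rewrite -[X in measurable X]setTI; exact: mX.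
have mL n : measurable_fun setT (fun w => \prod_i Ln n (tnth (X w) i) i).
  apply: measurable_prod => i _; apply: measurable_funM => //.
  have mat (c : R) : measurable_fun setT (fun w => atan ((c - tnth (X w) i) / en n)).
    apply: (@measurableT_comp _ _ _ _ _ _ (fun v : R => atan ((c - v) / en n)) _ (fun w => tnth (X w) i)).
      apply: continuous_measurable_fun => v.
      apply: (@continuous_comp _ _ _ (fun v : R => (c - v) / en n)); last exact: continuous_atan.
      by apply: cvgMl; apply: cvgB; [exact: cvg_cst|exact: cvg_id].
    by apply: (@measurableT_comp _ _ _ _ _ _ (fun x : d.-tuple R => tnth x i)) => //; exact: measurable_tnth.
  by apply: measurable_funB.
have eq_n n : (\int[P]_w (\prod_i Ln n (tnth (X w) i) i)%:E =
    \int[leb_measure R d]_a ((chi n a)%:E * smoothed n a))%E.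
  pose f (p : d.-tuple R * T) := (chi n p.1 * poisson_kernel (en n) p.1 (X p.2))%:E.
  have f0 p : (0 <= f p)%E by rewrite lee_fin mulr_ge0// poisson_kernel_ge0.
  have mf : measurable_fun setT f.
    apply/measurable_EFinP; apply: measurable_funM; first exact: measurableT_comp.
    by apply: measurable_poisson_kernel2 => //; exact: measurableT_comp.
  transitivity (\int[P]_w \int[leb_measure R d]_a f (a, w))%E.
    apply: eq_integral => w _; rewrite -leb_int_chi_ker leb_intE//.
      apply/measurable_EFinP; apply: measurable_funM => //.
      by apply: measurable_poisson_kernel2 => //; exact: measurable_id.
    by move=> a; exact: (f0 (a, w)).
  rewrite -fubini_tonelli//; apply: eq_integral => a _.
  rewrite /smoothed -ge0_integralZl_EFin//.
  by move=> w _; rewrite lee_fin poisson_kernel_ge0.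
have mS n : measurable_fun setT (smoothed n).
  pose f (p : d.-tuple R * T) := (poisson_kernel (en n) p.1 (X p.2))%:E.
  apply: (@measurable_fun_fubini_tonelli_F _ _ _ _ R P f).
    by apply/measurable_EFinP; apply: measurable_poisson_kernel2 => //; exact: measurableT_comp.
  by move=> p; rewrite lee_fin poisson_kernel_ge0.
have lhs : (\int[P]_w (\prod_i Ln n (tnth (X w) i) i)%:E @[n --> \oo] -->
    \int[P]_w ((2 * pi) ^+ d * \1_(X @^-1` box al be) w)%:E)%E.
  apply: (@dominated_cvg _ _ _ P setT measurableT _ _ (cst ((2 * pi) ^+ d)%:E)) => //.
  - by move=> n; apply/measurable_EFinP.
  - move=> w _; apply: cvg_EFin; first exact: nearW.
    have -> : (\1_(X @^-1` box al be) w : R) = \1_(box al be) (X w) by rewrite !indicE.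
    rewrite indic_box -[X in X ^+ d]/(2 * pi) -[d in _ ^+ d](card_ord d) -prodr_const -big_split/=.
    by apply: cvg_big => [|i _]; [exact: mul_continuous|exact: Ln_cvg].
  - exact: finite_measure_integrable_cst.
  - move=> n w _; rewrite /= lee_fin normr_prod -[X in _ <= _ ^+ X](card_ord d) -prodr_const.
    by apply: ler_prod => i _; rewrite normr_ge0 Ln_abs.
have fin_box : (leb_measure R d (box al be) < +oo)%E.
  have -> : leb_measure R d (box al be) = leb_int (fun x => (1 * \prod_i (\1_(`]al i, be i[%classic) (tnth x i) : R))%:E).
    have h := @integral_indic _ _ R (leb_measure R d) setT measurableT _ mB.
    rewrite setIT in h; rewrite -h leb_intE.
    - by apply: eq_integral => x _; rewrite indic_box mul1r.
    - apply/measurable_EFinP; apply: measurable_funM => //; apply: measurable_prod => i _.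
      apply: (@measurableT_comp _ _ _ _ _ _ (\1_(`]al i, be i[%classic) : R -> R)); last exact: measurable_tnth.
      by apply: measurable_indic; exact: measurable_itv.
    - by move=> x; rewrite lee_fin mul1r; apply: prodr_ge0 => i _; rewrite indicE.
  rewrite (@leb_int_prod _ _ (fun i => \1_(`]al i, be i[%classic)) (fun i => be i - al i)) ?ltry//.
  move=> i; have h := @integral_indic _ _ R (@lebesgue_measure R) setT measurableT `]al i, be i[%classic (measurable_itv _).
  rewrite setIT in h; apply: etrans h _.
  by apply: etrans (lebesgue_measure_itv `](al i), (be i)[) _; rewrite /= lte_fin ab.
have rhs : (\int[leb_measure R d]_a ((chi n a)%:E * smoothed n a) @[n --> \oo] -->
    \int[leb_measure R d]_a (\1_(box al be) a * char_inv a)%:E)%E.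
  apply: (@dominated_cvg _ _ _ (leb_measure R d) setT measurableT _ _ (fun a => (I%:E * (\1_(box al be) a)%:E)%E)) => //.
  - by move=> n; apply: emeasurable_funM => //; apply/measurable_EFinP.
  - move=> a _; rewrite EFinM; apply: cvgeM => //.
    + by apply: cvg_EFin; [exact: nearW|exact: chi_cvg].
    + exact: smoothed_cvg.
  - apply: integrableZl => //; apply/integrableP; split; first exact/measurable_EFinP/measurable_indic.
    under eq_integral do rewrite /= ger0_norm ?indicE//.
    by rewrite integral_indic// setIT.
  - move=> n a _; rewrite abseM !gee0_abs ?smoothed_ge0 ?lee_fin// muleC.
    by apply: lee_pmul; rewrite ?smoothed_ge0 ?lee_fin ?smoothed_le// chi_le.
have -> : leb_int (fun a => (\1_(box al be) a * char_inv a)%:E) =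
    (\int[leb_measure R d]_a (\1_(box al be) a * char_inv a)%:E)%E.
  rewrite leb_intE//.
  - apply/measurable_EFinP; apply: measurable_funM; first exact: measurable_indic.
    exact: measurable_char_inv.
  - by move=> a; rewrite lee_fin mulr_ge0 ?indicE// char_inv_ge0.
have -> : (((2 * pi) ^+ d)%:E * P (X @^-1` box al be) =
    \int[P]_w ((2 * pi) ^+ d * \1_(X @^-1` box al be) w)%:E)%E.
  under eq_integral do rewrite EFinM.
  rewrite ge0_integralZl_EFin//.
  - by rewrite integral_indic// setIT.
  - exact/measurable_EFinP/measurable_indic.
  - by rewrite exprn_ge0// mulr_ge0// pi_ge0.
rewrite (_ : (fun n => _) = (fun n => \int[leb_measure R d]_a ((chi n a)%:E * smoothed n a))%E) in lhs; last first.
  by apply/funext => n; exact: eq_n.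
by rewrite -(cvg_lim _ lhs)// -(cvg_lim _ rhs).
Qed.

End one_box.
End inversion.
End charfun.

(** * Identification of the density *)

Lemma density_measure (R : realType) (dT : measure_display) (T : measurableType dT)
  (mu : {measure set T -> \bar R}) (f : T -> R) :
  measurable_fun setT f -> (forall x, 0 <= f x) ->
  exists nu : {measure set T -> \bar R},
    forall B, measurable B -> (nu B = \int[mu]_x (\1_B x * f x)%:E)%E.
Proof.
move=> mf f0; pose nu B := (\int[mu]_(x in B) (f x)%:E)%E.
have nu0 : nu set0 = 0%E by rewrite /nu integral_set0.
have nu_ge0 B : (0 <= nu B)%E by apply: integral_ge0 => x _; rewrite lee_fin.
have nu_additive : semi_sigma_additive nu.
  move=> F mF tF mUF; rewrite /nu ge0_integral_bigcup//.
  - apply: is_cvg_ereal_nneg_natsum_cond => n _ _; exact: nu_ge0.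
  - by apply/measurable_EFinP; exact: measurable_funTS.
  - by move=> x _; rewrite lee_fin.
exists (HB.pack_for {measure set T -> \bar R} nu
  (isMeasure.Build _ _ _ nu nu0 nu_ge0 nu_additive)) => B mB /=.
rewrite /nu integral_mkcond; apply: eq_integral => x _; rewrite patchE indicE.
by case: ifPn => _; rewrite ?mul1r ?mul0r.
Qed.

Section boxes.
Variables (R : realType) (d : nat).
Implicit Types al be : 'I_d -> R.

Let G : set (set (d.-tuple R)) := [set B | exists al be, B = box al be].

Lemma box_setI al be al' be' :
  box al be `&` box al' be' = box (fun i => Num.max (al i) (al' i)) (fun i => Num.min (be i) (be' i)).
Proof.
apply/seteqP; split => x.
  by move=> [h h'] i; rewrite gt_max lt_min; have /andP[-> ->] := h i; have /andP[-> ->] := h' i.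
move=> h; split => i; have := h i; rewrite gt_max lt_min => /andP[/andP[a1 a2] /andP[b1 b2]].
  by rewrite a1.
by rewrite a2.
Qed.

Lemma exists_nat_box (x : d.-tuple R) : exists n : nat, forall i, - n%:R < tnth x i < n%:R.
Proof.
have h i : `|tnth x i| <= \sum_j `|tnth x j|.
  by rewrite (bigD1 i)//= lerDl sumr_ge0.
exists (Num.truncn (\sum_j `|tnth x j|)).+1 => i; rewrite -ltr_norml.
by apply: le_lt_trans (h i) _; rewrite truncnS_gt.
Qed.

(** A half-line in one coordinate is a countable union of boxes, so the coordinates, and with them
    the identity, are measurable for the sigma-algebra generated by boxes. *)
Lemma measurable_boxE : @measurable _ (d.-tuple R) = <<s G >>.
Proof.
apply/seteqP; split => [B mB|]; last first.
  apply: smallest_sub; first exact: sigma_algebra_measurable.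
  by move=> _ [al [be ->]]; exact: measurable_box.
have mid : measurable_fun setT (fun x : g_sigma_algebraType G => (x : d.-tuple R)).
  apply/measurable_fun_tnthP => i mT.
  apply: (measurability _ (RGenOInfty.measurableE R)) => //.
  move=> _ [_ [a ->] <-]; rewrite setTI.
  have -> : (@tnth d R ^~ i \o (fun x : g_sigma_algebraType G => (x : d.-tuple R))) @^-1` `]a, +oo[%classic =
    \bigcup_n box (fun j => if j == i then a else - n%:R) (fun=> n%:R).
    apply/seteqP; split => x /=; rewrite in_itv/= andbT.
      move=> ax; have [n hn] := exists_nat_box x; exists n => // j.
      by have /andP[h1 h2] := hn j; rewrite h2 andbT; case: eqP => // ->.
    by move=> [n _ /(_ i)]; rewrite eqxx => /andP[].
  apply: bigcupT_measurable => n; apply: sub_sigma_algebra.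
  by exists (fun j => if j == i then a else - n%:R), (fun=> n%:R).
by have := mid measurableT B mB; rewrite setTI.
Qed.

(** Boxes form a generating class stable under intersection that exhausts the space. Equality is
    only asked for al < be, the case treated by the atan limits; all other boxes are empty. *)
Lemma box_measure_unique (m1 m2 : {measure set (d.-tuple R) -> \bar R}) :
  (forall al be, (forall i, al i < be i) -> m1 (box al be) = m2 (box al be)) ->
  (forall al be, m1 (box al be) < +oo)%E ->
  forall B, measurable B -> m1 B = m2 B.
Proof.
move=> m12 m1oo B mB.
apply: (@measure_unique _ R _ G (fun n => box (fun=> - n%:R) (fun=> n%:R))) => //.
- exact: measurable_boxE.
- move=> _ _ [al [be ->]] [al' [be' ->]]; rewrite box_setI.
  by eexists; eexists; reflexivity.
- by move=> n; eexists; eexists; reflexivity.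
- apply/seteqP; split => // x _; have [n hn] := exists_nat_box x.
  by exists n.
move=> _ [al [be ->]]; have [ab|] := pselect (forall i, al i < be i); first exact: m12.
move=> /existsNP[i /negP]; rewrite -leNgt => ba.
suff -> : box al be = set0 by rewrite !measure0.
apply/seteqP; split => // x /(_ i) /andP[h1 h2].
by have := lt_trans h1 h2; rewrite ltNge ba.
Qed.

End boxes.

Section density.
Variables (R : realType) (d : nat).
Variables (dT : measure_display) (T : measurableType dT) (P : probability T R).
Variables (X : T -> d.-tuple R) (mX : measurable_fun setT X).
Variables (E th : d.-tuple R -> R).
Hypothesis E0 : forall z, 0 <= E z.
Hypothesis mE : measurable_fun setT E.
Hypothesis hc : forall z, (\int[P]_w (cos (ip z (X w)))%:E = (E z * cos (th z))%:E)%E.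
Hypothesis hs : forall z, (\int[P]_w (sin (ip z (X w)))%:E = (- (E z * sin (th z)))%:E)%E.

Lemma char_inversion (K : R) :
  (leb_int (fun z => (E z)%:E) <= K%:E)%E ->
  exists p : d.-tuple R -> R,
    [/\ measurable_fun setT p, forall x, 0 <= p x,
        forall B, measurable B -> P (X @^-1` B) = leb_int (fun x => (\1_B x * p x)%:E) &
        forall x, p x <= K / (2 * pi) ^+ d].
Proof.
move=> EK; have IE : (leb_int (fun z => (E z)%:E) < +oo)%E by rewrite (le_lt_trans EK)// ltry.
have c0 : 0 < (2 * pi) ^+ d :> R by rewrite exprn_gt0// mulr_gt0// pi_gt0.
pose p x := char_inv E th x / (2 * pi) ^+ d.
have p0 x : 0 <= p x by rewrite divr_ge0 ?(ltW c0)// (char_inv_ge0 mX E0 mE hc hs).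
have mp : measurable_fun setT p.
  by apply: measurable_funM => //; exact: (measurable_char_inv mX E0 mE hc hs).
have mBp B : measurable B -> measurable_fun setT (fun x => (\1_B x * p x)%:E).
  by move=> mB; apply/measurable_EFinP; apply: measurable_funM => //; exact: measurable_indic.
have Bp0 B x : (0 <= (\1_B x * p x)%:E)%E by rewrite lee_fin mulr_ge0 ?indicE.
exists p; split => //; last first.
  move=> x; rewrite ler_pM2r ?invr_gt0//; apply: le_trans (char_inv_le mX E0 mE hc hs IE x) _.
  by rewrite -lee_fin -(leb_int_charE E0 mE IE).
have [nu nuE] := density_measure (leb_measure R d) mp p0.
move=> B mB; rewrite leb_intE//; [rewrite -nuE//|exact: mBp].
pose m1 : {measure set (d.-tuple R) -> \bar R} :=
  measure_function_pushforward__canonical__measure_function_Measure P mX.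
apply: (@box_measure_unique _ _ m1 nu) => // [al be ab|al be]; last first.
  apply: (@le_lt_trans _ _ 1%E); last exact: ltry.
  by apply: probability_le1; rewrite -[X in measurable X]setTI; apply: mX => //; exact: measurable_box.
rewrite nuE; last exact: measurable_box.
rewrite -leb_intE//; last by apply: mBp; exact: measurable_box.
have h := box_prob mX E0 mE hc hs IE ab.
have hZ : leb_int (fun x => (\1_(box al be) x * p x)%:E) =
    (((2 * pi) ^+ d)^-1%:E * leb_int (fun x => (\1_(box al be) x * char_inv E th x)%:E))%E.
  rewrite -leb_intZ ?invr_ge0 ?(ltW c0)//.
  - by congr leb_int; apply/funext => x; rewrite /p; congr EFin; ring.
  - apply: measurable_funM; first by apply: measurable_indic; exact: measurable_box.
    exact: (measurable_char_inv mX E0 mE hc hs).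
  - by move=> x; rewrite mulr_ge0 ?indicE// (char_inv_ge0 mX E0 mE hc hs).
by rewrite hZ -h muleA -EFinM mulVf ?lt0r_neq0// mul1e.
Qed.

End density.

Lemma bounded_density_le_leb_measure (R : realType) (d : nat) (dT : measure_display)
  (T : measurableType dT) (P : probability T R) (X : T -> d.-tuple R) (p : d.-tuple R -> R) (M : R) :
  0 <= M -> measurable_fun setT p -> (forall x, 0 <= p x) ->
  (forall x, p x <= M) ->
  (forall B, measurable B -> P (X @^-1` B) = leb_int (fun x => (\1_B x * p x)%:E)) ->
  forall B, measurable B -> (P (X @^-1` B) <= M%:E * leb_measure R d B)%E.
Proof.
move=> M0 mp p0 pM pE B mB; rewrite pE//.
have mI : measurable_fun setT (\1_B : d.-tuple R -> R) by exact: measurable_indic.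
have -> : leb_measure R d B = leb_int (fun x => (\1_B x)%:E).
  rewrite leb_intE; [by rewrite integral_indic// setIT|exact/measurable_EFinP|].
  by move=> x; rewrite lee_fin indicE.
rewrite -leb_intZ//.
apply: le_leb_int => //.
- exact: measurable_funM.
- exact: measurable_funM.
- by move=> x; rewrite mulr_ge0 ?indicE.
- by move=> x; rewrite mulrC ler_wpM2r ?indicE.
Qed.

(** * Densities and the exponential integral *)

Section main_equivalences.
Variables (R : realType) (d : nat) (dT : measure_display) (T : measurableType dT).
Variables (P : probability T R) (Y : R -> {RV P >-> d.-tuple R}).
Variables (A : 'M[R]_d) (N : {measure set (d.-tuple R) -> \bar R}) (b : d.-tuple R).
Hypotheses (symA : sym_nonneg_def A) (levyN : levy_measure N).
Hypothesis charY : has_char_exponent Y A N b.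
Hypothesis hoo : hfun A N r @[r --> 0^'+] --> +oo.

Definition D1 := exists T1 c1 : R, 0 < T1 /\ 0 < c1 /\
  forall t : R, T1 < t -> exists p : d.-tuple R -> R,
    [/\ measurable_fun setT p, (forall x, 0 <= p x),
        (forall B : set (d.-tuple R), measurable B ->
           P (Y t @^-1` B) = leb_int (fun x => (\1_B x * p x)%:E)) &
        (forall x, p x <= c1 * (hinv A N t^-1) ^- d)].

Let twopi : 0 < (2 * pi) ^+ d :> R.
Proof. by rewrite exprn_gt0// mulr_gt0// pi_gt0. Qed.

Lemma D2_D1 : D2 A N -> D1.
Proof.
move=> [T2 [c2 [T20 [c20 h]]]]; exists T2, (c2 / (2 * pi) ^+ d); split => //.
split=> [|t Tt]; first by rewrite divr_gt0.
have t0 : 0 <= t by rewrite ltW// (lt_trans T20).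
have [p [mp p0 pE pM]] := char_inversion (@measurable_funPT _ _ _ _ (Y t))
  (fun z => expR_ge0 _) (measurable_expRePsi A levyN t)
  (fun z => (charY t0 z).1) (fun z => (charY t0 z).2) (h t Tt).
by exists p; split => // x; rewrite mulrAC.
Qed.

(** The Plancherel bound controls the integral of |exp(-t Psi)|^2 = exp(-2 t Re Psi), hence the
    doubled time. *)
Lemma density_PsiIntegral t M : 0 <= t -> 0 <= M ->
  (exists p : d.-tuple R -> R,
    [/\ measurable_fun setT p, (forall x, 0 <= p x),
        (forall B : set (d.-tuple R), measurable B ->
           P (Y t @^-1` B) = leb_int (fun x => (\1_B x * p x)%:E)) &
        (forall x, p x <= M)]) ->
  (PsiIntegral A N (2 * t) <= (M * (2 * pi) ^+ d)%:E)%E.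
Proof.
move=> t0 M0 [p [mp p0 pE pM]].
have dom := bounded_density_le_leb_measure M0 mp p0 pM pE.
have := leb_int_sqr_char_le (@measurable_funPT _ _ _ _ (Y t))
  (fun z => expR_ge0 _) (measurable_expRePsi A levyN t)
  (fun z => (charY t0 z).1) (fun z => (charY t0 z).2) M0 dom.
apply: le_trans; rewrite /PsiIntegral le_eqVlt; apply/orP; left; apply/eqP.
congr leb_int; apply/funext => z; rewrite expr2 -expRD; congr (expR _)%:E; ring.
Qed.

Lemma D1_D2 : D1 -> D2 A N.
Proof.
have d0 := dim_gt0 symA levyN hoo.
have dR : 0 < d%:R :> R by rewrite ltr0n.
move=> [T1 [c1 [T10 [c10 h]]]].
pose C := c1 * (2 * pi) ^+ d.
have C0 : 0 < C by rewrite mulr_gt0.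
have hC t : T1 < t -> (PsiIntegral A N (2 * t) <= (C * (hinv A N t^-1) ^- d)%:E)%E.
  move=> Tt; have t0 : 0 < t by exact: lt_trans Tt.
  have hi0 : 0 < hinv A N t^-1 by apply: hinv_gt0 => //; rewrite invr_gt0.
  have M0 : 0 <= c1 * (hinv A N t^-1) ^- d by rewrite mulr_ge0 ?(ltW c10)// invr_ge0 exprn_ge0// ltW.
  by have := density_PsiIntegral (ltW t0) M0 (h t Tt); rewrite /C mulrAC.
have hinv_double t : T1 < t ->
    (hinv A N (2 / t)) ^- d <= d%:R ^+ d * expR 32 * C * (hinv A N t^-1) ^- d.
  move=> Tt; have t0 : 0 < t by exact: lt_trans Tt.
  have s0 : 0 < 2 / t by rewrite divr_gt0.
  have hi0 := hinv_gt0 symA levyN hoo s0.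
  have r0 : 0 < (hinv A N (2 / t))^-1 by rewrite invr_gt0.
  have tt0 : 0 <= 2 * t by rewrite mulr_ge0// ltW.
  have := le_trans (leb_int_expRePsi_ge_ball symA levyN d0 tt0 r0) (hC t Tt).
  rewrite invrK lee_fin => hb.
  have hle := hfun_hinv_le symA levyN hoo s0.
  have he : expR (- 32) <= expR (- (2 * t * (2 * hfun A N (hinv A N (2 / t))))).
    rewrite ler_expR lerN2.
    (* The exponent at time 2t and radius h^{-1}(2/t): a factor 2 from Re Psi <= 2 h, a factor 4
       from h(h^{-1}(s)) <= 4 s with s = 2 / t. *)
    have -> : 32 = 2 * t * (2 * (4 * (2 / t))) :> R by field; exact: lt0r_neq0.
    by rewrite ler_wpM2l// ler_wpM2l.
  have hp : 0 <= ((hinv A N (2 / t))^-1 / d%:R) ^+ d by rewrite exprn_ge0// divr_ge0// ltW.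
  have hb2 := le_trans (ler_wpM2l hp he) hb.
  rewrite -[_ * C * _]mulrA -[_ * expR 32 * _]mulrA -ler_pdivrMl ?exprn_gt0//.
  rewrite -ler_pdivrMl ?expR_gt0// -expRN; apply: le_trans hb2.
  by rewrite mulrC expr_div_n exprVn [X in X * _ <= _]mulrC.
(* For time s, apply the bound at t = s / 2; one factor C comes from this bound and the other from
   comparing h^{-1}(2/s) with h^{-1}(1/s). *)
exists (2 * T1), (C * (d%:R ^+ d * expR 32 * C)); split; first by rewrite mulr_gt0.
split.
  apply: mulr_gt0 => //; apply: mulr_gt0 => //; apply: mulr_gt0; last exact: expR_gt0.
  exact: exprn_gt0.
move=> s Ts; have Ts2 : T1 < s / 2 by rewrite ltr_pdivlMr// mulrC.
have s0 : 0 < s by apply: lt_trans Ts; rewrite mulr_gt0.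
have := hC _ Ts2; rewrite mulrC divfK// invf_div => /le_trans; apply.
rewrite lee_fin -[leRHS]mulrA ler_pM2l//; apply: hinv_double.
by apply: lt_trans Ts; rewrite ltr_pMl// ltr1n.
Qed.

End main_equivalences.

Theorem theorem3p6 (R : realType) (d : nat)
  (dT : measure_display) (T : measurableType dT) (P : probability T R)
  (Y : R -> {RV P >-> d.-tuple R})
  (A : 'M[R]_d) (N : {measure set (d.-tuple R) -> \bar R}) (b : d.-tuple R) :
  sym_nonneg_def A ->
  levy_measure N ->
  has_char_exponent Y A N b ->
  (* standing assumption h(0+) = oo *)
  hfun A N r @[r --> 0^'+] --> +oo ->
  [<->
  (* (D1) *)
   exists T1 c1 : R, 0 < T1 /\ 0 < c1 /\
     forall t : R, T1 < t ->
       exists p : d.-tuple R -> R,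
         [/\ measurable_fun setT p, (forall x, 0 <= p x),
             (forall B : set (d.-tuple R), measurable B ->
                P (Y t @^-1` B) = leb_int (fun x => (\1_B x * p x)%:E)) &
             (forall x, p x <= c1 * (hinv A N t^-1) ^- d)];
  (* (D2) *)
   exists T2 c2 : R, 0 < T2 /\ 0 < c2 /\
     forall t : R, T2 < t ->
       (leb_int (fun z => (expR (- (t * RePsi A N z)))%:E)
          <= (c2 * (hinv A N t^-1) ^- d)%:E)%E;
  (* (D3) *)
   (exists T3 c3 alpha3 : R, [/\ 0 < T3, 0 < c3 <= 1, 0 < alpha3 <= 2,
      (forall x : d.-tuple R, vnorm x < T3^-1 ->
         c3 * PsiStar A N (vnorm x) <= RePsi A N x) &
      (forall lambda r : R, 0 < lambda <= 1 -> 0 < r < T3^-1 ->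
         PsiStar A N (lambda * r) <= c3^-1 * lambda `^ alpha3 * PsiStar A N r)])
   /\ (exists t0 : R, 0 < t0 /\
        (leb_int (fun z : d.-tuple R => (expR (- (t0 * RePsi A N z)))%:E) < +oo)%E);
  (* (D4) *)
   (exists T4 c4 : R, [/\ 0 < T4, 1 <= c4 &
      forall x : d.-tuple R, vnorm x < T4^-1 ->
        ((PsiStar A N (vnorm x))%:E
          <= c4%:E * ((quadA A x)%:E
                      + \int[N]_(z in [set z | (`|ip x z| < 1)%R]) ((ip x z) ^+ 2)%:E))%E])
   /\ (exists t0 : R, 0 < t0 /\
        (leb_int (fun z : d.-tuple R => (expR (- (t0 * RePsi A N z)))%:E) < +oo)%E)
  ].
Proof.
move=> symA levyN charY hoo; tfae.
- exact: (D1_D2 symA levyN charY hoo).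
- exact: (D2_D3 symA levyN hoo).
- move=> [h3 hL]; split => //.
  have [T4 [c4 [T40 c41 h4]]] := D3_D4 symA levyN h3.
  by exists T4, c4; split => // x xT; rewrite UfunE// -EFinM lee_fin h4.
(* The cycle is closed from (D4) to (D1) by way of (D2), since the density is recovered from the
   integrability of exp(-t Psi). *)
- move=> [[T4 [c4 [T40 c41 h4]]] hL]; apply: (D2_D1 levyN charY).
  apply: (D4_D2 symA levyN hoo) => //; exists T4, c4; split => // x xT.
  by have := h4 x xT; rewrite UfunE// -EFinM lee_fin.
Qed.
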